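(* Let $\gamma\in(0,1)$. For each $N\ge 1$ let $\beta=\beta_N>0$ and $M=M_N>N-1$ be real parameters with $N/M\to\gamma$ as $N\to\infty$, let $(\lambda_1,\dots,\lambda_N)$ be distributed according to the $\beta$-Laguerre ensemble with parameters $(N,M,\beta)$, and let $L_N=N^{-1}\sum_{i=1}^N\delta_{\lambda_i}$ be its empirical distribution. (i) If $\beta N\to\infty$ as $N\to\infty$, then $L_N$ converges weakly to the Marchenko--Pastur distribution with parameter $\gamma$, almost surely. (ii) If $\beta N\to 2c$ as $N\to\infty$ with $c\in(0,\infty)$, then $L_N$ converges weakly to the probability measure $\nu_{\gamma,c}$, almost surely.
   Context: The $\beta$-Laguerre ensemble with parameters $N\ge1$, $\beta>0$, $M>N-1$ is the ensemble of $N$ positive particles with joint probability density $$\frac{1}{Z_{N,M}^{(\beta)}}\prod_{i<j}|\lambda_j-\lambda_i|^\beta\prod_{i=1}^N\left(\lambda_i^{\frac{\beta}{2}(M-N+1)-1}e^{-\frac{\beta M}{2}\lambda_i}\right),\quad \lambda_i>0,$$ where $Z_{N,M}^{(\beta)}$ is the normalizing constant. The random variables for different $N$ are defined on a common probability space (no assumption is made on their joint law over different $N$). ''$L_N$ converges weakly to $\mu$ almost surely'' means: almost surely, $\frac1N\sum_{i=1}^N f(\lambda_i)\to\int f\,d\mu$ as $N\to\infty$ for every bounded continuous $f$. The Marchenko--Pastur distribution with parameter $\gamma\in(0,1)$ has density $mp_\gamma(x)=\frac{1}{2\pi\gamma x}\sqrt{(\lambda_+-x)(x-\lambda_-)}$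 on $\lambda_-<x<\lambda_+$, where $\lambda_\pm=(1\pm\sqrt\gamma)^2$. The spectral measure of an infinite Jacobi (symmetric tridiagonal) matrix $J$ with positive off-diagonal entries is the probability measure $\mu$ on $\mathbb{R}$ with $\int x^k\,d\mu(x)=J^k(1,1)$ for all $k=0,1,2,\dots$, when this moment problem has a unique solution (this is the case for the matrix below). For $c\in(0,\infty)$, $\nu_{\gamma,c}$ is the spectral measure of $\frac{\gamma}{c}WW^t$, where $W$ is the infinite lower bidiagonal matrix with diagonal entries $W(i,i)=\sqrt{\frac{c}{\gamma}+i-1}$ and sub-diagonal entries $W(i+1,i)=\sqrt{c+i}$, $i=1,2,\dots$, all other entries being zero. *)

(* Defs.v *)
From HB Require Import structures.
From mathcomp Require Export all_boot all_order all_algebra.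
From mathcomp Require Export all_classical all_reals all_analysis.
From mathcomp Require Export measurable_realfun.
Set Implicit Arguments.
Unset Strict Implicit.
Unset Printing Implicit Defensive.
Import Order.TTheory GRing.Theory Num.Theory.
Import numFieldNormedType.Exports.
Local Open Scope classical_set_scope.
Local Open Scope ring_scope.

Lemma sigma_finite_product d1 d2 (T1 : measurableType d1) (T2 : measurableType d2)
    (R : realType) (m1 : {sigma_finite_measure set T1 -> \bar R})
    (m2 : {sigma_finite_measure set T2 -> \bar R}) :
  sigma_finite setT (m1 \x m2)%E.
Proof.
have /sigma_finiteP[F [TF ndF Foo]] := sigma_finiteT m1.
have /sigma_finiteP[G [TG ndG Goo]] := sigma_finiteT m2.
exists (fun n => F n `*` G n).
  rewrite -setXTT TF TG predeqE => -[x y]; split.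
    move=> [/= [n _ Fnx] [k _ Gky]]; exists (maxn n k) => //; split.
    - by move: x Fnx; exact/subsetPset/ndF/leq_maxl.
    - by move: y Gky; exact/subsetPset/ndG/leq_maxr.
  by move=> [n _ []/= ? ?]; split; exists n.
move=> k; have [? ?] := Foo k; have [? ?] := Goo k.
split; first exact: measurableX.
by rewrite product_measure1E// lte_mul_pinfty// ge0_fin_numE.
Qed.

Section lebesgue_tuple.
Context {R : realType}.

Definition cons_pair n (p : measurableTypeR R * n.-tuple R) : n.+1.-tuple R :=
  [tuple of p.1 :: p.2].

Lemma measurable_cons_pair n : measurable_fun setT (@cons_pair n).
Proof. exact: (measurable_cons measurable_fst measurable_snd). Qed.

Section step.
Variables (n : nat) (m : {sigma_finite_measure set (n.-tuple R) -> \bar R}).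

Definition lebesgue_tuple_step : set (n.+1.-tuple R) -> \bar R :=
  pushforward (lebesgue_measure \x m)%E (@cons_pair n).

Let step0 : lebesgue_tuple_step set0 = 0%E.
Proof. by rewrite /lebesgue_tuple_step /pushforward preimage_set0 measure0. Qed.

Let step_ge0 A : (0 <= lebesgue_tuple_step A)%E.
Proof. by rewrite /lebesgue_tuple_step /pushforward measure_ge0. Qed.

Let step_sigma_additive : semi_sigma_additive lebesgue_tuple_step.
Proof.
move=> F mF tF mUF; rewrite /lebesgue_tuple_step /pushforward preimage_bigcup.
apply: measure_semi_sigma_additive.
- by move=> k; rewrite -[X in measurable X]setTI; exact: measurable_cons_pair.
- apply/trivIsetP => /= i j _ _ ij; rewrite -preimage_setI.
  by move/trivIsetP : tF => /(_ _ _ _ _ ij) ->//; rewrite preimage_set0.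
- by rewrite -preimage_bigcup -[X in measurable X]setTI; exact: measurable_cons_pair.
Qed.

HB.instance Definition _ := isMeasure.Build _ _ _
  lebesgue_tuple_step step0 step_ge0 step_sigma_additive.

Let step_sigma_finite : sigma_finite setT lebesgue_tuple_step.
Proof.
have [F UF mF] := sigma_finite_product lebesgue_measure m.
pose u (t : n.+1.-tuple R) : measurableTypeR R * n.-tuple R :=
  (thead t, [tuple of behead t]).
have uK : cancel (@cons_pair n) u.
  by case=> x t; rewrite /u /cons_pair theadE; congr pair; exact/val_inj.
have mu : measurable_fun setT u.
  apply: measurable_fun_pair; last exact: measurable_behead.
  exact: (@measurable_tnth _ (measurableTypeR R)).
exists (fun k => u @^-1` F k).
  by rewrite -preimage_bigcup -UF preimage_setT.
move=> k; have [mFk Fkoo] := mF k; split.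
  by rewrite -[_ @^-1` _]setTI; exact: mu.
rewrite /lebesgue_tuple_step /pushforward -comp_preimage.
by rewrite (_ : u \o _ = id) ?preimage_id//; apply/funext => p /=; rewrite uK.
Qed.

HB.instance Definition _ :=
  Measure_isSigmaFinite.Build _ _ _ lebesgue_tuple_step step_sigma_finite.

End step.

(* Lebesgue measure on R^n (represented as n.-tuple R), as an iterated product
   measure. *)
Fixpoint lebesgue_tuple n : {sigma_finite_measure set (n.-tuple R) -> \bar R} :=
  if n is k.+1 then lebesgue_tuple_step (lebesgue_tuple k)
  else \d_([tuple] : 0.-tuple R).

End lebesgue_tuple.

Section laguerre.
Context {R : realType}.
Variables (N : nat) (beta M : R).

Definition laguerre_weight (x : N.-tuple R) : R :=
  if [forall i, 0 < tnth x i] then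
    (\prod_(p : 'I_N * 'I_N | (p.1 < p.2)%N)
       `|tnth x p.2 - tnth x p.1| `^ beta) *
    \prod_(i < N)
      (tnth x i `^ (beta / 2 * (M - N%:R + 1) - 1) *
       expR (- (beta * M / 2 * tnth x i)))
  else 0.

Definition laguerre_Z : R := \int[lebesgue_tuple N]_x laguerre_weight x.

Definition laguerre_pdf (x : N.-tuple R) : R := laguerre_Z^-1 * laguerre_weight x.

Definition laguerre_ensemble d (T : measurableType d) (P : probability T R)
    (lambda : {RV P >-> N.-tuple R}) : Prop :=
  forall B : set (N.-tuple R), measurable B ->
    distribution P lambda B =
    (\int[lebesgue_tuple N]_(x in B) (laguerre_pdf x)%:E)%E.

End laguerre.

Section empirical.
Context {R : realType}.

Definition empirical_measure n (x : n.-tuple R) : set (measurableTypeR R) -> \bar R :=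
  mscale (n%:R^-1)%:nng
    (msum (fun k => \d_(nth 0 x k : measurableTypeR R)) n).

HB.instance Definition _ n (x : n.-tuple R) := Measure.on (empirical_measure x).

Definition cvg_weakly (mu_ : nat -> {measure set (measurableTypeR R) -> \bar R})
    (mu : {measure set (measurableTypeR R) -> \bar R}) : Prop :=
  forall f : R -> R, continuous f -> bounded_fun f ->
    (\int[mu_ n]_x (f x)%:E)%E @[n --> \oo] --> (\int[mu]_x (f x)%:E)%E.

End empirical.

Section marchenko_pastur.
Context {R : realType}.
Variable gamma : R.

Definition mp_lo : R := (1 - Num.sqrt gamma) ^+ 2.
Definition mp_hi : R := (1 + Num.sqrt gamma) ^+ 2.

Definition mp_pdf (x : R) : R :=
  if (mp_lo < x) && (x < mp_hi) then
    (2 * pi * gamma * x)^-1 * Num.sqrt ((mp_hi - x) * (x - mp_lo))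
  else 0.

Let mp_denom_ge0 x : mp_lo < x -> x < mp_hi -> 0 <= 2 * pi * gamma * x.
Proof.
move=> lox xhi.
have x0 : 0 < x by apply: le_lt_trans lox; exact: sqr_ge0.
rewrite mulr_ge0 ?(ltW x0)// !mulr_ge0 ?pi_ge0// leNgt; apply/negP => g0.
move: (lt_trans lox xhi).
by rewrite /mp_lo /mp_hi ler0_sqrtr ?(ltW g0)// subr0 addr0 ltxx.
Qed.

Lemma mp_pdf_ge0 x : 0 <= mp_pdf x.
Proof.
rewrite /mp_pdf; case: ifPn => // /andP[lox xhi].
by rewrite mulr_ge0 ?sqrtr_ge0// invr_ge0 mp_denom_ge0.
Qed.

Lemma measurable_mp_pdf : measurable_fun setT mp_pdf.
Proof.
rewrite (_ : mp_pdf = fun x => if (mp_lo < x) && (x < mp_hi) then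
    (2 * pi * gamma * x) `^ (-1) * Num.sqrt ((mp_hi - x) * (x - mp_lo))
    else 0); last first.
  apply/funext => x; rewrite /mp_pdf; case: ifPn => // /andP[lox xhi].
  by rewrite powR_inv1// mp_denom_ge0.
apply: measurable_fun_ifT => //.
  by apply: measurable_and; exact: measurable_fun_ltr.
apply: measurable_funM.
  apply: (measurableT_comp (measurable_powR _)).
  exact: measurable_funM.
have msqrt : measurable_fun setT (Num.sqrt : R -> R).
  by apply: continuous_measurable_fun; exact: sqrt_continuous.
have mquad : measurable_fun setT (fun x : R => (mp_hi - x) * (x - mp_lo)).
  by apply: measurable_funM; exact: measurable_funB.
exact: (measurableT_comp msqrt mquad).
Qed.

Definition marchenko_pastur (A : set (measurableTypeR R)) : \bar R :=
  (\int[lebesgue_measure]_(x in A) (mp_pdf x)%:E)%E.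

Let mp0 : marchenko_pastur set0 = 0%E.
Proof. exact: integral_set0. Qed.

Let mp_ge0 A : (0 <= marchenko_pastur A)%E.
Proof. by apply: integral_ge0 => x _; rewrite lee_fin mp_pdf_ge0. Qed.

Let mp_sigma_additive : semi_sigma_additive marchenko_pastur.
Proof.
move=> A mA tA mUA; rewrite /marchenko_pastur ge0_integral_bigcup//=.
- apply: is_cvg_ereal_nneg_natsum_cond => n _ _; exact: mp_ge0.
- apply/measurable_EFinP; apply: measurable_funTS; exact: measurable_mp_pdf.
- by move=> x _; rewrite lee_fin mp_pdf_ge0.
Qed.

HB.instance Definition _ :=
  isMeasure.Build _ _ _ marchenko_pastur mp0 mp_ge0 mp_sigma_additive.

End marchenko_pastur.

Section infinite_matrices.
Context {R : realType}.

(* Rows and columns are indexed from 0. *)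
Definition imatrix := nat -> nat -> R.

(* The sum has finite support for all matrices multiplied below, which have
   finitely many nonzero entries in each row and in each column. *)
Definition imul (A B : imatrix) : imatrix :=
  fun i j => \sum_(k \in [set: nat]) (A i k * B k j).

Definition iexp (A : imatrix) (n : nat) : imatrix :=
  iter n (imul A) (fun i j => (i == j)%:R).

Definition itr (A : imatrix) : imatrix := fun i j => A j i.

Definition iscale (a : R) (A : imatrix) : imatrix := fun i j => a * A i j.

Definition has_moments_of (J : imatrix) (mu : probability (measurableTypeR R) R) :=
  forall k : nat,
    mu.-integrable setT (fun x : R => (x ^+ k)%:E) /\
    (\int[mu]_x (x ^+ k)%:E = (iexp J k 0 0)%:E)%E.

(* Uniqueness is on measurable sets only, because elements of [probability]
   also carry irrelevant values on non-measurable sets. *)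
Definition is_spectral_measure (J : imatrix) : set (probability (measurableTypeR R) R) :=
  [set mu | has_moments_of J mu /\
    forall nu, has_moments_of J nu ->
      forall A, measurable A -> nu A = mu A].

(* The Dirac mass is a dummy value, used when the moment problem of J does not
   have a unique solution. *)
Definition spectral_measure (J : imatrix) : probability (measurableTypeR R) R :=
  xget (\d_(0 : measurableTypeR R) : probability (measurableTypeR R) R)
    (is_spectral_measure J).

(* With 1-based indices: W(i, i) = sqrt (c / gamma + i - 1) and
   W(i + 1, i) = sqrt (c + i). *)
Definition laguerre_W (gamma c : R) : imatrix := fun i j =>
  if i == j then Num.sqrt (c / gamma + i%:R)
  else if i == j.+1 then Num.sqrt (c + i%:R)
  else 0.

Definition nu_spectral (gamma c : R) : probability (measurableTypeR R) R :=
  spectral_measure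
    (iscale (gamma / c) (imul (laguerre_W gamma c) (itr (laguerre_W gamma c)))).

End infinite_matrices.

(* Main.v *)
From HB Require Import structures.
Require Import Defs.
From mathcomp Require Import ring lra zify.

(** Weak convergence is deduced from the almost sure convergence of every
    empirical moment, in three steps.

    Moments. The substitution x -> x + s x^(k+1) in all coordinates preserves
    the positive orthant and multiplies the Laguerre density by an explicit
    factor ([laguerre_invariance]). Differentiation at s = 0, with a product of
    centered empirical moments as a test function, gives the exact relations
    [loop_equation]. Their deterministic part is a quadratic recursion of the
    form u_(k+1) = A_k u_k + g (u_k u_0 + ... + u_0 u_k), u_0 = 1
    ([rec_moment]), and the centering is taken at its solution. By induction on
    the total degree, a product of r centered moments has a mean of order
    eps^(r/2), r/2 being rounded up, with eps = 2 / (beta M N) ([loop_bound]).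
    In both regimes eps is O(1/N), so the fourth moments are O(1/N^2), and the
    centered moments tend to 0 almost surely, whatever the joint law is
    ([laguerre_power_mean_ae]). The limits satisfy the recursion with g = gamma
    and A_k = 1 - gamma + k kappa, where kappa = lim 2 / (beta M) is 0 in the
    first regime and gamma / c in the second.

    Identification. The generating series of such a recursion solves a Riccati
    equation, and one step of its continued fraction leads to an equation of
    the same family with the parameters (a, c) changed to (c + e, a)
    ([jacobi_series_fraction]). The limits are therefore the entries J^k(1, 1)
    of an explicit Jacobi matrix ([jacobi_moment]), which is (gamma / c) W W^t
    in the second regime. In the first regime the matrix has constant
    coefficients; the parametrization of the support by
    1 + gamma - 2 sqrt(gamma) cos t shows that its moments are those of the
    Marchenko-Pastur law ([marchenko_pastur_moment]).

    From moments to laws. The limiting moments are bounded by C^k k!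
    ([rec_moment_growth]). Hence a law with these moments has an exponential
    moment, so that its characteristic function is determined step by step from
    0, and then the law itself, since indicators of intervals are limits of
    trigonometric polynomials ([moment_determinacy]). Any subsequence of laws
    with convergent moments has a further subsequence converging weakly to a
    law with the limiting moments ([moment_selection]), which is unique by
    determinacy; this proves [method_of_moments], and in the second regime also
    that the spectral measure exists ([spectral_measure_has_moments]). *)

Set Implicit Arguments.
Unset Strict Implicit.
Unset Printing Implicit Defensive.
Import Order.TTheory GRing.Theory Num.Theory.
Import numFieldNormedType.Exports.
Local Open Scope classical_set_scope.
Local Open Scope ring_scope.

(** * Densities and the substitution x + s x^(k+1) *)

Section density.
Local Open Scope ereal_scope.
Context d (X : measurableType d) (R : realType).
Variables (mu nu : {measure set X -> \bar R}) (rho : X -> R).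
Hypothesis mrho : measurable_fun setT rho.
Hypothesis rho_ge0 : forall x, (0 <= rho x)%R.
Hypothesis nuE : forall A, measurable A -> nu A = \int[mu]_(x in A) (rho x)%:E.

Import HBNNSimple.

Let integral_density_indic (A : set X) (r : R) : measurable A -> (0 <= r)%R ->
  \int[nu]_x (r * \1_A x)%:E = \int[mu]_x (r * \1_A x * rho x)%:E.
Proof.
move=> mA r0; have mI : measurable_fun setT (EFin \o (\1_A : X -> R)).
  by apply/measurable_EFinP; exact: measurable_indic.
have -> : \int[nu]_x (r * \1_A x)%:E = r%:E * nu A.
  under eq_integral do rewrite EFinM.
  by rewrite ge0_integralZl// integral_indic// setIT.
have mArho : measurable_fun setT (fun x => (\1_A x * rho x)%:E).
  by apply/measurable_EFinP; apply: measurable_funM => //; exact: measurable_indic.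
under [RHS]eq_integral do rewrite -mulrA EFinM.
rewrite ge0_integralZl//; last by move=> x _; rewrite lee_fin mulr_ge0.
rewrite nuE// [in LHS]integral_mkcond; congr (_ * _); apply: eq_integral => x _.
by rewrite patchE indicE; case: ifP => _; rewrite ?mul1r ?mul0r.
Qed.

Let integral_density_nnsfun (h : {nnsfun X >-> R}) :
  \int[nu]_x (h x)%:E = \int[mu]_x (h x * rho x)%:E.
Proof.
have mA r : measurable (h @^-1` [set r]) by exact: measurable_sfunP.
have r0 r : r \in range h -> (0 <= r)%R by rewrite inE => -[x _ <-].
have term_ge0 (c : R) r x : (0 <= c)%R -> 0 <= (r * \1_(h @^-1` [set r]) x * c)%:E.
  move=> c0; rewrite lee_fin mulr_ge0// indicE; have [|_] := boolP (x \in _).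
    by rewrite inE/= => <-; rewrite mulr1.
  by rewrite mulr0.
have mterm r : measurable_fun setT (fun x => (r * \1_(h @^-1` [set r]) x)%:E).
  by apply/measurable_EFinP; apply: measurable_funM => //; exact: measurable_indic.
under eq_integral do rewrite fimfunE -fsumEFin//.
under [RHS]eq_integral do rewrite fimfunE mulrC mulr_fsumr// -fsumEFin//.
rewrite !ge0_integral_fsum//.
- apply: eq_fsbigr => r /r0 rge0; rewrite integral_density_indic//.
  by apply: eq_integral => x _; rewrite [in RHS]mulrC.
- move=> r; apply/measurable_EFinP; apply: measurable_funM => //.
  by apply/measurable_EFinP; exact: mterm.
- by move=> r x _; rewrite mulrC term_ge0.
- by move=> r x _; rewrite -[X in X%:E]mulr1 term_ge0.
Qed.

Lemma ge0_integral_density (f : X -> \bar R) : measurable_fun setT f ->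
  (forall x, 0 <= f x) -> \int[nu]_x f x = \int[mu]_x (f x * (rho x)%:E).
Proof.
move=> mf f0; pose h := nnsfun_approx measurableT mf.
have hf x : (h n x)%:E @[n --> \oo] --> f x by exact: cvg_nnsfun_approx.
have hmono x : {homo (fun n => (h n x)%:E) : n m / (n <= m)%N >-> n <= m}.
  by move=> n m nm; rewrite lee_fin; exact/lefP/nd_nnsfun_approx.
pose g n x := (h n x)%:E; pose g' n x := (h n x * rho x)%:E.
have mg n : measurable_fun setT (g n) by exact/measurable_EFinP.
have mg' n : measurable_fun setT (g' n).
  by apply/measurable_EFinP; apply: measurable_funM.
have g0 n x : setT x -> 0 <= g n x by rewrite lee_fin.
have g'0 n x : setT x -> 0 <= g' n x by rewrite lee_fin mulr_ge0.
have g'mono x : setT x -> {homo g'^~ x : n m / (n <= m)%N >-> n <= m}.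
  by move=> _ n m /(hmono x); rewrite !lee_fin; exact: ler_wpM2r.
have cl := cvg_monotone_convergence measurableT mg g0 (fun x _ => hmono x).
have cr := cvg_monotone_convergence measurableT mg' g'0 g'mono.
transitivity (\int[nu]_x limn (g^~ x)).
  by apply: eq_integral => x _; apply/esym; apply: cvg_lim => //; exact: hf.
transitivity (\int[mu]_x limn (g'^~ x)); last first.
  apply: eq_integral => x _; apply: cvg_lim => //.
  under eq_fun do rewrite /g' EFinM.
  by apply: cvgeZr => //; exact: hf.
apply: (cvg_unique _ (cl nu)) => //; apply: cvg_trans (cr mu).
by under eq_fun do rewrite /g integral_density_nnsfun.
Qed.

Lemma integral_density (f : X -> R) : measurable_fun setT f ->
  \int[nu]_x (f x)%:E = \int[mu]_x (f x * rho x)%:E.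
Proof.
move=> mf; have mf' : measurable_fun setT (EFin \o f) by exact/measurable_EFinP.
rewrite integralE [RHS]integralE; congr (_ - _).
- rewrite ge0_integral_density//; last exact: measurable_funepos.
  apply: eq_integral => x _; rewrite !funeposE EFinM.
  by rewrite -[in RHS](mul0e (rho x)%:E) maxeMl// lee_fin.
- rewrite ge0_integral_density//; last exact: measurable_funeneg.
  apply: eq_integral => x _; rewrite !funenegE EFinM -mulNe.
  by rewrite -[in RHS](mul0e (rho x)%:E) maxeMl// lee_fin.
Qed.
End density.

Section density_measure.
Local Open Scope ereal_scope.
Context d (X : measurableType d) (R : realType).
Variables (mu : {measure set X -> \bar R}) (rho : X -> R).
Hypothesis mrho : measurable_fun setT rho.
Hypothesis rho_ge0 : forall x, (0 <= rho x)%R.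

Definition density_measure (A : set X) : \bar R := \int[mu]_(x in A) (rho x)%:E.

Let density0 : density_measure set0 = 0.
Proof. exact: integral_set0. Qed.

Let density_ge0 A : 0 <= density_measure A.
Proof. by apply: integral_ge0 => x _; rewrite lee_fin. Qed.

Let density_sigma_additive : semi_sigma_additive density_measure.
Proof.
move=> A mA tA mUA; rewrite /density_measure ge0_integral_bigcup//=.
- by apply: is_cvg_ereal_nneg_natsum_cond => n _ _; exact: density_ge0.
- by apply/measurable_EFinP; exact: measurable_funTS.
- by move=> x _; rewrite lee_fin.
Qed.

HB.instance Definition _ := isMeasure.Build _ _ _
  density_measure density0 density_ge0 density_sigma_additive.

Definition with_density : {measure set X -> \bar R} := density_measure.
End density_measure.

Section power_shift.
Context {R : realType}.
Variables (s : R) (k : nat).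
Hypothesis s_ge0 : 0 <= s.

(** The flow of the vector field x^(k+1) to first order in s; unlike the flow,
    it is defined on the whole positive half-line, which it maps onto itself.
    *)
Definition pshift (x : R) : R := x + s * x ^+ k.+1.
Definition dpshift (x : R) : R := 1 + s * k.+1%:R * x ^+ k.

Lemma is_derive_pshift (x : R) : is_derive x 1 pshift (dpshift x).
Proof.
have -> : pshift = horner ('X + s *: 'X^(k.+1)).
  by apply/funext => y; rewrite /pshift !hornerE.
apply: is_derive_eq.
by rewrite derivD derivX derivZ derivXn !hornerE hornerMn hornerXn /dpshift /= -mulr_natl mulrA.
Qed.

Lemma continuous_pshift : continuous pshift.
Proof.
move=> x; apply: differentiable_continuous; apply/derivable1_diffP.
by have [] := is_derive_pshift x.
Qed.

Lemma continuous_dpshift : continuous dpshift.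
Proof.
by move=> x; apply: cvgD; [exact: cvg_cst|apply: cvgM; [exact: cvg_cst|exact: exprn_continuous]].
Qed.

Lemma pshift_incr : {in Num.nneg &, {mono pshift : x y / x <= y}}.
Proof.
apply: le_mono_in => x y; rewrite !nnegrE /pshift => x0 y0 xy.
by rewrite ltr_leD// ler_wpM2l// lerXn2r// ltW.
Qed.

Lemma pshift0 : pshift 0 = 0.
Proof. by rewrite /pshift expr0n/= mulr0 addr0. Qed.

Lemma le_pshift x : 0 <= x -> x <= pshift x.
Proof. by move=> x0; rewrite lerDl mulr_ge0// exprn_ge0. Qed.

Lemma pshift_surj y : 0 <= y -> exists2 x, 0 <= x & pshift x = y.
Proof.
move=> y0.
have [] := @IVT R pshift 0 y y y0.
- by apply: continuous_subspaceT; exact: continuous_pshift.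
- by rewrite pshift0 ge_min y0/= le_max le_pshift// orbT.
- by move=> c /itvP c0y <-; exists c; rewrite ?c0y.
Qed.

Lemma integral_dpshift (a b : R) : a <= b ->
  (\int[lebesgue_measure]_(x in `]a, b]) (dpshift x)%:E =
  (pshift b - pshift a)%:E)%E.
Proof.
rewrite le_eqVlt => /predU1P[->|ab].
  by rewrite set_itv_ge ?bnd_simp ?ltxx// integral_set0 subrr.
rewrite integral_itv_obnd_cbnd; last first.
  apply/measurable_EFinP; apply: measurable_funTS.
  by apply: continuous_measurable_fun; exact: continuous_dpshift.
rewrite EFinB; apply: (@continuous_FTC2 _ dpshift pshift) => //.
- by apply: continuous_subspaceT; exact: continuous_dpshift.
- split => [x _||].
  + by have [] := is_derive_pshift x.
  + exact/cvg_at_right_filter/continuous_pshift.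
  + exact/cvg_at_left_filter/continuous_pshift.
- by move=> x _; rewrite derive1E; have [_ ->] := is_derive_pshift x.
Qed.

(** Extended by 0, so that it also restricts integrals to the half-line. *)
Definition jac_pshift (x : R) : R := if 0 < x then dpshift x else 0.

Lemma jac_pshift_ge0 x : 0 <= jac_pshift x.
Proof.
rewrite /jac_pshift; case: ifPn => // x0.
by rewrite addr_ge0// mulr_ge0 ?mulr_ge0// exprn_ge0// ltW.
Qed.

Lemma measurable_jac_pshift : measurable_fun setT jac_pshift.
Proof.
apply: measurable_fun_ifT => //; first exact: measurable_fun_ltr.
by apply: continuous_measurable_fun; exact: continuous_dpshift.
Qed.

Lemma measurable_pshift :
  measurable_fun setT (pshift : measurableTypeR R -> measurableTypeR R).
Proof. by apply: continuous_measurable_fun; exact: continuous_pshift. Qed.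

Let mu2 := measure_function_pushforward__canonical__measure_function_Measure
  (with_density (@lebesgue_measure R) measurable_jac_pshift jac_pshift_ge0)
  measurable_pshift.

Let mpos : measurable (`]0%R, +oo[%classic : set (measurableTypeR R)).
Proof. exact: measurable_itv. Qed.

Let pushforward_pshift_oc (a b : R) :
  mrestr (@lebesgue_measure R) mpos `]a, b]%classic = mu2 `]a, b]%classic.
Proof.
pose a' := Num.max a 0; pose b' := Num.max b a'.
have a'0 : 0 <= a' by rewrite le_max lexx orbT.
have ab' : a' <= b' by rewrite le_max lexx orbT.
have b'0 : 0 <= b' by exact: le_trans ab'.
have -> : mrestr (@lebesgue_measure R) mpos `]a, b]%classic = (b' - a')%:E.
  rewrite /mrestr; have -> : `]a, b]%classic `&` `]0, +oo[%classic = `]a', b']%classic.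
    apply/seteqP; split => x /=; rewrite !in_itv/= !andbT.
      by move=> [/andP[ax xb] x0]; rewrite /b' le_max xb /a' gt_max ax x0.
    rewrite /b' le_max => /andP[]; rewrite {1}/a' gt_max => /andP[ax x0].
    by rewrite [x <= a']leNgt /a' gt_max ax x0/= orbF => xb; rewrite xb.
  rewrite lebesgue_measure_itv/= lte_fin -EFinB; case: ltgtP ab' => // -> _.
  by rewrite subrr.
have [x x0 xa] := pshift_surj a'0; have [y y0 yb] := pshift_surj b'0.
have xy : x <= y by rewrite -pshift_incr ?nnegrE// xa yb.
rewrite /= /pushforward /density_measure.
rewrite -xa -yb -integral_dpshift// [LHS]integral_mkcond [RHS]integral_mkcond.
apply: eq_integral => z _; rewrite /patch /jac_pshift.
have [z0|z0] := ltP 0 z.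
  have -> : (z \in pshift @^-1` `]a, b]%classic) = (z \in `]x, y]%classic) => //.
  have ltE : {in Num.nneg &, {mono pshift : x y / x < y}}.
    exact: leW_mono_in pshift_incr.
  have z0' : 0 <= z by exact: ltW.
  apply/idP/idP; rewrite !inE/= !in_itv/= -[x < z]ltE ?nnegrE//
    -[z <= y]pshift_incr ?nnegrE// xa yb.
    move=> /andP[az zb]; rewrite /a' gt_max az (lt_le_trans z0 (le_pshift _))//=.
    by rewrite /b' le_max zb.
  rewrite {1}/a' gt_max => /andP[/andP[az _]].
  rewrite /b' le_max [_ <= a']leNgt /a' gt_max az.
  by rewrite (lt_le_trans z0 (le_pshift _))//= orbF => ->.
rewrite if_same; case: ifPn => //; rewrite inE/= in_itv/= => /andP[xz _].
by move: (lt_le_trans xz z0); rewrite ltNge x0.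
Qed.

(** The two measures give the same mass to every half-open interval, by the
    fundamental theorem of calculus. *)
Lemma pushforward_pshift (A : set (measurableTypeR R)) : measurable A ->
  mrestr (@lebesgue_measure R) mpos A = mu2 A.
Proof.
apply: (@measure_unique _ R (measurableTypeR R) (@ocitv R)
  (fun n => `]- n%:R, n%:R]%classic) _ _ _ _ (mrestr (@lebesgue_measure R) mpos) mu2) => //.
- exact: ocitvI.
- by move=> i; exact: is_ocitv.
- exact: bigcup_itvT.
- move=> _ [[a b] _ <-]; exact: pushforward_pshift_oc.
- move=> n; rewrite /mrestr; apply: (@le_lt_trans _ _
    (lebesgue_measure (`]- n%:R, n%:R]%classic : set R))).
    apply: le_measure; rewrite ?inE; [|exact: measurable_itv|by move=> x []].
    by apply: (@measurableI _ (measurableTypeR R)) => //; exact: measurable_itv.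
  by rewrite lebesgue_measure_itv/=; case: ifP => // _; rewrite -EFinB ltry.
Qed.

Lemma integral_pshift (h : R -> \bar R) : measurable_fun setT h ->
  (forall x, 0 <= h x)%E ->
  (\int[lebesgue_measure]_x (h x * ((0 < x)%R%:R)%:E) =
  \int[lebesgue_measure]_x (h (pshift x) * (jac_pshift x)%:E))%E.
Proof.
move=> mh h0.
have mJ : measurable_fun setT (EFin \o jac_pshift).
  by apply/measurable_EFinP; exact: measurable_jac_pshift.
transitivity (\int[mrestr (@lebesgue_measure R) mpos]_x h x)%E.
  have posE : (fun x : R => (0 < x)%R%:R) = (\1_(`]0%R, +oo[%classic) : R -> R).
    by apply/funext => x; rewrite indicE mem_setE in_itv/= andbT.
  rewrite [RHS](@ge0_integral_density _ _ _ (@lebesgue_measure R) _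
    (fun x : R => (0 < x)%R%:R))//.
    by rewrite posE; exact: measurable_indic.
  move=> A mA; rewrite /mrestr.
  transitivity (\int[lebesgue_measure]_(x in A) (\1_(`]0%R, +oo[%classic) x)%:E)%E.
    by rewrite integral_indic// setIC.
  by apply: eq_integral => x _; rewrite -posE.
rewrite (eq_measure_integral mu2) => [|A mA _]; last exact: pushforward_pshift.
rewrite ge0_integral_pushforward//; last exact: measurable_pshift.
rewrite preimage_setT (@ge0_integral_density _ _ _ (@lebesgue_measure R) _ jac_pshift)//.
- exact: measurable_jac_pshift.
- exact: jac_pshift_ge0.
- by apply: measurableT_comp => //; exact: measurable_pshift.
- by move=> x; exact: h0.
Qed.
End power_shift.

(** * Coordinatewise substitutions in Lebesgue measure on tuples *)

Section tensorization.
Context {R : realType}.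
Local Open Scope ereal_scope.

Lemma ge0_integral_lebesgue_tupleS n (f : n.+1.-tuple R -> \bar R) :
  measurable_fun setT f -> (forall x, 0 <= f x) ->
  \int[lebesgue_tuple n.+1]_x f x =
  \int[(@lebesgue_measure R \x lebesgue_tuple n)%E]_p f (cons_pair p).
Proof.
move=> mf f0.
rewrite /= /lebesgue_tuple_step ge0_integral_pushforward//.
exact: measurable_cons_pair.
Qed.

Variables (phi p J : R -> R).
Hypotheses (mphi : measurable_fun setT (phi : measurableTypeR R -> measurableTypeR R))
  (mp : measurable_fun setT p) (mJ : measurable_fun setT J)
  (p_ge0 : forall x, (0 <= p x)%R) (J_ge0 : forall x, (0 <= J x)%R).
Hypothesis phiE : forall h : R -> \bar R, measurable_fun setT h ->
  (forall x, 0 <= h x) ->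
  \int[lebesgue_measure]_x (h x * (p x)%:E) =
  \int[lebesgue_measure]_x (h (phi x) * (J x)%:E).

Lemma measurable_prod_tnth n (q : R -> R) : measurable_fun setT q ->
  measurable_fun setT (fun x : n.-tuple R => \prod_(i < n) q (tnth x i))%R.
Proof.
move=> mq; apply: measurable_prod => i _.
exact: (measurableT_comp mq (measurable_tnth i)).
Qed.

Lemma measurable_map_tuple n :
  measurable_fun setT (fun x : n.-tuple R => [tuple of map phi x] : n.-tuple R).
Proof.
apply: (measurable_fun_tnthP _).2 => i.
rewrite [X in measurable_fun _ X](_ : _ = phi \o (@tnth n R)^~ i); last first.
  by apply/funext => x /=; rewrite tnth_map.
exact: (measurableT_comp mphi (measurable_tnth i)).
Qed.

(** Induction on the number of coordinates: Tonelli separates the first one,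
    to which [phiE] applies. *)
Lemma ge0_integral_tuple_change n (f : n.-tuple R -> \bar R) :
  measurable_fun setT f -> (forall x, 0 <= f x) ->
  \int[lebesgue_tuple n]_x (f x * (\prod_(i < n) p (tnth x i))%:E) =
  \int[lebesgue_tuple n]_x (f [tuple of map phi x] * (\prod_(i < n) J (tnth x i))%:E).
Proof.
elim: n f => [|n IH] f mf f0.
  apply: eq_integral => x _; rewrite !big_ord0; congr (f _ * _).
  by apply/val_inj; rewrite /= (tuple0 x).
pose c n x (t : n.-tuple R) : n.+1.-tuple R := [tuple of x :: t].
have mpr (q : R -> R) m : measurable_fun setT q -> measurable_fun setT
    (EFin \o fun x : m.-tuple R => \prod_(i < m) q (tnth x i))%R.
  by move=> mq; apply/measurable_EFinP; exact: measurable_prod_tnth.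
have pr0 (q : R -> R) m (x : m.-tuple R) : (forall y, 0 <= q y)%R ->
    0 <= (\prod_(i < m) q (tnth x i))%:E.
  by move=> q0; rewrite lee_fin prodr_ge0.
have prS (q : R -> R) m x (t : m.-tuple R) : (\prod_(i < m.+1) q (tnth (c m x t) i))%:E =
    (q x)%:E * (\prod_(i < m) q (tnth t i))%:E.
  rewrite big_ord_recl -EFinM; congr (_ * _)%R%:E.
  by apply: eq_bigr => i _; rewrite tnthS.
have mfst (q : R -> R) : measurable_fun setT q ->
    measurable_fun setT (fun z : measurableTypeR R * n.-tuple R => (q z.1)%:E).
  by move=> mq; apply/measurable_EFinP; exact: (measurableT_comp mq measurable_fst).
have msnd (q : R -> R) : measurable_fun setT q ->
    measurable_fun setT (fun z : measurableTypeR R * n.-tuple R =>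
      (\prod_(i < n) q (tnth z.2 i))%:E).
  by move=> mq; exact: (measurableT_comp (mpr _ n mq) measurable_snd).
have mmap := @measurable_map_tuple n.
have mcons2 : measurable_fun setT (fun z : measurableTypeR R * n.-tuple R =>
    c n z.1 [tuple of map phi z.2]).
  apply: measurable_cons; first exact: measurable_fst.
  exact: (measurableT_comp mmap measurable_snd).
pose G1 (z : measurableTypeR R * n.-tuple R) :=
  f (c n z.1 z.2) * ((p z.1)%:E * (\prod_(i < n) p (tnth z.2 i))%:E).
pose G2 (z : measurableTypeR R * n.-tuple R) :=
  f (c n z.1 [tuple of map phi z.2]) * ((p z.1)%:E * (\prod_(i < n) J (tnth z.2 i))%:E).
have mG1 : measurable_fun setT G1.
  apply: emeasurable_funM; last by apply: emeasurable_funM; [exact: mfst|exact: msnd].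
  have := measurableT_comp mf (@measurable_cons_pair R n).
  by apply: eq_measurable_fun => -[x t] _.
have mG2 : measurable_fun setT G2.
  apply: emeasurable_funM; last by apply: emeasurable_funM; [exact: mfst|exact: msnd].
  have := measurableT_comp mf mcons2.
  by apply: eq_measurable_fun => -[x t] _.
have G10 z : 0 <= G1 z by rewrite !mule_ge0 ?pr0 ?lee_fin.
have G20 z : 0 <= G2 z by rewrite !mule_ge0 ?pr0 ?lee_fin.
transitivity (\int[(@lebesgue_measure R \x lebesgue_tuple n)%E]_z G1 z).
  rewrite ge0_integral_lebesgue_tupleS.
  - by apply: eq_integral => -[x t] _; rewrite prS.
  - by apply: emeasurable_funM => //; exact: mpr.
  - by move=> x; rewrite mule_ge0 ?pr0.
rewrite fubini_tonelli1//.
transitivity (\int[lebesgue_measure]_x \int[lebesgue_tuple n]_t G2 (x, t)).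
  apply: eq_integral => x _; rewrite /fubini_F /G1 /G2 /=.
  have mfx : measurable_fun setT (fun t => f (c n x t) * (p x)%:E).
    apply: emeasurable_funM => //; apply: measurableT_comp => //.
    exact: measurable_cons.
  transitivity (\int[lebesgue_tuple n]_t (f (c n x t) * (p x)%:E *
      (\prod_(i < n) p (tnth t i))%:E)).
    by apply: eq_integral => t _; rewrite muleA.
  rewrite (IH (fun t => f (c n x t) * (p x)%:E))//.
    by apply: eq_integral => t _; rewrite muleA.
  by move=> t; rewrite mule_ge0 ?lee_fin.
rewrite (fubini_tonelli G2)//.
pose G3 (z : measurableTypeR R * n.-tuple R) :=
  f (c n (phi z.1) [tuple of map phi z.2]) * ((J z.1)%:E * (\prod_(i < n) J (tnth z.2 i))%:E).
have mG3 : measurable_fun setT G3.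
  apply: emeasurable_funM; last by apply: emeasurable_funM; [exact: mfst|exact: msnd].
  apply: (measurableT_comp mf); apply: measurable_cons.
    exact: (measurableT_comp mphi measurable_fst).
  exact: (measurableT_comp mmap measurable_snd).
have G30 z : 0 <= G3 z by rewrite !mule_ge0 ?pr0 ?lee_fin.
transitivity (\int[lebesgue_tuple n]_t \int[lebesgue_measure]_x G3 (x, t)).
  apply: eq_integral => t _; rewrite /G2 /G3 /=.
  set g := fun x => f (c n x [tuple of map phi t]) * (\prod_(i < n) J (tnth t i))%:E.
  have mg : measurable_fun setT g.
    apply: emeasurable_funM => //; apply: measurableT_comp => //.
    exact: measurable_cons.
  transitivity (\int[lebesgue_measure]_x (g x * (p x)%:E)).
    by apply: eq_integral => x _; rewrite /g -muleA [(p x)%:E * _]muleC.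
  rewrite phiE//; last by move=> x; rewrite /g mule_ge0 ?pr0.
  by apply: eq_integral => x _; rewrite /g -muleA [(J x)%:E * _]muleC.
rewrite -(fubini_tonelli G3)// -fubini_tonelli1// [RHS]ge0_integral_lebesgue_tupleS.
- apply: eq_integral => -[x t] _; rewrite /G3 prS; congr (f _ * _).
  by apply/val_inj.
- apply: emeasurable_funM; last exact: mpr.
  exact: (measurableT_comp mf (@measurable_map_tuple n.+1)).
- by move=> x; rewrite mule_ge0 ?pr0.
Qed.

End tensorization.

Section power_shift_tuple.
Context {R : realType}.
Variables (s : R) (k n : nat).
Hypothesis s_ge0 : 0 <= s.

Lemma ge0_integral_pshift_tuple (f : n.-tuple R -> \bar R) :
  measurable_fun setT f -> (forall x, 0 <= f x)%E ->
  (\int[lebesgue_tuple n]_x (f x * (\prod_(i < n) (0 < tnth x i)%R%:R)%:E) =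
   \int[lebesgue_tuple n]_x (f [tuple of map (pshift s k) x] *
     (\prod_(i < n) jac_pshift s k (tnth x i))%:E))%E.
Proof.
move=> mf f0; have H := @ge0_integral_tuple_change R (pshift s k)
  (fun x => (0 < x)%R%:R) (jac_pshift s k); apply: H => //.
- exact: measurable_pshift.
- have -> : (fun x : R => (0 < x)%R%:R) = (\1_(`]0%R, +oo[%classic) : R -> R).
    by apply/funext => x; rewrite indicE mem_setE in_itv/= andbT.
  exact: measurable_indic.
- exact: measurable_jac_pshift.
- exact: jac_pshift_ge0.
- by move=> h mh h0; exact: integral_pshift.
Qed.

Lemma integral_pshift_tuple (f : n.-tuple R -> R) : measurable_fun setT f ->
  (\int[lebesgue_tuple n]_x (f x * \prod_(i < n) (0 < tnth x i)%R%:R)%:E =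
   \int[lebesgue_tuple n]_x (f [tuple of map (pshift s k) x] *
     \prod_(i < n) jac_pshift s k (tnth x i))%:E)%E.
Proof.
move=> mf; have mf' : measurable_fun setT (EFin \o f) by exact/measurable_EFinP.
have jac0 (x : n.-tuple R) : 0 <= \prod_(i < n) jac_pshift s k (tnth x i).
  by apply: prodr_ge0 => i _; exact: jac_pshift_ge0.
have pos0 (x : n.-tuple R) : 0 <= \prod_(i < n) (0 < tnth x i)%R%:R :> R.
  by apply: prodr_ge0 => i _; exact: ler0n.
have posM (y z : R) : 0 <= z -> (maxe (y * z)%:E 0 = maxe y%:E 0 * z%:E)%E.
  by move=> z0; rewrite maxeMl// mul0e -EFinM.
have negM (y z : R) : 0 <= z -> (maxe (- (y * z)%:E) 0 = maxe (- y%:E) 0 * z%:E)%E.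
  by move=> z0; rewrite maxeMl// mul0e -EFinN -EFinM mulNr.
rewrite integralE [RHS]integralE; congr (_ - _)%E.
- under eq_integral => x _ do rewrite funeposE posM//.
  under [in RHS]eq_integral => x _ do rewrite funeposE posM//.
  rewrite -(@ge0_integral_pshift_tuple (fun x => maxe (f x)%:E 0))//.
  + by have := measurable_funepos mf'; apply: eq_measurable_fun => x _; rewrite funeposE.
  + by move=> x; rewrite le_max lexx orbT.
- under eq_integral => x _ do rewrite funenegE negM//.
  under [in RHS]eq_integral => x _ do rewrite funenegE negM//.
  rewrite -(@ge0_integral_pshift_tuple (fun x => maxe (- (f x)%:E)%E 0%E))//.
  + by have := measurable_funeneg mf'; apply: eq_measurable_fun => x _; rewrite funenegE.
  + by move=> x; rewrite le_max lexx orbT.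
Qed.
End power_shift_tuple.

(** * First order expansions with remainders of polynomial growth *)

Section exp_bounds.
Context {R : realType}.
Implicit Types (r u y : R).

Lemma ln1D_taylor u : 0 <= u -> `|ln (1 + u) - u| <= u ^+ 2.
Proof.
move=> u0; have u1 : 0 < 1 + u by rewrite ltr_pwDl.
rewrite ler0_norm; last by rewrite subr_le0 le_ln1Dx// (lt_le_trans _ u0)// ltrN10.
rewrite opprB lerBlDr -lerBlDl.
have := @le_ln1Dx R ((1 + u)^-1 - 1).
rewrite addrCA subrr addr0 lnV ?posrE// ltrDr invr_gt0 => /(_ u1).
rewrite lerNl => h; apply: le_trans h.
rewrite -subr_ge0 [X in 0 <= X](_ : _ = u ^+ 3 / (1 + u)).
  by rewrite divr_ge0 ?exprn_ge0// ltW.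
by field; rewrite gt_eqF.
Qed.

Lemma expR_taylor y : `|expR y - 1 - y| <= y ^+ 2 * expR `|y|.
Proof.
have exp1 (z : R) : expR z - 1 <= z * expR z.
  have := expR_ge1Dx (- z); rewrite expRN => h.
  have := ler_wpM2r (expR_ge0 z) h.
  by rewrite mulVf ?gt_eqF ?expR_gt0// mulrDl mulNr; lra.
rewrite [leLHS]ger0_norm; last by have := expR_ge1Dx y; lra.
have [y0|y0] := leP 0 y.
  rewrite ger0_norm//.
  have : y * (expR y - 1) <= y * (y * expR y) by rewrite ler_wpM2l ?exp1.
  by have := exp1 y; rewrite expr2; lra.
rewrite ltr0_norm//; apply: (@le_trans _ _ (y ^+ 2)); last first.
  by rewrite ler_peMr ?sqr_ge0// -[leLHS](@expR0 R) ler_expR oppr_ge0 ltW.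
have := exp1 y; have := exp1 (- y); rewrite expRN => h1 h2.
have : expR y <= 1 by rewrite expR_le1 ltW.
have yN : y * expR y <= y * (1 + y) by rewrite ler_wnM2l ?expR_ge1Dx// ltW.
by rewrite expr2; lra.
Qed.

(** The remainder is polynomial in u, of a degree that depends on r alone;
    this keeps it integrable against a law with exponential moments. *)
Lemma powR_taylor r u : 0 <= u ->
  `|(1 + u) `^ r - 1 - r * u| <= (r ^+ 2 + `|r|) * u ^+ 2 * (1 + u) ^+ (Num.truncn `|r|).+1.
Proof.
move=> u0; have u1 : 0 < 1 + u by rewrite ltr_pwDl.
have u1' : 1 <= 1 + u by rewrite lerDl.
set L := ln (1 + u).
have L0 : 0 <= L by rewrite ln_ge0.
have Lu : L <= u by rewrite le_ln1Dx// (lt_le_trans _ u0)// ltrN10.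
have -> : (1 + u) `^ r = expR (r * L) by rewrite /powR gt_eqF.
set m := (Num.truncn _).+1.
have m1 : 1 <= (1 + u) ^+ m by rewrite exprn_ege1.
have em : expR `|r * L| <= (1 + u) ^+ m.
  rewrite normrM (ger0_norm L0) -[leRHS]lnK ?posrE ?exprn_gt0// ler_expR lnXn//.
  rewrite -/L -mulr_natl ler_wpM2r// ltW//.
  by have /andP[] := truncn_itv (normr_ge0 r).
have e1 := expR_taylor (r * L); have l1 := ln1D_taylor u0; rewrite -/L in l1.
rewrite [X in `|X|](_ : _ = (expR (r * L) - 1 - r * L) + r * (L - u)); last by ring.
apply: (le_trans (ler_normD _ _)).
rewrite 2!mulrDl lerD//.
  apply: (le_trans e1); apply: ler_pM => //; rewrite ?sqr_ge0 ?expR_ge0//.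
  by rewrite exprMn ler_wpM2l ?sqr_ge0// lerXn2r.
rewrite normrM -mulrA ler_wpM2l//; apply: (le_trans l1).
by rewrite ler_peMr ?sqr_ge0.
Qed.
End exp_bounds.

Section germs.
Context {R : realType} {X : Type}.
Variables (D : set X) (T : X -> R).
Hypothesis T_ge1 : forall x, D x -> 1 <= T x.
Implicit Types (f g u : X -> R).

(** Polynomial growth on D in terms of the size T of a point. *)
Definition tame f := exists C m, forall x, D x -> `|f x| <= C * T x ^+ m.

(** The functions h0 and h1 are the value and the right derivative at s = 0 of
    the family h, and the second order remainder grows polynomially, uniformly
    in s; this justifies differentiation under the integral sign. *)
Definition germ (h : R -> X -> R) (h0 h1 : X -> R) := [/\ tame h0, tame h1 &
  exists C m, forall x s, D x -> 0 <= s <= 1 ->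
    `|h s x - h0 x - s * h1 x| <= s ^+ 2 * (C * T x ^+ m)].

Lemma tame_ge0P f : tame f -> exists C m, [/\ 0 <= C &
  forall x, D x -> `|f x| <= C * T x ^+ m].
Proof.
move=> [C [m fC]]; exists `|C|, m; split=> // x Dx.
apply: (le_trans (fC x Dx)); rewrite ler_wpM2r ?ler_norm// exprn_ge0//.
by rewrite (le_trans _ (T_ge1 Dx)).
Qed.

Let TX m x : D x -> 1 <= T x ^+ m.
Proof. by move=> Dx; rewrite exprn_ege1// T_ge1. Qed.

Lemma tame_le f g : tame g -> (forall x, D x -> `|f x| <= `|g x|) -> tame f.
Proof. by move=> [C [m gC]] fg; exists C, m => x Dx; apply: (le_trans (fg _ Dx)); exact: gC. Qed.

Lemma tame_ext f g : tame g -> (forall x, D x -> f x = g x) -> tame f.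
Proof. by move=> tg fg; apply: (tame_le tg) => x Dx; rewrite fg. Qed.

Lemma tame_cst c : tame (fun=> c).
Proof. by exists `|c|, 0%N => x Dx; rewrite expr0 mulr1. Qed.

Lemma tame_size : tame T.
Proof.
by exists 1, 1%N => x Dx; rewrite expr1 mul1r ger0_norm// (le_trans _ (T_ge1 Dx)).
Qed.

Lemma tameN f : tame f -> tame (fun x => - f x).
Proof. by move=> tf; apply: (tame_le tf) => x _; rewrite normrN. Qed.

Lemma tame_norm f : tame f -> tame (fun x => `|f x|).
Proof. by move=> tf; apply: (tame_le tf) => x _; rewrite normr_id. Qed.

Lemma tameD f g : tame f -> tame g -> tame (fun x => f x + g x).
Proof.
move=> /tame_ge0P[C [m [C0 fC]]] /tame_ge0P[E [n [E0 gE]]].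
exists (C + E), (m + n)%N => x Dx; apply: (le_trans (ler_normD _ _)).
rewrite mulrDl lerD//.
  apply: (le_trans (fC x Dx)); rewrite exprD mulrA ler_peMr ?TX//.
  by rewrite mulr_ge0// (le_trans _ (TX m Dx)).
apply: (le_trans (gE x Dx)); rewrite exprD mulrCA ler_peMl ?TX//.
by rewrite mulr_ge0// (le_trans _ (TX n Dx)).
Qed.

Lemma tameM f g : tame f -> tame g -> tame (fun x => f x * g x).
Proof.
move=> [C [m fC]] [E [n gE]].
exists (C * E), (m + n)%N => x Dx.
by rewrite normrM exprD mulrACA ler_pM ?fC ?gE.
Qed.

Lemma tameX f n : tame f -> tame (fun x => f x ^+ n).
Proof.
move=> tf; elim: n => [|n IH]; first exact: (tame_ext (tame_cst 1)).
by apply: (tame_ext (tameM tf IH)) => x _; rewrite exprS.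
Qed.

Lemma tame_sum I (r : seq I) (P : pred I) (F : I -> X -> R) :
  (forall i, P i -> tame (F i)) -> tame (fun x => \sum_(i <- r | P i) F i x).
Proof.
move=> tF; elim: r => [|i r IH].
  by apply: (tame_ext (tame_cst 0)) => x _; rewrite big_nil.
have [Pi|Pi] := boolP (P i).
  by apply: (tame_ext (tameD (tF _ Pi) IH)) => x _; rewrite big_cons Pi.
by apply: (tame_ext IH) => x _; rewrite big_cons (negbTE Pi).
Qed.

Lemma germ_ext (h h' : R -> X -> R) (h0 h0' h1 h1' : X -> R) :
  (forall s x, D x -> 0 <= s <= 1 -> h' s x = h s x) ->
  (forall x, D x -> h0' x = h0 x) -> (forall x, D x -> h1' x = h1 x) ->
  germ h h0 h1 -> germ h' h0' h1'.
Proof.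
move=> hE h0E h1E [t0 t1 [C [m hC]]]; split; [exact: tame_ext h0E|exact: tame_ext h1E|].
by exists C, m => x s Dx s1; rewrite hE// h0E// h1E//; exact: hC.
Qed.

Lemma germM h h0 h1 k k0 k1 : germ h h0 h1 -> germ k k0 k1 ->
  germ (fun s x => h s x * k s x) (fun x => h0 x * k0 x)
    (fun x => h1 x * k0 x + h0 x * k1 x).
Proof.
move=> [th0 th1 th] [tk0 tk1 tk]; split.
- exact: tameM.
- by apply: tameD; exact: tameM.
case: th => C [m hC]; case: tk => E [n kE].
pose e x : R := C * T x ^+ m; pose f x : R := E * T x ^+ n.
have te : tame e by apply: tameM; [exact: tame_cst|apply: tameX; exact: tame_size].
have tf : tame f by apply: tameM; [exact: tame_cst|apply: tameX; exact: tame_size].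
have tB : tame (fun x => `|h1 x| * `|k1 x| + (`|h0 x| + `|h1 x|) * f x +
    (`|k0 x| + `|k1 x|) * e x + e x * f x).
  apply: tameD; last exact: tameM.
  apply: tameD; first apply: tameD; apply: tameM => //; do ?apply: tameD; exact: tame_norm.
case: tB => B [p hB]; exists B, p => x s Dx s01.
have /andP[s0 s1] := s01.
have he := hC x s Dx s01; have kf := kE x s Dx s01; rewrite -/(e x) in he; rewrite -/(f x) in kf.
set a := h s x - h0 x - s * h1 x in he; set b := k s x - k0 x - s * k1 x in kf.
rewrite [X in `|X|](_ : _ = s ^+ 2 * (h1 x * k1 x) + (h0 x + s * h1 x) * b +
    (k0 x + s * k1 x) * a + a * b); last by rewrite /a /b; ring.
have s2 : s ^+ 2 <= 1 by rewrite expr_le1.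
have e0 : 0 <= s ^+ 2 * e x by apply: le_trans he.
have f0 : 0 <= s ^+ 2 * f x by apply: le_trans kf.
have lin (u v : R) : `|u + s * v| <= `|u| + `|v|.
  apply: (le_trans (ler_normD _ _)); rewrite lerD2l normrM ger0_norm//.
  by rewrite ler_piMl.
have h4 : `|a * b| <= s ^+ 2 * (e x * f x).
  rewrite normrM; apply: (@le_trans _ _ ((s ^+ 2 * e x) * (s ^+ 2 * f x))).
    by rewrite ler_pM.
  have [s00|s00] := eqVneq s 0; first by rewrite s00 expr0n/= !mul0r.
  have s20 : 0 < s ^+ 2 by rewrite exprn_gt0// lt_neqAle eq_sym s00.
  have ex : 0 <= e x by rewrite -(pmulr_rge0 _ s20).
  have fx : 0 <= f x by rewrite -(pmulr_rge0 _ s20).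
  by rewrite mulrACA -mulrA ler_wpM2l ?sqr_ge0// ler_piMl// mulr_ge0.
have h3 : `|(k0 x + s * k1 x) * a| <= s ^+ 2 * ((`|k0 x| + `|k1 x|) * e x).
  by rewrite normrM mulrCA ler_pM// lin.
have h2 : `|(h0 x + s * h1 x) * b| <= s ^+ 2 * ((`|h0 x| + `|h1 x|) * f x).
  by rewrite normrM mulrCA ler_pM// lin.
have h1' : `|s ^+ 2 * (h1 x * k1 x)| <= s ^+ 2 * (`|h1 x| * `|k1 x|).
  by rewrite !normrM ger0_norm// sqr_ge0.
have hB' := hB x Dx.
apply: (@le_trans _ _ (s ^+ 2 * (`|h1 x| * `|k1 x| + (`|h0 x| + `|h1 x|) * f x +
    (`|k0 x| + `|k1 x|) * e x + e x * f x))); last first.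
  by rewrite ler_wpM2l ?sqr_ge0// (le_trans (ler_norm _)).
clearbody a b; rewrite !mulrDr; apply: (le_trans (ler_normD _ _)); apply: lerD => //.
apply: (le_trans (ler_normD _ _)); apply: lerD => //.
by apply: (le_trans (ler_normD _ _)); apply: lerD.
Qed.

Lemma germD h h0 h1 k k0 k1 : germ h h0 h1 -> germ k k0 k1 ->
  germ (fun s x => h s x + k s x) (fun x => h0 x + k0 x) (fun x => h1 x + k1 x).
Proof.
move=> [th0 th1 [C [m hC]]] [tk0 tk1 [E [n kE]]]; split; [exact: tameD|exact: tameD|].
have tB : tame (fun x => C * T x ^+ m + E * T x ^+ n).
  by apply: tameD; (apply: tameM; [exact: tame_cst|apply: tameX; exact: tame_size]).
case: tB => B [p hB]; exists B, p => x s Dx s01.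
apply: (@le_trans _ _ (s ^+ 2 * (C * T x ^+ m + E * T x ^+ n))); last first.
  by rewrite ler_wpM2l ?sqr_ge0// (le_trans (ler_norm _))// hB.
rewrite [X in `|X|](_ : _ = (h s x - h0 x - s * h1 x) + (k s x - k0 x - s * k1 x)).
  by rewrite mulrDr; apply: (le_trans (ler_normD _ _)); apply: lerD; [exact: hC|exact: kE].
by ring.
Qed.

Lemma germ_cst f : tame f -> germ (fun _ => f) f (fun=> 0).
Proof.
move=> tf; split => //; first exact: tame_cst.
exists 0, 0%N => x s Dx s01.
by rewrite mulr0 subr0 subrr normr0 mul0r mulr0.
Qed.

Lemma germ_lin u : tame u -> germ (fun s x => 1 + s * u x) (fun=> 1) u.
Proof.
move=> tu; split => //; first exact: tame_cst.
exists 0, 0%N => x s Dx s01.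
by rewrite [X in `|X|](_ : _ = 0) ?normr0 ?mul0r ?mulr0//; ring.
Qed.

Lemma germ_sum I (r : seq I) (P : pred I) (h : I -> R -> X -> R) (h0 h1 : I -> X -> R) :
  (forall i, P i -> germ (h i) (h0 i) (h1 i)) ->
  germ (fun s x => \sum_(i <- r | P i) h i s x) (fun x => \sum_(i <- r | P i) h0 i x)
    (fun x => \sum_(i <- r | P i) h1 i x).
Proof.
move=> gh; elim: r => [|i r IH].
  apply: germ_ext (germ_cst (tame_cst 0)) => //= *; rewrite big_nil//.
have [Pi|Pi] := boolP (P i).
  by apply: germ_ext (germD (gh _ Pi) IH) => //= *; rewrite big_cons Pi.
by apply: germ_ext IH => //= *; rewrite big_cons (negbTE Pi).
Qed.

Lemma germ_prod1 I (r : seq I) (P : pred I) (h : I -> R -> X -> R) (h1 : I -> X -> R) :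
  (forall i, P i -> germ (h i) (fun=> 1) (h1 i)) ->
  germ (fun s x => \prod_(i <- r | P i) h i s x) (fun=> 1)
    (fun x => \sum_(i <- r | P i) h1 i x).
Proof.
move=> gh; elim: r => [|i r IH].
  apply: germ_ext (germ_cst (tame_cst 1)) => //= *; rewrite big_nil//.
have [Pi|Pi] := boolP (P i).
  apply: germ_ext (germM (gh _ Pi) IH) => //= *; rewrite ?big_cons ?Pi ?mulr1 ?mul1r//.
by apply: germ_ext IH => //= *; rewrite big_cons (negbTE Pi).
Qed.

Lemma germX (h : R -> X -> R) (h1 : X -> R) n : germ h (fun=> 1) h1 ->
  germ (fun s x => h s x ^+ n) (fun=> 1) (fun x => n%:R * h1 x).
Proof.
move=> gh; have := @germ_prod1 _ (index_enum 'I_n) xpredT (fun=> h) (fun=> h1) (fun _ _ => gh).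
apply: germ_ext => // [s x _ _|x _]; first by rewrite prodr_const card_ord.
by rewrite sumr_const card_ord mulr_natl.
Qed.

Lemma germ_powR r u : tame u -> (forall x, D x -> 0 <= u x) ->
  germ (fun s x => (1 + s * u x) `^ r) (fun=> 1) (fun x => r * u x).
Proof.
move=> tu u0; split; [exact: tame_cst|by apply: tameM => //; exact: tame_cst|].
pose N := (Num.truncn `|r|).+1.
have tB : tame (fun x => (r ^+ 2 + `|r|) * u x ^+ 2 * (1 + u x) ^+ N).
  apply: tameM; first by apply: tameM; [exact: tame_cst|exact: tameX].
  by apply: tameX; apply: tameD => //; exact: tame_cst.
case: tB => B [p hB]; exists B, p => x s Dx /andP[s0 s1].
have ux := u0 _ Dx; have su0 : 0 <= s * u x by rewrite mulr_ge0.
have su1 : s * u x <= u x by rewrite ler_piMl.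
have := powR_taylor r su0; rewrite mulrCA => /le_trans; apply.
apply: (@le_trans _ _ (s ^+ 2 * ((r ^+ 2 + `|r|) * u x ^+ 2 * (1 + u x) ^+ N))).
  have r0 : 0 <= r ^+ 2 + `|r| by rewrite addr_ge0 ?sqr_ge0.
  rewrite [leLHS](_ : _ =
    s ^+ 2 * ((r ^+ 2 + `|r|) * u x ^+ 2 * (1 + s * u x) ^+ N)); last by ring.
  rewrite ler_wpM2l ?sqr_ge0// ler_wpM2l ?mulr_ge0 ?sqr_ge0//.
  by rewrite lerXn2r ?nnegrE ?addr_ge0// lerD2l.
by rewrite ler_wpM2l ?sqr_ge0// (le_trans (ler_norm _))// hB.
Qed.

Lemma germ_expR u : tame u -> (forall x, D x -> 0 <= u x) ->
  germ (fun s x => expR (- (s * u x))) (fun=> 1) (fun x => - u x).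
Proof.
move=> tu u0; split; [exact: tame_cst|exact: tameN|].
have [B [p hB]] : tame (fun x => u x ^+ 2) by exact: tameX.
exists B, p => x s Dx /andP[s0 s1].
have ux := u0 _ Dx; have su0 : 0 <= s * u x by rewrite mulr_ge0.
apply: (@le_trans _ _ (s ^+ 2 * u x ^+ 2)); last first.
  by rewrite ler_wpM2l ?sqr_ge0// (le_trans (ler_norm _))// hB.
rewrite mulrN -exprMn; set v := s * u x.
have v1 : 0 < 1 + v by rewrite ltr_pwDl.
rewrite ger0_norm; last by have := expR_ge1Dx (- v); lra.
have : expR (- v) <= (1 + v)^-1.
  by rewrite expRN lef_pV2 ?posrE ?expR_gt0// expR_ge1Dx.
suff : (1 + v)^-1 <= 1 - v + v ^+ 2 by lra.
rewrite -[leLHS]mul1r ler_pdivrMr//.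
have : 0 <= v ^+ 3 by rewrite exprn_ge0.
by rewrite -subr_ge0 => v3; rewrite -subr_ge0 [X in 0 <= X](_ : _ = v ^+ 3 - 0) //; ring.
Qed.

End germs.

(** * The Laguerre weight under polynomial shifts *)

Lemma measurable_prod_cond d (T : measurableType d) (R : realType) (I : finType)
    (P : pred I) (h : I -> T -> R) : (forall i, measurable_fun setT (h i)) ->
  measurable_fun setT (fun x => \prod_(i | P i) h i x).
Proof.
move=> mh; under eq_fun do rewrite big_mkcond.
by apply: measurable_prod => i _; case: (P i).
Qed.

Section laguerre_invariance.
Context {R : realType}.
Variables (n : nat) (beta M : R).
Hypotheses (n_gt0 : (0 < n)%N) (beta_gt0 : 0 < beta) (M_gt : n%:R - 1 < M).
Implicit Types (x : n.-tuple R) (s : R) (k : nat).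

Let a := beta / 2 * (M - n%:R + 1).
Let b := beta * M / 2.
Local Notation w := (@laguerre_weight R n beta M).

Definition pos_tuple : set (n.-tuple R) := [set x | forall i, 0 < tnth x i].
Local Notation D := pos_tuple.

Definition shift_tuple s k x : n.-tuple R := [tuple of map (pshift s k) x].

(** The quotient of u^(k+1) - v^(k+1) by u - v, written as a sum in order to
    make sense on the diagonal. *)
Definition diff_quot k (u v : R) : R := \sum_(l < k.+1) u ^+ (k - l) * v ^+ l.

(** The weight at the shifted point times the Jacobian of the shift, divided
    by the weight at the original point, on the positive orthant. *)
Definition shift_factor s k x : R :=
  (\prod_(p : 'I_n * 'I_n | (p.1 < p.2)%N)
    (1 + s * diff_quot k (tnth x p.2) (tnth x p.1)) `^ beta) *
  \prod_(i < n) ((1 + s * tnth x i ^+ k) `^ (a - 1) *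
    (1 + s * (k.+1%:R * tnth x i ^+ k)) * expR (- (s * (b * tnth x i ^+ k.+1)))).

Lemma laguerre_M_gt0 : 0 < M.
Proof.
by apply: le_lt_trans M_gt; rewrite subr_ge0 ler1n.
Qed.

Lemma laguerre_rate_gt0 : 0 < b.
Proof. by rewrite divr_gt0// mulr_gt0// laguerre_M_gt0. Qed.

Lemma pos_tupleP x : reflect (D x) [forall i, 0 < tnth x i].
Proof. exact: forallP. Qed.

Lemma prod_pos_tuple x : \prod_(i < n) (0 < tnth x i)%R%:R = [forall i, 0 < tnth x i]%:R :> R.
Proof.
case: (pos_tupleP x) => Dx; first by rewrite big1// => i _; rewrite Dx.
move/pos_tupleP : Dx; rewrite negb_forall => /existsP[i xi].
by rewrite (bigD1 i)//= (negbTE xi) mul0r.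
Qed.

Lemma laguerre_weight_ge0 x : 0 <= w x.
Proof.
rewrite /laguerre_weight; case: ifPn => // _; apply: mulr_ge0.
  by apply: prodr_ge0 => p _; exact: powR_ge0.
by apply: prodr_ge0 => i _; rewrite mulr_ge0 ?powR_ge0 ?expR_ge0.
Qed.

Lemma laguerre_weight_notpos x : ~ D x -> w x = 0.
Proof. by rewrite /laguerre_weight; case: (pos_tupleP x). Qed.

Lemma measurable_tnth_tuple i : measurable_fun setT (fun x => tnth x i).
Proof. exact: (@measurable_tnth _ R). Qed.

Lemma measurable_laguerre_weight : measurable_fun setT w.
Proof.
have mt := measurable_tnth_tuple.
have -> : w = fun x => (\prod_(i < n) (0 < tnth x i)%R%:R) *
    ((\prod_(p : 'I_n * 'I_n | (p.1 < p.2)%N) `|tnth x p.2 - tnth x p.1| `^ beta) *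
    \prod_(i < n) (tnth x i `^ (a - 1) * expR (- (b * tnth x i)))).
  apply/funext => x; rewrite prod_pos_tuple /laguerre_weight; case: ifP => _.
    by rewrite mul1r.
  by rewrite mul0r.
apply: measurable_funM; [|apply: measurable_funM]; apply: measurable_prod_cond => i.
- have -> : (fun x => (0 < tnth x i)%R%:R) =
      (\1_(`]0%R, +oo[%classic) : R -> R) \o (fun x => tnth x i).
    by apply/funext => x; rewrite /= indicE mem_setE in_itv/= andbT.
  by apply: measurableT_comp => //; exact: measurable_indic.
- apply: (measurableT_comp (measurable_powR _)); apply: measurableT_comp => //.
  exact: measurable_funB.
- apply: measurable_funM; first exact: (measurableT_comp (measurable_powR _)).
  apply: measurableT_comp => //; apply: measurableT_comp => //.
  exact: measurable_funM.
Qed.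

Lemma shift_tuple_pos s k x : 0 <= s -> D x -> D (shift_tuple s k x).
Proof.
move=> s0 Dx i; rewrite tnth_map; apply: lt_le_trans (le_pshift _ s0 _) => //.
exact: ltW.
Qed.

Lemma diff_quot_ge0 k (u v : R) : 0 <= u -> 0 <= v -> 0 <= diff_quot k u v.
Proof. by move=> u0 v0; apply: sumr_ge0 => l _; rewrite mulr_ge0 ?exprn_ge0. Qed.

Lemma pshiftB s k (u v : R) :
  pshift s k u - pshift s k v = (u - v) * (1 + s * diff_quot k u v).
Proof.
have : u ^+ k.+1 - v ^+ k.+1 = (u - v) * diff_quot k u v.
  by rewrite subrXX.
by rewrite mulrDr mulrCA => <-; rewrite /pshift; ring.
Qed.

(** Every factor of the weight is multiplicative under the shift: the
    differences by [pshiftB], and the coordinates because x + s x^(k+1) = x (1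
    + s x^k). *)
Lemma laguerre_weight_shift s k x : 0 <= s ->
  w (shift_tuple s k x) * \prod_(i < n) jac_pshift s k (tnth x i) =
  w x * shift_factor s k x.
Proof.
move=> s0; have [Dx|nDx] := pselect (D x); last first.
  rewrite (laguerre_weight_notpos nDx) mul0r.
  move: nDx => /pos_tupleP; rewrite negb_forall => /existsP[i xi].
  by rewrite (bigD1 i)//= {1}/jac_pshift (negbTE xi) mul0r mulr0.
rewrite /laguerre_weight (introT (pos_tupleP _) Dx).
rewrite (introT (pos_tupleP _) (shift_tuple_pos k s0 Dx)).
rewrite /shift_factor [RHS]mulrACA -[LHS]mulrA -!big_split/=; congr (_ * _).
  apply: eq_bigr => p _; rewrite !tnth_map pshiftB normrM powRM//; congr (_ * _).
  by rewrite ger0_norm// addr_ge0// mulr_ge0// diff_quot_ge0// ltW.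
apply: eq_bigr => i _; rewrite tnth_map /jac_pshift Dx -/a -/b.
have xi := Dx i; set u := tnth x i in xi *.
have -> : pshift s k u = u * (1 + s * u ^+ k) by rewrite /pshift exprS; ring.
have u0 : 0 <= u by exact: ltW.
have v0 : 0 <= 1 + s * u ^+ k by rewrite addr_ge0// mulr_ge0// exprn_ge0.
rewrite powRM//.
have -> : expR (- (b * (u * (1 + s * u ^+ k)))) =
    expR (- (b * u)) * expR (- (s * (b * u ^+ k.+1))).
  by rewrite -expRD; congr expR; rewrite exprS; ring.
rewrite /dpshift; ring.
Qed.

End laguerre_invariance.

(** * Invariance and integrability under the Laguerre law *)

Lemma expr_le_expR (R : realType) (c t : R) m : 0 < c -> 0 <= t ->
  t ^+ m <= m`!%:R / c ^+ m * expR (c * t).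
Proof.
move=> c0 t0; rewrite mulrAC ler_pdivlMr ?exprn_gt0// -exprMn [t * c]mulrC.
have [->|m0] := posnP m.
  by rewrite expr0 fact0 mul1r -[leLHS](@expR0 R) ler_expR mulr_ge0// ltW.
have ct0 : 0 <= c * t by rewrite mulr_ge0// ltW.
have := expR_ge1Dxn m.-1 ct0; rewrite prednK// => h.
rewrite -ler_pdivrMl ?ltr0n ?fact_gt0// [leLHS]mulrC; apply: le_trans h.
by rewrite lerDr.
Qed.

Section laguerre_law.
Context {R : realType}.
Variables (n : nat) (beta M : R).
Hypotheses (n_gt0 : (0 < n)%N) (beta_gt0 : 0 < beta) (M_gt : n%:R - 1 < M).
Variable Q : probability (n.-tuple R) R.
Hypothesis QE : forall B, measurable B ->
  Q B = (\int[lebesgue_tuple n]_(x in B) (laguerre_pdf beta M x)%:E)%E.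
Implicit Types (x : n.-tuple R) (s : R) (k : nat) (f g : n.-tuple R -> R).

Let a := beta / 2 * (M - n%:R + 1).
Let b := beta * M / 2.
Local Notation w := (@laguerre_weight R n beta M).
Local Notation pdf := (@laguerre_pdf R n beta M).
Local Notation D := (@pos_tuple R n).
Local Notation Rf := (@shift_factor R n beta M).

Lemma laguerre_pdf_ge0 x : 0 <= pdf x.
Proof.
rewrite mulr_ge0 ?laguerre_weight_ge0// invr_ge0.
by apply: Rintegral_ge0 => y _; exact: laguerre_weight_ge0.
Qed.

Lemma measurable_laguerre_pdf : measurable_fun setT pdf.
Proof. by apply: measurable_funM => //; exact: measurable_laguerre_weight. Qed.

Lemma laguerre_pdf_notpos x : ~ D x -> pdf x = 0.
Proof. by move=> Dx; rewrite /laguerre_pdf laguerre_weight_notpos// mulr0. Qed.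

Lemma laguerre_integralE f : measurable_fun setT f ->
  (\int[Q]_x (f x)%:E = \int[lebesgue_tuple n]_x (f x * pdf x)%:E)%E.
Proof.
move=> mf; apply: integral_density => //; first exact: measurable_laguerre_pdf.
exact: laguerre_pdf_ge0.
Qed.

Lemma laguerre_integral_le f g : measurable_fun setT f -> measurable_fun setT g ->
  (forall x, 0 <= f x) -> (forall x, 0 <= g x) ->
  (forall x, D x -> f x <= g x) ->
  (\int[Q]_x (f x)%:E <= \int[Q]_x (g x)%:E)%E.
Proof.
move=> mf mg f0 g0 fg; rewrite !laguerre_integralE//.
have mp := measurable_laguerre_pdf.
apply: ge0_le_integral => //.
- by move=> x _; rewrite lee_fin mulr_ge0// laguerre_pdf_ge0.
- by apply/measurable_EFinP; exact: measurable_funM.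
- by apply/measurable_EFinP; exact: measurable_funM.
- move=> x _; rewrite lee_fin; have [Dx|nDx] := pselect (D x).
    by rewrite ler_wpM2r ?laguerre_pdf_ge0// fg.
  by rewrite laguerre_pdf_notpos// !mulr0.
Qed.

Lemma measurable_shift_factor s k : measurable_fun setT (Rf s k).
Proof.
have mt := @measurable_tnth_tuple R n.
apply: measurable_funM; apply: measurable_prod_cond => i.
  apply: (measurableT_comp (measurable_powR _)).
  apply: measurable_funD => //; apply: measurable_funM => //.
  apply: measurable_sum => l; apply: measurable_funM; exact: measurable_funX.
apply: measurable_funM; [apply: measurable_funM|].
- apply: (measurableT_comp (measurable_powR _)).
  apply: measurable_funD => //; apply: measurable_funM => //.
  exact: measurable_funX.
- apply: measurable_funD => //; apply: measurable_funM => //.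
  by apply: measurable_funM => //; exact: measurable_funX.
- apply: measurableT_comp => //; apply: measurableT_comp => //.
  apply: measurable_funM => //; apply: measurable_funM => //.
  exact: measurable_funX.
Qed.

Lemma laguerre_invariance s k f : 0 <= s -> measurable_fun setT f ->
  (\int[Q]_x (f x)%:E = \int[Q]_x (f (shift_tuple s k x) * Rf s k x)%:E)%E.
Proof.
move=> s0 mf.
have mS : measurable_fun setT (fun x => shift_tuple s k x).
  by apply: measurable_map_tuple; exact: measurable_pshift.
have mR := measurable_shift_factor s k.
rewrite !laguerre_integralE//; last first.
  by apply: measurable_funM => //; exact: measurableT_comp.
transitivity (\int[lebesgue_tuple n]_x (f x * pdf x *
    \prod_(i < n) (0 < tnth x i)%R%:R)%:E)%E.
  apply: eq_integral => x _; rewrite prod_pos_tuple; congr (_%:E).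
  case: (pos_tupleP x) => Dx; first by rewrite mulr1.
  by rewrite laguerre_pdf_notpos// !mulr0.
rewrite (@integral_pshift_tuple R s k n s0 (fun x => f x * pdf x)); last first.
  by apply: measurable_funM => //; exact: measurable_laguerre_pdf.
apply: eq_integral => x _; rewrite /= -/(shift_tuple s k x).
rewrite -[in LHS]mulrA -[in RHS]mulrA; congr (_ * _)%:E.
by rewrite /laguerre_pdf -[in LHS]mulrA laguerre_weight_shift//; ring.
Qed.

(** At least 1, so that its powers increase with the exponent. *)
Definition tuple_size x : R := 1 + \sum_(i < n) `|tnth x i|.

Lemma tuple_size_ge1 x : 1 <= tuple_size x.
Proof. by rewrite lerDl sumr_ge0. Qed.

Lemma measurable_tuple_size : measurable_fun setT tuple_size.
Proof.
apply: measurable_funD => //; apply: measurable_sum => i.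
by apply: measurableT_comp => //; exact: measurable_tnth_tuple.
Qed.

(** Dilating every coordinate by 2 doubles the exponent b / 2 of the integrand
    to b, while the invariance identity brings in the exponential of - b times
    the sum of the coordinates: the two cancel. *)
Lemma laguerre_exp_moment :
  (\int[Q]_x (expR (b / 2 * tuple_size x))%:E < +oo)%E.
Proof.
have mS := measurable_tuple_size.
have me : measurable_fun setT (fun x => expR (b / 2 * tuple_size x)).
  by apply: measurableT_comp => //; exact: measurable_funM.
rewrite (@laguerre_invariance 1 0)//.
pose C : R := expR (b / 2) * (\prod_(p : 'I_n * 'I_n | (p.1 < p.2)%N) 2 `^ beta) *
  \prod_(i < n) (2 `^ (a - 1) * 2).
have C0 : 0 <= C.
  rewrite !mulr_ge0 ?expR_ge0//; apply: prodr_ge0 => i _; first exact: powR_ge0.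
  by rewrite mulr_ge0 ?powR_ge0.
apply: (@le_lt_trans _ _ (\int[Q]_x C%:E)%E); last first.
  by rewrite integral_cst// [X in (_ * X)%E](probability_setT Q) mule1 ltry.
have RE x : Rf 1 0 x = (\prod_(p : 'I_n * 'I_n | (p.1 < p.2)%N) 2 `^ beta) *
    \prod_(i < n) (2 `^ (a - 1) * 2) * expR (- \sum_(i < n) (b * tnth x i)).
  rewrite -mulrA /shift_factor; congr (_ * _).
    apply: eq_bigr => p _; congr (_ `^ _).
    by rewrite /diff_quot big_ord1 !expr0 !mul1r.
  rewrite -sumrN expR_sum -big_split/=; apply: eq_bigr => i _.
  by rewrite expr0 expr1 !mul1r -/a -/b.
have mR : measurable_fun setT (Rf 1 0).
  rewrite (funext RE).
  apply: measurable_funM => //; apply: measurableT_comp => //.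
  apply: measurableT_comp => //; apply: measurable_sum => i.
  by apply: measurable_funM => //; exact: measurable_tnth_tuple.
apply: (@laguerre_integral_le (fun x => expR (b / 2 * tuple_size (shift_tuple 1 0 x)) *
  Rf 1 0 x)) => //.
- apply: measurable_funM => //.
  apply: (measurableT_comp me); apply: measurable_map_tuple.
  exact: measurable_pshift.
- move=> x; rewrite RE !mulr_ge0 ?expR_ge0//; apply: prodr_ge0 => i _.
    exact: powR_ge0.
  by rewrite mulr_ge0 ?powR_ge0.
- move=> x Dx; rewrite RE /C le_eqVlt; apply/orP; left; apply/eqP.
  have -> : tuple_size (shift_tuple 1 0 x) = 1 + 2 * \sum_(i < n) tnth x i.
    rewrite /tuple_size mulr_sumr; congr (_ + _); apply: eq_bigr => i _.
    rewrite tnth_map ger0_norm /pshift ?expr1 ?mul1r ?mulr2n ?mulrDl ?mul1r//.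
    by rewrite addr_ge0 ?ltW.
  rewrite -mulr_sumr; set S := \sum_(i < n) tnth x i.
  have -> : expR (b / 2 * (1 + 2 * S)) = expR (b / 2) * expR (b * S).
    by rewrite -expRD; congr expR; field.
  by rewrite mulrACA expRxMexpNx_1 mulr1 mulrA.
Qed.

Lemma laguerre_integrable_tame f : measurable_fun setT f ->
  tame D tuple_size f -> Q.-integrable setT (EFin \o f).
Proof.
move=> mf /tame_ge0P[x _|C [m [C0 fC]]]; first exact: tuple_size_ge1.
apply/integrableP; split; first exact/measurable_EFinP.
have b0 : 0 < b / 2 by rewrite divr_gt0// (laguerre_rate_gt0 n_gt0).
pose K := C * (m`!%:R / (b / 2) ^+ m).
have K0 : 0 <= K by rewrite mulr_ge0// divr_ge0// exprn_ge0// ltW.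
have me : measurable_fun setT (fun x => expR (b / 2 * tuple_size x)).
  by apply: measurableT_comp => //; apply: measurable_funM => //; exact: measurable_tuple_size.
apply: (@le_lt_trans _ _ (\int[Q]_x (K * expR (b / 2 * tuple_size x))%:E)%E).
  apply: (@laguerre_integral_le (fun x => `|f x|)) => //.
  - exact: measurableT_comp.
  - exact: measurable_funM.
  - by move=> x; rewrite mulr_ge0 ?expR_ge0.
  - move=> x Dx; apply: (le_trans (fC x Dx)); rewrite /K -mulrA ler_wpM2l//.
    by rewrite expr_le_expR// (le_trans _ (tuple_size_ge1 x)).
rewrite -[ltLHS]/(\int[Q]_x (K%:E * (expR (b / 2 * tuple_size x))%:E))%E.
rewrite ge0_integralZl//.
- by rewrite lte_mul_pinfty// laguerre_exp_moment.
- exact/measurable_EFinP.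
Qed.

(** The difference quotients of h at 0 have mean zero, and they differ from h1
    by at most s times an integrable function. *)
Lemma laguerre_germ_mean (h : R -> n.-tuple R -> R) (h0 h1 : n.-tuple R -> R) :
  (forall s, 0 <= s -> measurable_fun setT (h s)) ->
  measurable_fun setT h0 -> measurable_fun setT h1 ->
  germ D tuple_size h h0 h1 ->
  (forall s, 0 < s -> (\int[Q]_x (h s x)%:E = \int[Q]_x (h0 x)%:E)%E) ->
  \int[Q]_x h1 x = 0.
Proof.
move=> mh mh0 mh1 [th0 th1 [C [m hC]]] hE.
have mS := measurable_tuple_size.
have i0 := laguerre_integrable_tame mh0 th0.
have i1 := laguerre_integrable_tame mh1 th1.
pose r s x := h s x - h0 x - s * h1 x.
have mr s : 0 <= s -> measurable_fun setT (r s).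
  move=> s0; apply: measurable_funB; last exact: measurable_funM.
  by apply: measurable_funB => //; exact: mh.
have ir s : 0 <= s <= 1 -> Q.-integrable setT (EFin \o r s).
  move=> s01; apply: laguerre_integrable_tame; first by apply: mr; case/andP : s01.
  by exists (s ^+ 2 * C), m => x Dx; rewrite -mulrA; exact: hC.
pose B x := C * tuple_size x ^+ m.
have mB : measurable_fun setT B by apply: measurable_funM => //; exact: measurable_funX.
have iB : Q.-integrable setT (EFin \o (fun x => `|B x|)).
  apply: laguerre_integrable_tame; first exact: measurableT_comp.
  exists `|C|, m => x Dx; rewrite normr_id normrM ler_wpM2l//.
  by rewrite ger0_norm// exprn_ge0// (le_trans _ (tuple_size_ge1 x)).
pose K := \int[Q]_x `|B x|.
have K0 : 0 <= K by apply: Rintegral_ge0 => x _.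
have key s : 0 < s <= 1 -> `|\int[Q]_x h1 x| <= s * K.
  move=> /andP[s0 s1]; have s01 : 0 <= s <= 1 by rewrite (ltW s0).
  have ish1 : Q.-integrable setT (EFin \o (fun x => s * h1 x)).
    by apply: (@eq_integrable _ _ _ _ _ measurableT (fun x => s%:E * (h1 x)%:E)%E) => //; exact: integrableZl.
  have h0r : Q.-integrable setT (EFin \o (fun x => h0 x + s * h1 x)).
    apply: (@eq_integrable _ _ _ _ _ measurableT
      ((EFin \o h0) \+ (EFin \o (fun x => (s * h1 x)%R)))%E) => //.
    exact: integrableD.
  have : \int[Q]_x h s x = \int[Q]_x h0 x by rewrite /Rintegral hE.
  rewrite (_ : h s = fun x => (h0 x + s * h1 x) + r s x); last first.
    by apply/funext => x; rewrite /r; ring.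
  rewrite RintegralD//; last exact: ir.
  rewrite RintegralD// RintegralZl// -addrA => /eqP.
  rewrite -subr_eq0 addrAC subrr add0r addr_eq0 => /eqP E.
  rewrite -(ler_pM2l s0) -[leLHS](@ger0_norm _ (s * _)); last by rewrite mulr_ge0// ltW.
  rewrite normrM normr_id -normrM E normrN.
  apply: (le_trans (le_normr_Rintegral _ (ir _ s01))) => //.
  rewrite mulrA -expr2 -RintegralZl//; apply: fine_le; [apply: integrable_fin_num => //|apply: integrable_fin_num => //|].
  - apply: laguerre_integrable_tame; first by apply: measurableT_comp => //; exact: mr (ltW s0).
    exists (s ^+ 2 * C), m => x Dx; rewrite normr_id -mulrA; exact: hC.
  - by apply: (@eq_integrable _ _ _ _ _ measurableT (fun x => (s ^+ 2)%:E * `|B x|%:E)%E) => //; exact: integrableZl.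
  - apply: (@laguerre_integral_le (fun x => `|r s x|) (fun x => s ^+ 2 * `|B x|)) => //.
    + by apply: measurableT_comp => //; exact: mr (ltW s0).
    + by apply: measurable_funM => //; exact: measurableT_comp.
    + by move=> x; rewrite mulr_ge0 ?sqr_ge0.
    + move=> x Dx; apply: (le_trans (hC _ _ Dx s01)).
      by rewrite ler_wpM2l ?sqr_ge0// ler_norm.
apply/eqP; rewrite -normr_eq0 eq_le normr_ge0 andbT leNgt; apply/negP => e0.
set e := `|_| in key e0.
have Ke : 0 < K + e by rewrite ltr_wpDl.
have /key : 0 < Num.min 1 (e / (2 * (K + e))) <= 1.
  by rewrite lt_min ltr01 divr_gt0 ?mulr_gt0//= ge_min lexx.
apply/negP; rewrite -ltNge; apply: (@le_lt_trans _ _ (e / (2 * (K + e)) * K)).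
  by rewrite ler_wpM2r// ge_min lexx orbT.
rewrite mulrAC ltr_pdivrMr ?mulr_gt0// ltr_pM2l//; lra.
Qed.

End laguerre_law.

(** * Loop equations *)

Section symmetric_sums.
Context {R : realType}.
Implicit Types (k : nat) (u v : R).

Lemma diff_quotC k u v : diff_quot k u v = diff_quot k v u.
Proof.
rewrite /diff_quot [RHS](reindex_inj rev_ord_inj)/=; apply: eq_bigr => l _.
by rewrite subSS subKn 1?mulrC// -ltnS.
Qed.

Lemma diff_quot_diag k u : diff_quot k u u = k.+1%:R * u ^+ k.
Proof.
rewrite /diff_quot (eq_bigr (fun=> u ^+ k)) => [|l _].
  by rewrite sumr_const card_ord mulr_natl.
by rewrite -exprD subnK// -ltnS.
Qed.

(** The sum of [diff_quot] over all ordered pairs is a sum of products of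
    power sums; the diagonal accounts for the last term. *)
Lemma sum_diff_quot n k (x : n.-tuple R) :
  2 * \sum_(p : 'I_n * 'I_n | (p.1 < p.2)%N) diff_quot k (tnth x p.2) (tnth x p.1) =
  (\sum_(l < k.+1) (\sum_(i < n) tnth x i ^+ (k - l)) * (\sum_(i < n) tnth x i ^+ l)) -
  k.+1%:R * \sum_(i < n) tnth x i ^+ k.
Proof.
pose q (p : 'I_n * 'I_n) := diff_quot k (tnth x p.2) (tnth x p.1).
have -> : \sum_(l < k.+1) (\sum_(i < n) tnth x i ^+ (k - l)) *
    (\sum_(i < n) tnth x i ^+ l) = \sum_p q p.
  rewrite -(pair_bigA _ (fun i j => q (i, j)))/= exchange_big/=.
  under [RHS]eq_bigr => j _ do rewrite /q /diff_quot/= exchange_big/=.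
  rewrite [RHS]exchange_big/=; apply: eq_bigr => l _; rewrite mulr_suml.
  by apply: eq_bigr => j _; rewrite mulr_sumr.
have -> : k.+1%:R * \sum_(i < n) tnth x i ^+ k = \sum_(p : 'I_n * 'I_n | p.1 == p.2) q p.
  rewrite -(pair_big_dep xpredT (fun i j => i == j) (fun i j => q (i, j)))/= mulr_sumr.
  apply: eq_bigr => i _; rewrite (big_pred1 i) => [|j]; last by rewrite /= eq_sym.
  by rewrite /q diff_quot_diag.
rewrite [X in _ = X - _](bigID (fun p : 'I_n * 'I_n => p.1 == p.2))/=.
rewrite addrAC subrr add0r.
rewrite [RHS](bigID (fun p : 'I_n * 'I_n => (p.1 < p.2)%N))/= mulr2n mulrDl !mul1r.
congr (_ + _).
  apply: eq_bigl => p; case: ltngtP => //; rewrite ?andbF ?andbT// => h.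
  - by rewrite -val_eqE/= neq_ltn h.
rewrite (reindex_inj (h := fun p : 'I_n * 'I_n => (p.2, p.1)))/=; last first.
  by move=> [? ?] [? ?] [-> ->].
apply: eq_big => [p|p _]; last by rewrite /q/= diff_quotC.
by rewrite -val_eqE/= -leqNgt ltn_neqAle eq_sym.
Qed.
End symmetric_sums.

Section loop_equation.
Context {R : realType}.
Variables (n : nat) (beta M : R).
Hypotheses (n_gt0 : (0 < n)%N) (beta_gt0 : 0 < beta) (M_gt : n%:R - 1 < M).
Variable Q : probability (n.-tuple R) R.
Hypothesis QE : forall B, measurable B ->
  Q B = (\int[lebesgue_tuple n]_(x in B) (laguerre_pdf beta M x)%:E)%E.
Variable u : nat -> R.
Implicit Types (x : n.-tuple R) (s : R) (k j : nat) (l : seq nat) (f g : n.-tuple R -> R).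

Local Notation D := (@pos_tuple R n).
Local Notation T := (@tuple_size R n).

Definition power_mean k x : R := n%:R^-1 * \sum_(i < n) tnth x i ^+ k.
Definition centered_mean k x : R := power_mean k x - u k.
Definition centered_prod l x : R := \prod_(j <- l) centered_mean j x.

Definition remove_at i l := take i l ++ drop i.+1 l.

Let T1 x : D x -> 1 <= T x.
Proof. by move=> _; exact: tuple_size_ge1. Qed.

Lemma tame_tnth i : tame D T (fun x => tnth x i).
Proof.
apply: (tame_le (tame_size T1)) => x Dx.
rewrite [leRHS]ger0_norm; last by rewrite (le_trans _ (tuple_size_ge1 x)).
by rewrite /tuple_size (bigD1 i)//= addrCA lerDl addr_ge0// sumr_ge0.
Qed.

Lemma tame_power_mean k : tame D T (power_mean k).
Proof.
rewrite /power_mean; apply: tameM; first exact: tame_cst.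
by apply: (tame_sum T1) => i _; apply: tameX; exact: tame_tnth.
Qed.

Lemma measurable_power_mean k : measurable_fun setT (power_mean k).
Proof.
apply: measurable_funM => //; apply: measurable_sum => i.
by apply: measurable_funX; exact: measurable_tnth_tuple.
Qed.

Lemma tame_centered_prod l : tame D T (centered_prod l).
Proof.
elim: l => [|j l IH].
  by apply: (tame_ext (tame_cst D T 1)) => x _; rewrite /centered_prod big_nil.
apply: (tame_ext (g := fun x => centered_mean j x * centered_prod l x)).
  apply: tameM => //; apply: (tameD T1); first exact: tame_power_mean.
  exact: tame_cst.
by move=> x _; rewrite /centered_prod big_cons.
Qed.

Lemma measurable_centered_prod l : measurable_fun setT (centered_prod l).
Proof.
apply: measurable_prod => j _; apply: measurable_funB => //.
exact: measurable_power_mean.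
Qed.

Lemma integrable_centered_prod l : Q.-integrable setT (EFin \o centered_prod l).
Proof.
apply: (laguerre_integrable_tame n_gt0 beta_gt0 M_gt QE).
  exact: measurable_centered_prod.
exact: tame_centered_prod.
Qed.

(** The derivative of [centered_prod l] along the shift of order k, as the
    product rule produces it. *)
Fixpoint shift_deriv k l x : R := if l is j :: l' then
  j%:R * power_mean (j + k) x * centered_prod l' x + centered_mean j x * shift_deriv k l' x
  else 0.

Lemma shift_derivE k l x : shift_deriv k l x =
  \sum_(i < size l) (nth 0%N l i)%:R * power_mean (nth 0%N l i + k) x *
    centered_prod (remove_at i l) x.
Proof.
elim: l => [|j l IH] /=; first by rewrite big_ord0.
rewrite big_ord_recl/= /remove_at/= drop0; congr (_ + _).
rewrite IH mulr_sumr; apply: eq_bigr => i _.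
by rewrite /= {2}/centered_prod /= big_cons -/(centered_prod _ _); ring.
Qed.

Lemma measurable_shift_deriv k l : measurable_fun setT (shift_deriv k l).
Proof.
have mp := measurable_power_mean.
elim: l => [|j l IH] /=; first exact: measurable_cst.
apply: measurable_funD; apply: measurable_funM => //.
- exact: measurable_funM.
- exact: measurable_centered_prod.
- exact: measurable_funB.
Qed.

Lemma germ_power_mean k j : germ D T (fun s x => power_mean j (shift_tuple s k x))
  (power_mean j) (fun x => j%:R * power_mean (j + k) x).
Proof.
have tX i m : tame D T (fun x => tnth x i ^+ m) by apply: tameX; exact: tame_tnth.
have gi i : germ D T (fun s x => tnth x i ^+ j * (1 + s * tnth x i ^+ k) ^+ j)
    (fun x => tnth x i ^+ j * 1)
    (fun x => 0 * 1 + tnth x i ^+ j * (j%:R * tnth x i ^+ k)).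
  apply: (germM T1) => //; first exact: germ_cst.
  by apply: (germX T1); exact: germ_lin.
have := germM T1 (germ_cst (tame_cst D T n%:R^-1))
  (germ_sum T1 (index_enum 'I_n) (P := xpredT) (fun i _ => gi i)).
apply: germ_ext => [s x Dx s01|x Dx|x Dx].
- rewrite /power_mean; congr (_ * _); apply: eq_bigr => i _.
  by rewrite tnth_map /pshift -exprMn; congr (_ ^+ _); rewrite exprS; ring.
- by rewrite /power_mean; congr (_ * _); apply: eq_bigr => i _; rewrite mulr1.
- rewrite mul0r add0r /power_mean mulrCA; congr (_ * _); rewrite mulr_sumr.
  by apply: eq_bigr => i _; rewrite mul0r add0r exprD; ring.
Qed.

Lemma germ_centered_prod k l : germ D T (fun s x => centered_prod l (shift_tuple s k x))
  (centered_prod l) (shift_deriv k l).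
Proof.
elim: l => [|j l IH].
  by apply: germ_ext (germ_cst (tame_cst D T 1)) => *; rewrite ?/centered_prod ?big_nil.
have gj : germ D T (fun s x => centered_mean j (shift_tuple s k x)) (centered_mean j)
    (fun x => j%:R * power_mean (j + k) x + 0).
  exact: germD (germ_power_mean k j) (germ_cst (tame_cst D T (- u j))).
by apply: germ_ext (germM T1 gj IH) => *; rewrite /centered_prod ?big_cons//= addr0.
Qed.

Let a := beta / 2 * (M - n%:R + 1).
Let b := beta * M / 2.
Local Notation Rf := (@shift_factor R n beta M).

(** The derivative of [shift_factor] at s = 0. *)
Definition shift_factor_deriv k x : R :=
  beta * (\sum_(p : 'I_n * 'I_n | (p.1 < p.2)%N) diff_quot k (tnth x p.2) (tnth x p.1)) +
  ((a + k%:R) * (n%:R * power_mean k x) - b * (n%:R * power_mean k.+1 x)).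

Lemma germ_shift_factor k : germ D T (fun s x => Rf s k x) (fun=> 1) (shift_factor_deriv k).
Proof.
have tX i m : tame D T (fun x => tnth x i ^+ m) by apply: tameX; exact: tame_tnth.
have pX i m x : D x -> 0 <= tnth x i ^+ m by move=> Dx; rewrite exprn_ge0// ltW.
have g1 : germ D T (fun s x => \prod_(p : 'I_n * 'I_n | (p.1 < p.2)%N)
      (1 + s * diff_quot k (tnth x p.2) (tnth x p.1)) `^ beta) (fun=> 1)
    (fun x => \sum_(p : 'I_n * 'I_n | (p.1 < p.2)%N)
      beta * diff_quot k (tnth x p.2) (tnth x p.1)).
  apply: (germ_prod1 T1) => p _; apply: (germ_powR T1).
    by apply: (tame_sum T1) => l _; exact: tameM.
  by move=> x Dx; rewrite diff_quot_ge0// ltW.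
have g2 : germ D T (fun s x => \prod_(i < n) ((1 + s * tnth x i ^+ k) `^ (a - 1) *
      (1 + s * (k.+1%:R * tnth x i ^+ k)) * expR (- (s * (b * tnth x i ^+ k.+1)))))
    (fun=> 1) (fun x => \sum_(i < n) (((a - 1) * tnth x i ^+ k * 1 + 1 * (k.+1%:R * tnth x i ^+ k)) * 1 +
       1 * 1 * - (b * tnth x i ^+ k.+1))).
  apply: (germ_prod1 T1) => i _.
  have ga := germ_powR T1 (a - 1) (tX i k) (pX i k).
  have gb := germ_lin (tameM (tame_cst D T k.+1%:R) (tX i k)).
  have gc : germ D T (fun s x => expR (- (s * (b * tnth x i ^+ k.+1)))) (fun=> 1)
      (fun x => - (b * tnth x i ^+ k.+1)).
    apply: germ_expR; first exact: (tameM (tame_cst D T b) (tX i k.+1)).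
    by move=> x Dx; rewrite mulr_ge0 ?pX// ltW// (laguerre_rate_gt0 n_gt0).
  by apply: germ_ext (germM T1 (germM T1 ga gb) gc) => // *; rewrite !mulr1.
apply: germ_ext (germM T1 g1 g2) => // [*|x Dx]; first by rewrite mulr1.
have n0 : n%:R != 0 :> R by rewrite pnatr_eq0 -lt0n.
rewrite mulr1 mul1r /shift_factor_deriv -mulr_sumr; congr (_ + _).
rewrite /power_mean !mulVKf// 2!mulr_sumr -sumrB; apply: eq_bigr => i _.
by rewrite -natr1; ring.
Qed.

Let gam := n%:R / M.
Let eps := 2 / (beta * M * n%:R).
Let A k := (M - n%:R) / M + (2 / beta - 1) * k%:R / M.

Hypothesis u0 : u 0%N = 1.
Hypothesis uS : forall k, u k.+1 = A k * u k + gam * \sum_(i < k.+1) u (k - i)%N * u i.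

Let centered_prod_cons j l x : centered_prod (j :: l) x = centered_mean j x * centered_prod l x.
Proof. by rewrite /centered_prod big_cons. Qed.

(** The recursion satisfied by u removes the deterministic terms, so that only
    centered means remain; the factor eps normalizes the coefficient of the
    highest one to -1. *)
Lemma shift_factor_derivE k x : eps * shift_factor_deriv k x =
  - centered_mean k.+1 x + A k * centered_mean k x +
  gam * \sum_(i < k.+1) (centered_mean (k - i)%N x * centered_mean i x +
    u (k - i)%N * centered_mean i x + u i * centered_mean (k - i)%N x).
Proof.
have n0 : n%:R != 0 :> R by rewrite pnatr_eq0 -lt0n.
have M0 : M != 0 by rewrite gt_eqF// (laguerre_M_gt0 n_gt0).
have b0 : beta != 0 by rewrite gt_eqF.
have SE j : \sum_(i < n) tnth x i ^+ j = n%:R * power_mean j x.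
  by rewrite /power_mean mulVKf.
have := sum_diff_quot k x; rewrite SE.
rewrite (_ : \sum_(l < k.+1) (\sum_(i < n) tnth x i ^+ (k - l)) *
    (\sum_(i < n) tnth x i ^+ l) = n%:R ^+ 2 *
  (\sum_(i < k.+1) (centered_mean (k - i)%N x * centered_mean i x +
    u (k - i)%N * centered_mean i x + u i * centered_mean (k - i)%N x) +
   \sum_(i < k.+1) u (k - i)%N * u i)); last first.
  rewrite -big_split mulr_sumr; apply: eq_bigr => i _.
  by rewrite !SE /= /centered_mean; ring.
set Sd := \sum_(p | _) _; set Sc := \sum_(i < _) _; set Su := \sum_(i < _) _.
have t0 : 2 != 0 :> R by rewrite pnatr_eq0.
move=> /(canRL (mulKf t0)) SdE.
have -> : centered_mean k.+1 x = power_mean k.+1 x - (A k * u k + gam * Su).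
  by rewrite /centered_mean uS.
rewrite /shift_factor_deriv /centered_mean -/Sd SdE /eps /gam /A /a /b -natr1.
by field; rewrite M0 b0.
Qed.

(** The class of functions in which the integrals below are linear. *)
Let good f := measurable_fun setT f /\ tame D T f.

Let integrable_good f : good f -> Q.-integrable setT (EFin \o f).
Proof. by move=> [mf tf]; exact: (laguerre_integrable_tame n_gt0 beta_gt0 M_gt QE). Qed.

Let goodD f g : good f -> good g -> good (fun x => f x + g x).
Proof. by move=> [mf tf] [mg tg]; split; [exact: measurable_funD|exact: tameD]. Qed.

Let goodM f g : good f -> good g -> good (fun x => f x * g x).
Proof. by move=> [mf tf] [mg tg]; split; [exact: measurable_funM|exact: tameM]. Qed.

Let good_cst c : good (fun=> c).
Proof. by split; [exact: measurable_cst|exact: tame_cst]. Qed.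

Let good_sum I (r : seq I) (F : I -> n.-tuple R -> R) :
  (forall i, good (F i)) -> good (fun x => \sum_(i <- r) F i x).
Proof.
move=> gF; split; first by apply: measurable_sum => i; exact: (gF i).1.
by apply: (tame_sum T1) => i _; exact: (gF i).2.
Qed.

Let good_prod l : good (centered_prod l).
Proof. by split; [exact: measurable_centered_prod|exact: tame_centered_prod]. Qed.

Local Notation E f := (Rintegral Q setT f).

Let meanD f g : good f -> good g -> E (fun x => f x + g x) = E f + E g.
Proof. by move=> gf gg; rewrite RintegralD//; exact: integrable_good. Qed.

Let meanZ c f : good f -> E (fun x => c * f x) = c * E f.
Proof. by move=> gf; rewrite RintegralZl//; exact: integrable_good. Qed.

Let mean_sum I (r : seq I) (F : I -> n.-tuple R -> R) :
  (forall i, good (F i)) ->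
  E (fun x => \sum_(i <- r) F i x) = \sum_(i <- r) E (F i).
Proof.
move=> gF; elim: r => [|i r IH].
  rewrite big_nil; under eq_Rintegral do rewrite big_nil.
  by rewrite Rintegral_cst// mul0r.
rewrite big_cons -IH -meanD//; last exact: good_sum.
by apply: eq_Rintegral => x _; rewrite big_cons.
Qed.

Definition mean_prod l : R := E (centered_prod l).

(** By the invariance identity, the mean of [centered_prod l] at the shifted
    point times [shift_factor] does not depend on s; its derivative at s = 0
    therefore vanishes. *)
Lemma loop_equation k l : mean_prod (k.+1 :: l) = A k * mean_prod (k :: l) +
  gam * \sum_(i < k.+1) (mean_prod ((k - i)%N :: nat_of_ord i :: l) +
    u (k - i)%N * mean_prod (nat_of_ord i :: l) + u i * mean_prod ((k - i)%N :: l)) +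
  eps * \sum_(i < size l) (nth 0%N l i)%:R *
    (mean_prod ((nth 0%N l i + k)%N :: remove_at i l) +
     u (nth 0%N l i + k)%N * mean_prod (remove_at i l)).
Proof.
pose G x := \sum_(i < k.+1) (centered_prod ((k - i)%N :: nat_of_ord i :: l) x +
    u (k - i)%N * centered_prod (nat_of_ord i :: l) x + u i * centered_prod ((k - i)%N :: l) x).
pose H x := \sum_(i < size l) (nth 0%N l i)%:R *
    (centered_prod ((nth 0%N l i + k)%N :: remove_at i l) x +
     u (nth 0%N l i + k)%N * centered_prod (remove_at i l) x).
have gZ c m : good (fun x => c * centered_prod m x) by apply: goodM.
have gG : good G by apply: good_sum => i; do ?apply: goodD.
have gH : good H by apply: good_sum => i; apply: goodM => //; apply: goodD.
have gR : good (shift_factor_deriv k).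
  split; last by have [] := germ_shift_factor k.
  have mp := measurable_power_mean.
  apply: measurable_funD; last first.
    by apply: measurable_funB; apply: measurable_funM => //; exact: measurable_funM.
  apply: measurable_funM => //; under eq_fun do rewrite big_mkcond.
  apply: measurable_sum => p; case: (p.1 < p.2)%N; last exact: measurable_cst.
  apply: measurable_sum => j.
  by apply: measurable_funM; apply: measurable_funX; exact: measurable_tnth_tuple.
have gS : good (shift_deriv k l).
  by split; [exact: measurable_shift_deriv|have [] := germ_centered_prod k l].
have gm := germM T1 (germ_shift_factor k) (germ_centered_prod k l).
have E0 : E (fun x => shift_factor_deriv k x * centered_prod l x + 1 * shift_deriv k l x) = 0.
  apply: (laguerre_germ_mean n_gt0 beta_gt0 M_gt QE _ _ _ gm).
  - move=> s s0; apply: measurable_funM; first exact: measurable_shift_factor.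
    apply: (measurableT_comp (measurable_centered_prod l)).
    by apply: measurable_map_tuple; exact: measurable_pshift.
  - by apply: measurable_funM => //; exact: measurable_centered_prod.
  - by apply: measurable_funD; apply: measurable_funM => //; [exact: gR.1|exact: measurable_centered_prod|exact: gS.1].
  - move=> s s0; under eq_integral do rewrite mulrC.
    rewrite -(laguerre_invariance QE)//; [|exact: ltW|exact: measurable_centered_prod].
    by apply: eq_integral => x _; rewrite mul1r.
have : E (fun x => eps * (shift_factor_deriv k x * centered_prod l x + 1 * shift_deriv k l x)) = 0.
  by rewrite meanZ ?E0 ?mulr0//; apply: goodD; apply: goodM.
have -> : E (fun x => eps * (shift_factor_deriv k x * centered_prod l x + 1 * shift_deriv k l x)) =
    E (fun x => ((- 1) * centered_prod (k.+1 :: l) x + A k * centered_prod (k :: l) x) +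
      (gam * G x + eps * H x)).
  apply: eq_Rintegral => x _; rewrite mul1r mulrDr mulrA shift_factor_derivE shift_derivE.
  set S1 := \sum_(i < k.+1) _; set S2 := \sum_(i < size l) _.
  have -> : G x = S1 * centered_prod l x.
    rewrite mulr_suml; apply: eq_bigr => i _; rewrite !centered_prod_cons; ring.
  have -> : H x = S2.
    apply: eq_bigr => i _; rewrite -mulrA centered_prod_cons -mulrDl.
    by rewrite /centered_mean subrK.
  by rewrite !centered_prod_cons; ring.
rewrite !meanD ?meanZ//; do ?[apply: goodD|apply: goodM] => //.
rewrite mulN1r -addrA => /eqP; rewrite addrC subr_eq0 => /eqP E1.
rewrite [LHS](esym E1) -[RHS]addrA; congr (_ + (_ * _ + _ * _)).
- rewrite mean_sum => [|i]; last by do ?apply: goodD.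
  by apply: eq_bigr => i _; rewrite !meanD ?meanZ//; apply: goodD.
- rewrite mean_sum => [|i]; last by apply: goodM => //; apply: goodD.
  by apply: eq_bigr => i _; rewrite meanZ ?meanD ?meanZ//; apply: goodD.
Qed.

End loop_equation.

(** * Decay of the correlators *)

Section moment_bound.
Context {R : realType}.
Implicit Types (l : seq nat) (K C : R).

Lemma size_remove_at i l : (i < size l)%N -> (size (remove_at i l)).+1 = size l.
Proof. by move=> il; rewrite size_cat size_takel ?size_drop; lia. Qed.

Lemma sumn_remove_at i l : (i < size l)%N ->
  (sumn (remove_at i l) + nth 0 l i = sumn l)%N.
Proof.
move=> il; rewrite -[in RHS](cat_take_drop i l) (drop_nth 0%N)// !sumn_cat/=.
lia.
Qed.

Lemma sum_nth_sumn l : \sum_(i < size l) (nth 0%N l i)%:R = (sumn l)%:R :> R.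
Proof.
by rewrite -natr_sum sumnE (big_nth 0%N) big_mkord.
Qed.

(** The loop equations, abstracted from the ensemble: [e l] stands for the
    mean of the product of the centered means of orders l. *)
Record loop_system (e : seq nat -> R) (A : nat -> R) (gam eps : R) (u : nat -> R) := {
  loop_nil : e [::] = 1;
  loop_zero : forall l, e (0%N :: l) = 0;
  loop_step : forall k l, e (k.+1 :: l) = A k * e (k :: l) +
    gam * \sum_(i < k.+1) (e ((k - i)%N :: nat_of_ord i :: l) +
      u (k - i)%N * e (nat_of_ord i :: l) + u i * e ((k - i)%N :: l)) +
    eps * \sum_(i < size l) (nth 0%N l i)%:R *
      (e ((nth 0%N l i + k)%N :: remove_at i l) +
       u (nth 0%N l i + k)%N * e (remove_at i l)) }.

(** Induction on the total order. All words on the right of [loop_step] have a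
    smaller total order than the word on the left, and those that have lost
    one or two letters come with a factor eps; this is why each pair of
    letters gains one power of eps. *)
Lemma loop_bound K (m : nat) : 1 <= K -> exists2 C, 1 <= C &
  forall e A gam eps u, loop_system e A gam eps u ->
    0 <= eps <= 1 -> `|gam| <= K ->
    (forall k, (k <= m)%N -> `|A k| <= K) -> (forall k, (k <= m)%N -> `|u k| <= K) ->
    forall l, (sumn l <= m)%N -> `|e l| <= C * eps ^+ uphalf (size l).
Proof.
move=> K1; have K0 : 0 <= K by rewrite (le_trans _ K1).
elim: m => [|m [C C1 IH]].
  exists 1 => // e A gam eps u le /andP[e0 e1] _ _ _ [|[|k] l]//.
  - by rewrite (loop_nil le) normr1 expr0 mulr1.
  - by move=> _; rewrite (loop_zero le) normr0 mul1r exprn_ge0.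
have C0 : 0 <= C by rewrite (le_trans _ C1).
(* One summand for each group of terms on the right of [loop_step]. *)
pose C' := C * (1 + K + K * (m.+1%:R * (1 + K + K)) + m.+1%:R * (1 + K)).
have C'C : C <= C'.
  have K2 : 0 <= 1 + K + K by rewrite !addr_ge0.
  by rewrite ler_peMr// -!addrA lerDl !addr_ge0// !mulr_ge0// !addr_ge0.
exists C'; first exact: le_trans C'C.
move=> e A gam eps u le /[dup] e01 /andP[e0 e1] gK AK uK.
have {}IH l : (sumn l <= m)%N -> `|e l| <= C * eps ^+ uphalf (size l).
  by apply: (IH _ _ _ _ _ le) => // k km; [apply: AK|apply: uK]; exact: leqW.
have C'0 : 0 <= C' by exact: le_trans C'C.
case=> [|[|k] l] /= ml.
- by rewrite (loop_nil le) normr1 expr0 mulr1 (le_trans C1).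
- by rewrite (loop_zero le) normr0 mulr_ge0// exprn_ge0.
have {}ml : (k + sumn l <= m)%N by rewrite addSn in ml.
rewrite -[(half (size l)).+1]/(uphalf (size l).+1).
set r := (size l).+1; set E := eps ^+ uphalf r.
have E0 : 0 <= E by rewrite exprn_ge0.
have eE j : (uphalf r <= j)%N -> eps ^+ j <= E by move=> rj; rewrite ler_wiXn2l.
have IHE l' : (sumn l' <= m)%N -> (uphalf r <= uphalf (size l'))%N -> `|e l'| <= C * E.
  by move=> l'm rl'; apply: (le_trans (IH _ l'm)); rewrite ler_wpM2l// eE.
have CE0 : 0 <= C * E by rewrite mulr_ge0.
have uKm j : (j <= k + sumn l)%N -> `|u j| <= K.
  by move=> jk; apply: uK; rewrite (leq_trans jk)// (leq_trans ml).
have K2 : 0 <= 1 + K + K by rewrite !addr_ge0.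
have K3 : 0 <= 1 + K by rewrite addr_ge0.
rewrite (loop_step le).
have h1 : `|A k * e (k :: l)| <= K * (C * E).
  rewrite normrM ler_pM ?IHE//; apply: AK.
  by rewrite leqW// (leq_trans _ ml)// leq_addr.
have h2 : `|gam * \sum_(i < k.+1) (e ((k - i)%N :: nat_of_ord i :: l) +
      u (k - i)%N * e (nat_of_ord i :: l) + u i * e ((k - i)%N :: l))| <=
    K * (m.+1%:R * (1 + K + K) * (C * E)).
  rewrite normrM ler_pM//; apply: (le_trans (ler_norm_sum _ _ _)).
  apply: (@le_trans _ _ (\sum_(i < k.+1) (1 + K + K) * (C * E))); last first.
    rewrite sumr_const card_ord -[leLHS]mulr_natl mulrA ler_wpM2r//.
    by rewrite ler_wpM2r// ler_nat ltnS (leq_trans _ ml)// leq_addr.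
  apply: ler_sum => i _; rewrite 2!mulrDl mul1r.
  have ik : (i <= k)%N by rewrite -ltnS.
  have s1 : (k - i + (i + sumn l) <= m)%N by rewrite addnA subnK.
  have s2 : (i + sumn l <= m)%N by rewrite (leq_trans _ ml)// leq_add2r.
  have s3 : (k - i + sumn l <= m)%N by rewrite (leq_trans _ ml)// leq_add2r leq_subr.
  have u2 : `|u (k - i)%N| <= K by rewrite uKm// (leq_trans (leq_subr _ _))// leq_addr.
  have u3 : `|u i| <= K by rewrite uKm// (leq_trans ik)// leq_addr.
  apply: (le_trans (ler_normD _ _)); apply: lerD.
    apply: (le_trans (ler_normD _ _)); apply: lerD.
    + by apply: IHE; [exact: s1|apply: uphalf_leq; exact: leqnSn].
    + by rewrite normrM ler_pM// IHE.
  by rewrite normrM ler_pM// IHE.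
have h3 : `|eps * \sum_(i < size l) (nth 0%N l i)%:R *
      (e ((nth 0%N l i + k)%N :: remove_at i l) +
       u (nth 0%N l i + k)%N * e (remove_at i l))| <= m.+1%:R * (1 + K) * (C * E).
  rewrite mulr_sumr; apply: (le_trans (ler_norm_sum _ _ _)).
  apply: (@le_trans _ _ (\sum_(i < size l) (nth 0%N l i)%:R * ((1 + K) * (C * E)))).
    apply: ler_sum => i _; have il := ltn_ord i.
    have sz := size_remove_at il; have sm := sumn_remove_at il.
    rewrite mulrCA normrM ger0_norm ?ler0n// ler_wpM2l ?ler0n//.
    have epsM j x : `|x| <= C * eps ^+ j -> (uphalf r <= j.+1)%N -> `|eps * x| <= C * E.
      move=> xj rj; rewrite normrM ger0_norm//.
      apply: (@le_trans _ _ (eps * (C * eps ^+ j))); first by rewrite ler_wpM2l.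
      by rewrite mulrCA -exprS ler_wpM2l// eE.
    have s1 : (nth 0 l i + k + sumn (remove_at i l) <= m)%N.
      by rewrite addnAC [(nth 0 l i + sumn _)%N]addnC sm addnC.
    have s2 : (sumn (remove_at i l) <= m)%N by rewrite (leq_trans _ s1)// leq_addl.
    have u1 : `|u (nth 0%N l i + k)%N| <= K.
      by rewrite uKm// addnC leq_add2l -sm leq_addl.
    rewrite mulrDr [(1 + K) * _]mulrDl mul1r; apply: (le_trans (ler_normD _ _)).
    apply: lerD.
      apply: (epsM _ _ (IH ((nth 0%N l i + k)%N :: remove_at i l) s1)).
      by rewrite [size _]/= sz /r /= ltnS uphalf_half leq_addl.
    rewrite mulrCA normrM ler_pM//.
    have rE : r = (size (remove_at i l)).+2 by rewrite sz.
    by apply: (epsM _ _ (IH _ s2)); rewrite rE.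
  rewrite -mulr_suml sum_nth_sumn mulrA ler_wpM2r// ler_wpM2r// ler_nat leqW//.
  by rewrite (leq_trans _ ml)// leq_addl.
have -> : C' * E = C * E + K * (C * E) + K * (m.+1%:R * (1 + K + K) * (C * E)) +
  m.+1%:R * (1 + K) * (C * E) by rewrite /C'; ring.
do 2 (apply: (le_trans (ler_normD _ _)); apply: lerD => //).
by apply: (le_trans h1); rewrite lerDr.
Qed.

End moment_bound.

(** * Borel-Cantelli by moments, and quadratic recursions *)

Section almost_sure.
Local Open Scope ereal_scope.
Context d (T : measurableType d) (R : realType).
Variable mu : {measure set T -> \bar R}.

Lemma sum_inv_sqr_le (m : nat) : (\sum_(0 <= i < m) (i.+1%:R ^- 2) <= 2 - 2 / m.+1%:R :> R)%R.
Proof.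
elim: m => [|m IH]; first by rewrite big_nil divr1 subrr.
rewrite big_nat_recr//=; apply: (le_trans (lerD IH (lexx _))).
rewrite -subr_ge0; set x := m.+1%:R : R.
have x0 : (0 < x)%R by rewrite ltr0n.
rewrite -[m.+2%:R]natr1 -/x.
rewrite [X in (0 <= X)%R](_ : _ = (x - 1) / (x ^+ 2 * (x + 1)))%R.
  by rewrite divr_ge0 ?mulr_ge0 ?sqr_ge0 ?subr_ge0 ?ler1n// addr_ge0// ltW.
by field; rewrite !gt_eqF// addr_gt0.
Qed.

(** The sum of the series of the f n has a finite integral, hence is finite
    almost everywhere. *)
Lemma ae_cvg0_of_integral_le (f : nat -> T -> R) (C : R) :
  (forall n, measurable_fun setT (f n)) -> (forall n x, (0 <= f n x)%R) ->
  (0 <= C)%R ->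
  (forall n, \int[mu]_x (f n x)%:E <= (C * n.+1%:R ^- 2)%:E) ->
  {ae mu, forall w, f n w @[n --> \oo] --> (0 : R)%R}.
Proof.
move=> mf f0 C0 fC.
pose G w := \sum_(n <oo) (f n w)%:E.
have mG : measurable_fun setT G.
  apply: ge0_emeasurable_sum => [n x _ _|n _]; first by rewrite lee_fin.
  exact/measurable_EFinP.
have G0 w : 0 <= G w by apply: nneseries_ge0 => n _ _; rewrite lee_fin.
have iG : mu.-integrable setT G.
  apply/integrableP; split=> //.
  under eq_integral do rewrite gee0_abs//.
  apply: (@le_lt_trans _ _ (C * 2)%:E); last by rewrite ltry.
  rewrite integral_nneseries//; last 2 first.
    by move=> n; exact/measurable_EFinP.
    by move=> n x _; rewrite lee_fin.
  apply: lime_le; first by apply: is_cvg_nneseries => n _ _; apply: integral_ge0 => x _; rewrite lee_fin.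
  near=> m.
  apply: (@le_trans _ _ (\sum_(0 <= i < m) (C * i.+1%:R ^- 2)%:E)).
    by apply: lee_sum.
  rewrite sumEFin lee_fin -mulr_sumr ler_wpM2l//.
  by apply: (le_trans (sum_inv_sqr_le m)); rewrite gerBl.
have := integrable_ae measurableT iG.
apply: filterS => w /(_ I) Gw.
apply: (@cvg_series_cvg_0 R R^o); apply: nondecreasing_is_cvgn.
  by apply: nondecreasing_series => n _ _.
exists (fine (G w)) => _ [n _ <-].
rewrite -lee_fin fineK// /series/= -sumEFin.
by apply: nneseries_lim_ge => k _ _; rewrite lee_fin.
Unshelve. all: by end_near. Qed.
End almost_sure.

Section recursive_moments.
Context {R : realType}.
Implicit Types (A : nat -> R) (g : R).

(** All previous values are kept, because each new value is a convolution of
    them. *)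
Fixpoint moment_list A g n : seq R := if n is k.+1 then
  let s := moment_list A g k in
  rcons s (A k * s`_k + g * \sum_(i < k.+1) s`_(k - i) * s`_i) else [:: 1].

Definition rec_moment A g n : R := (moment_list A g n)`_n.

Lemma size_moment_list A g n : size (moment_list A g n) = n.+1.
Proof. by elim: n => //= n IH; rewrite size_rcons IH. Qed.

Lemma nth_moment_list A g n k : (k <= n)%N -> (moment_list A g n)`_k = rec_moment A g k.
Proof.
elim: n => [|n IH]; first by rewrite leqn0 => /eqP ->.
rewrite leq_eqVlt => /predU1P[->//|kn].
by rewrite /= nth_rcons size_moment_list kn IH.
Qed.

Lemma rec_moment0 A g : rec_moment A g 0 = 1.
Proof. by []. Qed.

Lemma rec_momentS A g k : rec_moment A g k.+1 = A k * rec_moment A g k +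
  g * \sum_(i < k.+1) rec_moment A g (k - i) * rec_moment A g i.
Proof.
rewrite [LHS]/rec_moment /= nth_rcons size_moment_list ltnn eqxx nth_moment_list//.
congr (_ + _ * _); apply: eq_bigr => i _.
by rewrite !nth_moment_list// ?leq_subr// -ltnS.
Qed.

Lemma rec_moment_cvg (F : set_system nat) {FF : Filter F} (A_ : nat -> nat -> R) A (g_ : nat -> R) g :
  (forall k, A_ n k @[n --> F] --> A k) -> g_ n @[n --> F] --> g ->
  forall k, rec_moment (A_ n) (g_ n) k @[n --> F] --> rec_moment A g k.
Proof.
move=> Ac gc k; have [m] := ubnP k; elim: m k => // m IH [|k] km.
  by under eq_fun do rewrite rec_moment0; exact: cvg_cst.
under eq_fun do rewrite rec_momentS.
rewrite rec_momentS; apply: cvgD; apply: cvgM => //; first exact: IH.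
apply: cvg_big => [|i _]; first exact: add_continuous.
apply: cvgM; apply: IH.
  by rewrite (leq_ltn_trans (leq_subr _ _)).
by rewrite (leq_trans (ltn_ord i)).
Qed.
End recursive_moments.

(** * Almost sure convergence of the empirical moments *)

Section laguerre_almost_sure.
Context {R : realType}.

Lemma laguerre_loop_system n (beta M : R) (Q : probability (n.-tuple R) R) :
  (0 < n)%N -> 0 < beta -> n%:R - 1 < M ->
  (forall B, measurable B ->
    Q B = (\int[lebesgue_tuple n]_(x in B) (laguerre_pdf beta M x)%:E)%E) ->
  let A k := (M - n%:R) / M + (2 / beta - 1) * k%:R / M in
  let u := rec_moment A (n%:R / M) in
  loop_system (mean_prod Q u) A (n%:R / M) (2 / (beta * M * n%:R)) u.
Proof.
move=> n0 b0 nM QE A u; split.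
- rewrite /mean_prod -[RHS]mul1r -[1 in X in _ = _ * X](@fine1 R).
  rewrite -[X in fine X](probability_setT Q) -Rintegral_cst//.
  by apply: eq_Rintegral => x _; rewrite /centered_prod big_nil.
- move=> l; rewrite /mean_prod -[RHS](mul0r (fine (Q setT))) -Rintegral_cst//.
  apply: eq_Rintegral => x _; rewrite /centered_prod big_cons /centered_mean /power_mean.
  have -> : \sum_(i < n) tnth x i ^+ 0 = n%:R.
    by rewrite (eq_bigr (fun=> 1)) ?sumr_const ?card_ord// => i _; rewrite expr0.
  rewrite /u rec_moment0 mulVf ?subrr ?mul0r//.
  by rewrite pnatr_eq0 -lt0n.
- move=> k l; apply: loop_equation => // j; exact: rec_momentS.
Qed.

Lemma cvg_bound (f : nat -> R) : cvgn f -> exists B, forall n, `|f n| <= B.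
Proof.
move=> /cvg_seq_bounded [B [_ hB]].
by exists (B + 1) => n; apply: hB; rewrite ?ltrDl.
Qed.

Context d (T : measurableType d) (P : probability T R).
Variables (gamma kappa : R) (beta M : nat -> R) (lambda : forall N : nat, {RV P >-> N.-tuple R}).
Hypotheses (hbeta : forall N, (1 <= N)%N -> 0 < beta N)
  (hM : forall N, (1 <= N)%N -> N%:R - 1 < M N)
  (hNM : N%:R / M N @[N --> \oo] --> gamma)
  (hlambda : forall N, (1 <= N)%N -> laguerre_ensemble (beta N) (M N) (lambda N))
  (hkappa : 2 / (beta N * M N) @[N --> \oo] --> kappa).

Let A_ N k : R := (M N - N%:R) / M N + (2 / beta N - 1) * k%:R / M N.
Let g_ N : R := N%:R / M N.
Let u_ N := rec_moment (A_ N) (g_ N).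
Let A k : R := 1 - gamma + k%:R * kappa.

Lemma laguerre_coef_cvg k : A_ N k @[N --> \oo] --> A k.
Proof.
have Minv : (M N)^-1 @[N --> \oo] --> (0 : R).
  have h : g_ N * N%:R^-1 @[N --> \oo] --> gamma * 0.
    apply: cvgM => //; rewrite -(cvg_shiftS (fun n => n%:R^-1 : R)).
    exact: cvg_harmonic.
  rewrite mulr0 in h; apply: cvg_trans h; apply: near_eq_cvg; near=> N.
  by rewrite /g_ mulrAC divff ?mul1r// pnatr_eq0 -lt0n; near: N; exact: nbhs_infty_gt.
have h : 1 - g_ N + k%:R * (2 / (beta N * M N)) - k%:R * (M N)^-1 @[N --> \oo] --> A k - k%:R * 0.
  apply: cvgB; last by apply: cvgM => //; exact: cvg_cst.
  apply: cvgD; last by apply: cvgM => //; exact: cvg_cst.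
  by apply: cvgB => //; exact: cvg_cst.
rewrite mulr0 subr0 in h; apply: cvg_trans h; apply: near_eq_cvg; near=> N.
have N0 : (0 < N)%N by near: N; exact: nbhs_infty_gt.
have M0 : M N != 0 by rewrite gt_eqF// (laguerre_M_gt0 N0 (hM N0)).
have b0 : beta N != 0 by rewrite gt_eqF// hbeta.
by rewrite /A_ /g_; field; rewrite M0 b0.
Unshelve. all: by end_near. Qed.

Lemma laguerre_rec_cvg k : u_ N k @[N --> \oo] --> rec_moment A gamma k.
Proof. by apply: rec_moment_cvg => // j; exact: laguerre_coef_cvg. Qed.

(** A word of four letters has size O(eps^2), and eps is O(1/N). *)
Lemma laguerre_fourth_moment k : exists N0 C, [/\ (0 < N0)%N, 0 <= C &
  forall N, (N0 <= N)%N ->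
    (\int[P]_w ((centered_mean (u_ N) k (lambda N w)) ^+ 4)%:E <=
     (C * N%:R ^- 2)%:E)%E].
Proof.
have Abound j : exists B, forall N, `|A_ N j| <= B.
  by apply: cvg_bound; apply: cvgP; exact: laguerre_coef_cvg.
have ubound j : exists B, forall N, `|u_ N j| <= B.
  by apply: cvg_bound; apply: cvgP; exact: laguerre_rec_cvg.
have [Bg hg] : exists B, forall N, `|g_ N| <= B by apply: cvg_bound; exact: cvgP hNM.
have [Be he] : exists B, forall N, `|2 / (beta N * M N)| <= B.
  by apply: cvg_bound; exact: cvgP hkappa.
have [BA hA] := choice Abound; have [Bu hu] := choice ubound.
pose m := (4 * k)%N.
have BA0 j : 0 <= BA j by apply: le_trans (hA j 0%N).
have Bu0 j : 0 <= Bu j by apply: le_trans (hu j 0%N).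
have Bg0 : 0 <= Bg by apply: le_trans (hg 0%N).
have Be0 : 0 <= Be by apply: le_trans (he 0%N).
pose K := 1 + Bg + \sum_(j < m.+1) (BA j + Bu j).
have S0 : 0 <= \sum_(j < m.+1) (BA j + Bu j) by apply: sumr_ge0 => j _; rewrite addr_ge0.
have K1 : 1 <= K by rewrite /K -addrA lerDl addr_ge0.
have Kj j : (j <= m)%N -> BA j + Bu j <= K.
  move=> jm; rewrite /K (bigD1 (Ordinal (jm : (j < m.+1)%N)))//= addrCA lerDl.
  by rewrite !addr_ge0// sumr_ge0// => i _; rewrite addr_ge0.
have [C C1 bound] := loop_bound m K1.
(* From N0 on, eps is at most 1. *)
pose N0 := (Num.truncn Be).+1.
exists N0, (C * Be ^+ 2); split => //.
  by rewrite mulr_ge0 ?sqr_ge0// (le_trans _ C1).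
move=> N NN0; have N_gt0 : (0 < N)%N by exact: leq_trans NN0.
have NR : 0 < N%:R :> R by rewrite ltr0n.
have M0 := laguerre_M_gt0 N_gt0 (hM N_gt0).
have b0 := hbeta N_gt0.
have QE := hlambda N_gt0.
have le := laguerre_loop_system N_gt0 b0 (hM N_gt0) QE.
set eps := 2 / (beta N * M N * N%:R) in le.
have eps0 : 0 <= eps by rewrite divr_ge0// !mulr_ge0// ltW.
have epsB : eps <= Be * N%:R^-1.
  rewrite /eps invfM mulrA ler_wpM2r ?invr_ge0 ?ler0n//.
  exact: le_trans (ler_norm _) (he N).
have eps1 : 0 <= eps <= 1.
  rewrite eps0 (le_trans epsB)// ler_pdivrMr// mul1r.
  apply: le_trans (_ : N0%:R <= _); last by rewrite ler_nat.
  by have /andP[_ /ltW] := truncn_itv Be0.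
have gK : `|N%:R / M N| <= K by rewrite (le_trans (hg N))// /K addrAC lerDr addr_ge0.
have AK j : (j <= m)%N -> `|A_ N j| <= K.
  by move=> jm; apply: le_trans (Kj j jm); rewrite (le_trans (hA j N))// lerDl.
have uK j : (j <= m)%N -> `|u_ N j| <= K.
  by move=> jm; apply: le_trans (Kj j jm); rewrite (le_trans (hu j N))// lerDr.
have sm : (sumn [:: k; k; k; k] <= m)%N by rewrite /m /= !mulSn mul0n.
have := bound _ _ _ _ _ le eps1 gK AK uK _ sm; rewrite [uphalf _]/=.
pose Q := distribution P (lambda N).
pose p : N.-tuple R -> R := centered_prod (u_ N) [:: k; k; k; k].
have mp : measurable_fun setT p by exact: measurable_centered_prod.
move=> hE.
have -> : (\int[P]_w ((centered_mean (u_ N) k (lambda N w)) ^+ 4)%:E =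
    \int[Q]_x (p x)%:E)%E.
  rewrite ge0_integral_distribution//=.
  - by apply: eq_integral => w _; rewrite /p /centered_prod !big_cons big_nil; congr (_%:E); ring.
  - exact/measurable_EFinP.
  - move=> x; rewrite lee_fin /p /centered_prod !big_cons big_nil mulr1 mulrA -!expr2.
    by rewrite mulr_ge0 ?sqr_ge0.
have ip : Q.-integrable setT (EFin \o p).
  exact: (integrable_centered_prod N_gt0 b0 (hM N_gt0) QE).
rewrite -[leLHS]fineK; last exact: integrable_fin_num.
rewrite lee_fin (le_trans (ler_norm _))// (le_trans hE)//.
rewrite -mulrA ler_wpM2l ?(le_trans _ C1)// -exprVn -exprMn lerXn2r ?nnegrE//.
by rewrite mulr_ge0.
Qed.

(** Fourth moments of order N^-2 are summable, which gives almost sure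
    convergence whatever the joint law of the ensembles is. *)
Lemma laguerre_power_mean_ae :
  {ae P, forall w, forall k,
    power_mean k (lambda N w) @[N --> \oo] --> rec_moment A gamma k}.
Proof.
apply: ae_foralln => k.
have [N0 [C [N0_gt0 C0 hC]]] := laguerre_fourth_moment k.
pose f n w := centered_mean (u_ (n + N0)%N) k (lambda (n + N0)%N w) ^+ 4.
have : {ae P, forall w, f n w @[n --> \oo] --> (0 : R)}.
  apply: (@ae_cvg0_of_integral_le _ _ _ _ f C) => //.
  - move=> n; apply: measurable_funX; apply: measurable_funB => //.
    by apply: measurableT_comp; [exact: measurable_power_mean|].
  - by move=> n w; rewrite /f (exprM _ 2 2) sqr_ge0.
  - move=> n; apply: (le_trans (hC _ (leq_addl _ _))).
    rewrite lee_fin ler_wpM2l// lef_pV2 ?posrE ?exprn_gt0 ?ltr0n ?addn_gt0 ?N0_gt0 ?orbT//.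
    by rewrite lerXn2r ?nnegrE ?ler0n// ler_nat -addn1 leq_add2l.
apply: filterS => w fw.
rewrite -(cvg_shiftn N0).
have -> : rec_moment A gamma k = 0 + rec_moment A gamma k by rewrite add0r.
rewrite (_ : (fun n => power_mean k (lambda (n + N0)%N w)) = fun n =>
  centered_mean (u_ (n + N0)%N) k (lambda (n + N0)%N w) + u_ (n + N0)%N k); last first.
  by apply/funext => n; rewrite /centered_mean subrK.
apply: cvgD; last by rewrite (cvg_shiftn N0 (fun n => u_ n k)); exact: laguerre_rec_cvg.
apply/cvgr0Pnorm_lt => e e0; move/cvgr0Pnorm_lt : fw => /(_ (e ^+ 4)).
rewrite exprn_gt0// => /(_ isT); apply: filterS => n.
by rewrite /f normrX ltr_pXn2r ?nnegrE// ltW.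
Qed.

End laguerre_almost_sure.

(** * Jacobi moments and Riccati equations for power series *)

Section power_series.
Context {R : realType}.

(** Formal power series, as sequences of coefficients. *)
Definition fps : Type := nat -> R.
HB.instance Definition _ := GRing.Zmodule.copy fps (nat -> R).

Implicit Types (f g h : fps).

Definition fps_trunc m f : {poly R} := \poly_(i < m.+1) f i.
Definition fps_mul f g : fps := fun n => \sum_(i < n.+1) f i * g (n - i)%N.
Definition fps_const (c : R) : fps := fun n => if n is 0%N then c else 0.

Lemma coef_fps_trunc m f i : (i <= m)%N -> (fps_trunc m f)`_i = f i.
Proof. by move=> im; rewrite coef_poly ltnS im. Qed.

(** Truncation to polynomials transfers the ring axioms and the product rule.
    *)
Lemma fps_mulE m f g n : (n <= m)%N ->
  fps_mul f g n = (fps_trunc m f * fps_trunc m g)`_n.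
Proof.
move=> nm; rewrite coefM; apply: eq_bigr => i _.
have im : (i <= m)%N by rewrite (leq_trans _ nm)// -ltnS.
by rewrite !coef_fps_trunc// (leq_trans (leq_subr _ _)).
Qed.

Lemma fps_mulC : commutative fps_mul.
Proof. by move=> f g; apply/funext => n; rewrite !(@fps_mulE n)// mulrC. Qed.

Lemma fps_mulA : associative fps_mul.
Proof.
move=> f g h; apply/funext => n.
transitivity ((fps_trunc n f * (fps_trunc n g * fps_trunc n h))`_n).
  rewrite [LHS]/fps_mul coefM; apply: eq_bigr => i _.
  by rewrite coef_fps_trunc -1?ltnS// (@fps_mulE n)// leq_subr.
rewrite mulrA [RHS]/fps_mul coefM; apply: eq_bigr => i _.
by rewrite coef_fps_trunc ?leq_subr// (@fps_mulE n)// -ltnS.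
Qed.

Lemma fps_mul1 : left_id (fps_const 1) fps_mul.
Proof.
move=> f; apply/funext => n; rewrite /fps_mul big_ord_recl/= mul1r subn0.
by rewrite big1 ?addr0// => i _; rewrite mul0r.
Qed.

Lemma fps_mulDl : left_distributive fps_mul +%R.
Proof.
move=> f g h; apply/funext => n.
rewrite -[RHS]/(fps_mul f h n + fps_mul g h n) /fps_mul -big_split/=.
by apply: eq_bigr => i _; rewrite -mulrDl.
Qed.

Lemma fps_oner_neq0 : fps_const 1 != 0.
Proof. by apply/eqP => /(congr1 (@^~ 0%N))/eqP; rewrite oner_eq0. Qed.

HB.instance Definition _ := GRing.Zmodule_isComNzRing.Build fps
  fps_mulA fps_mulC fps_mul1 fps_mulDl fps_oner_neq0.

Definition fps_X : fps := fun n => (n == 1%N)%:R.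
Definition fps_deriv f : fps := fun n => n.+1%:R * f n.+1.

Local Notation "''X" := fps_X.
Local Notation "c %:S" := (fps_const c) (at level 2).

Lemma fps_coefD f g n : (f + g) n = f n + g n.
Proof. by []. Qed.

Lemma fps_coefN f n : (- f) n = - f n.
Proof. by []. Qed.

Lemma fps_coefM f g n : (f * g) n = \sum_(i < n.+1) f i * g (n - i)%N.
Proof. by []. Qed.

Lemma fps_coefC c f n : (c%:S * f) n = c * f n.
Proof.
rewrite fps_coefM big_ord_recl/= subn0 big1 ?addr0// => i _.
by rewrite mul0r.
Qed.

Lemma fps_coef1 n : (1 : fps) n = (n == 0%N)%:R.
Proof. by case: n. Qed.

Lemma fps_coefX0 f : (''X * f) 0%N = 0.
Proof. by rewrite fps_coefM big_ord1 mul0r. Qed.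

Lemma fps_coefXS f n : (''X * f) n.+1 = f n.
Proof.
rewrite fps_coefM !big_ord_recl/= mul0r add0r mul1r subn1/=.
by rewrite big1 ?addr0// => i _; rewrite mul0r.
Qed.

Lemma fps_derivM f g : fps_deriv (f * g) = fps_deriv f * g + f * fps_deriv g.
Proof.
have truncD m h : (fps_trunc m.+1 h)^`() = fps_trunc m (fps_deriv h).
  apply/polyP => i; rewrite coef_deriv !coef_poly ltnS.
  by case: ifP => _; rewrite ?mul0rn// /fps_deriv mulr_natl.
apply/funext => n; rewrite /fps_deriv fps_coefD.
rewrite -[(f * g) n.+1]/(fps_mul f g n.+1) (@fps_mulE n.+1)// mulr_natl -coef_deriv derivM coefD.
rewrite !truncD; congr (_ + _).
  rewrite -[RHS]/(fps_mul (fps_deriv f) g n) coefM; apply: eq_bigr => i _.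
  have im : (i <= n)%N by rewrite -ltnS.
  by rewrite !coef_fps_trunc ?leq_subr// leqW// leq_subr.
rewrite -[RHS]/(fps_mul f (fps_deriv g) n) coefM; apply: eq_bigr => i _.
have im : (i <= n)%N by rewrite -ltnS.
by rewrite !coef_fps_trunc ?leq_subr// leqW.
Qed.

(** As f has constant term 1, the equation expresses each coefficient of g
    through the preceding ones, linearly and without a constant term. *)
Lemma fps_linear_ode (e : R) f g : f 0%N = 1 ->
  e%:S * (''X * (''X * fps_deriv g)) = f * g -> g = 0.
Proof.
move=> f0 E; apply/funext => n; have [m] := ubnP n; elim: m n => // m IH n nm.
have := congr1 (@^~ n) E; rewrite /= fps_coefC (fps_coefM f g) big_ord_recl/= f0 mul1r subn0.
rewrite big1 => [|i _]; last first.
  rewrite IH ?mulr0// (leq_trans _ (nm : (n <= m)%N))// /bump leq0n add1n.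
  by rewrite ltn_subrL (leq_ltn_trans _ (ltn_ord i)).
rewrite addr0 => <-; case: n nm => [|[|n]] nm.
- by rewrite fps_coefX0 mulr0.
- by rewrite fps_coefXS fps_coefX0 mulr0.
- by rewrite !fps_coefXS /fps_deriv IH ?mulr0.
Qed.
End power_series.
Arguments fps R : clear implicits.

Section continued_fraction.
Context {R : realType}.
Local Notation "''X" := (@fps_X R).
Local Notation "c %:S" := (fps_const c) (at level 2).
Implicit Types a c e : R.

Lemma fps_constD a c : (a + c)%:S = a%:S + c%:S :> fps R.
Proof. by apply/funext => -[|n]; rewrite fps_coefD//= addr0. Qed.

Lemma fps_constN a : (- a)%:S = - a%:S :> fps R.
Proof. by apply/funext => -[|n]; rewrite fps_coefN//= oppr0. Qed.

Lemma fps_deriv_const a : fps_deriv a%:S = 0 :> fps R.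
Proof. by apply/funext => n; rewrite /fps_deriv mulr0. Qed.

Lemma fps_derivD (f g : fps R) : fps_deriv (f + g) = fps_deriv f + fps_deriv g.
Proof. by apply/funext => n; rewrite fps_coefD /fps_deriv fps_coefD mulrDr. Qed.

Lemma fps_derivN (f : fps R) : fps_deriv (- f) = - fps_deriv f.
Proof. by apply/funext => n; rewrite fps_coefN /fps_deriv fps_coefN mulrN. Qed.

Lemma fps_derivX : fps_deriv ''X = 1.
Proof.
apply/funext => n; rewrite /fps_deriv /fps_X fps_coef1.
by case: n => [|n]; rewrite ?mulr1// eqSS mulr0.
Qed.

(** The generating series of the recursive moments; the coefficients are
    parametrized so that one step of the continued fraction maps (a, c) to (c
    + e, a). *)
Definition jacobi_series a c e : fps R := rec_moment (fun k => a - c + k%:R * e) c.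

Lemma jacobi_series_riccati a c e (F := jacobi_series a c e) :
  F = 1 + ''X * ((a - c)%:S * F + e%:S * (''X * fps_deriv F) + c%:S * (F * F)).
Proof.
apply/funext => -[|k]; rewrite fps_coefD fps_coef1.
  by rewrite fps_coefX0 addr0.
rewrite fps_coefXS add0r !fps_coefD !fps_coefC (fps_coefM F F) /F {1}/jacobi_series rec_momentS.
congr (_ + _ * _); last by apply: eq_bigr => i _; rewrite mulrC.
rewrite mulrDl; congr (_ + _); case: k => [|k]; first by rewrite fps_coefX0 !mul0r mulr0.
by rewrite fps_coefXS /fps_deriv mulrAC mulrC.
Qed.

(** With F and T the series for (a, c) and (c + e, a), the two Riccati
    equations show that F (1 - a X T) - 1 solves a linear homogeneous equation
    to which [fps_linear_ode] applies. *)
Lemma jacobi_series_fraction a c e :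
  jacobi_series a c e * (1 - a%:S * (''X * jacobi_series (c + e) a e)) = 1.
Proof.
set F := jacobi_series a c e; set T := jacobi_series _ _ _.
have RF := jacobi_series_riccati a c e; rewrite -/F in RF.
have RT := jacobi_series_riccati (c + e) a e; rewrite -/T in RT.
set D := 1 - _.
apply/eqP; rewrite -subr_eq0; apply/eqP.
apply: (@fps_linear_ode _ e (D - c%:S * (''X * F))).
  rewrite /D !fps_coefD !fps_coefN !fps_coefC !fps_coefX0 fps_coef1.
  by rewrite !mulr0 !subr0.
have -> : fps_deriv (F * D - 1) = fps_deriv F * D - F * (a%:S * (T + ''X * fps_deriv T)).
  rewrite fps_derivD fps_derivN -[1 in X in _ - X]/(1%:S) fps_deriv_const subr0.
  rewrite fps_derivM /D fps_derivD fps_derivN -[1 in X in _ * (X - _)]/(1%:S).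
  by rewrite !fps_derivM !fps_deriv_const fps_derivX; ring.
rewrite !fps_constD !fps_constN in RF RT.
have RF' : ''X * (e%:S * (''X * fps_deriv F)) =
    F - 1 - ''X * ((a%:S - c%:S) * F + c%:S * (F * F)) by rewrite [F in F - 1]RF; ring.
have RT' : ''X * (e%:S * (''X * fps_deriv T)) =
    T - 1 - ''X * ((c%:S + e%:S - a%:S) * T + a%:S * (T * T)) by rewrite [T in T - 1]RT; ring.
transitivity (D * (''X * (e%:S * (''X * fps_deriv F))) -
  F * a%:S * ''X * (''X * e%:S * T + ''X * (e%:S * (''X * fps_deriv T)))); first by ring.
by rewrite RF' RT' /D; ring.
Qed.

Lemma jacobi_series_up a c e : jacobi_series a c e =
  1 + a%:S * (''X * (jacobi_series (c + e) a e * jacobi_series a c e)).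
Proof. by rewrite -{1}(jacobi_series_fraction a c e); ring. Qed.

End continued_fraction.

Section jacobi_matrix.
Context {R : realType}.
Variables (a c e : R).
Hypotheses (a_ge0 : 0 <= a) (c_ge0 : 0 <= c) (e_ge0 : 0 <= e).
Local Notation "''X" := (@fps_X R).
Local Notation "x %:S" := (fps_const x) (at level 2).

Let al n := a + n%:R * e.
Let ka n := c + n%:R * e.
Let V n := jacobi_series (al n) (ka n) e.
Let U n := jacobi_series (ka n.+1) (al n) e.

Let VE n : V n = 1 + (al n)%:S * (''X * (U n * V n)).
Proof.
rewrite [LHS]jacobi_series_up /U (_ : ka n.+1 = ka n + e)//.
by rewrite /ka -natr1; ring.
Qed.

Let UE n : U n = 1 + (ka n.+1)%:S * (''X * (V n.+1 * U n)).
Proof.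
rewrite [LHS]jacobi_series_up /V (_ : al n.+1 = al n + e)//.
by rewrite /al -natr1; ring.
Qed.

(** Solution of the recursion for the generating series of the entries (n, 0)
    of the powers of the Jacobi matrix, without the products of square roots
    of off-diagonal entries. *)
Fixpoint jacobi_column n : fps R := if n is m.+1 then
  ''X * (U m * (V m.+1 * jacobi_column m)) else V 0%N.

Lemma fps_constM x y : (x * y)%:S = x%:S * y%:S :> fps R.
Proof. by apply/funext => -[|n]; rewrite fps_coefC//= mulr0. Qed.

Lemma jacobi_column0E : jacobi_column 0 =
  1 + ''X * ((al 0)%:S * jacobi_column 0 + (al 0 * ka 1)%:S * jacobi_column 1).
Proof.
rewrite /= fps_constM; set v := V 0; set v1 := V 1; set u := U 0.
have Ev : v = 1 + (al 0)%:S * (''X * (u * v)) := VE 0.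
have Eu : u = 1 + (ka 1)%:S * (''X * (v1 * u)) := UE 0.
by rewrite [LHS]Ev [u in LHS]Eu; ring.
Qed.

Lemma jacobi_columnSE n : jacobi_column n.+1 =
  ''X * (jacobi_column n + (al n.+1 + ka n.+1)%:S * jacobi_column n.+1 +
    (al n.+1 * ka n.+2)%:S * jacobi_column n.+2).
Proof.
rewrite /= fps_constM fps_constD; set p := jacobi_column n.
set v1 := V n.+1; set v2 := V n.+2; set u0 := U n; set u1 := U n.+1.
have Ev : v1 = 1 + (al n.+1)%:S * (''X * (u1 * v1)) := VE n.+1.
have Eu1 : u1 = 1 + (ka n.+2)%:S * (''X * (v2 * u1)) := UE n.+1.
have Eu0 : u0 = 1 + (ka n.+1)%:S * (''X * (v1 * u0)) := UE n.
transitivity (''X * p * (1 + (ka n.+1)%:S * (''X * (v1 * u0)) +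
  u0 * ((al n.+1)%:S * (''X * ((1 + (ka n.+2)%:S * (''X * (v2 * u1))) * v1))))); last by ring.
by rewrite -Eu1 -Eu0 [v1 in LHS]Ev; ring.
Qed.

(** The number m k n plays the role of the entry (n, 0) of the k-th power of a
    Jacobi matrix, which the recursion in k determines. *)
Lemma jacobi_moment (m : nat -> nat -> R) :
  (forall n, m 0%N n = (n == 0%N)%:R) ->
  (forall k, m k.+1 0%N = al 0 * m k 0%N + Num.sqrt (al 0 * ka 1) * m k 1%N) ->
  (forall k n, m k.+1 n.+1 = Num.sqrt (al n * ka n.+1) * m k n +
    (al n.+1 + ka n.+1) * m k n.+1 + Num.sqrt (al n.+1 * ka n.+2) * m k n.+2) ->
  forall k, m k 0%N = rec_moment (fun k => a - c + k%:R * e) c k.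
Proof.
move=> m0 mS0 mSS.
pose s n := Num.sqrt (al n * ka n.+1).
have al0 n : 0 <= al n by rewrite addr_ge0// mulr_ge0.
have ka0 n : 0 <= ka n by rewrite addr_ge0// mulr_ge0.
have s2 n : s n * s n = al n * ka n.+1 by rewrite -expr2 sqr_sqrtr// mulr_ge0.
suff mE k n : m k n = (\prod_(i < n) s i) * jacobi_column n k.
  move=> k; rewrite mE big_ord0 mul1r /= /V /jacobi_series /al /ka.
  by rewrite !mul0r !addr0.
elim: k n => [|k IH] [|n].
- by rewrite m0 big_ord0 mul1r jacobi_column0E fps_coefD fps_coefX0 addr0.
- by rewrite m0 jacobi_columnSE fps_coefX0 mulr0.
- rewrite mS0 !IH big_ord0 big_ord1 !mul1r [in RHS]jacobi_column0E fps_coefD fps_coefXS.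
  by rewrite fps_coef1 add0r fps_coefD !fps_coefC -/(s 0) mulrA s2.
- rewrite mSS !IH [in RHS]jacobi_columnSE fps_coefXS !fps_coefD !fps_coefC -/(s n) -/(s n.+1).
  rewrite -s2 !big_ord_recr /=; ring.
Qed.

End jacobi_matrix.

(** * Moments of the spectral matrix *)

Section spectral_moments.
Context {R : realType}.
Implicit Types (f : nat -> R).

Lemma fsum_nat_bounded f m : (forall j, (m <= j)%N -> f j = 0) ->
  \sum_(j \in [set: nat]) f j = \sum_(j < m) f j.
Proof.
move=> f0; rewrite fsbig_ord; apply/esym/fsbig_widen => // j [_ /= jm].
by apply: f0; rewrite leqNgt; apply/negP.
Qed.

Variables (gamma c : R).
Hypotheses (gamma_gt0 : 0 < gamma) (c_gt0 : 0 < c).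
Let W := laguerre_W gamma c.
Let J := iscale (gamma / c) (imul W (itr W)).
Let e := gamma / c.
Let al (n : nat) := 1 + n%:R * e.
Let ka (n : nat) := gamma + n%:R * e.

Let e0 : 0 < e. Proof. by rewrite divr_gt0. Qed.

Let alE n : al n = e * (c / gamma + n%:R).
Proof. by rewrite /al /e; field; rewrite !gt_eqF. Qed.

Let kaE n : ka n = e * (c + n%:R).
Proof. by rewrite /ka /e; field; rewrite !gt_eqF. Qed.

Let W_diag n : W n n = Num.sqrt (c / gamma + n%:R).
Proof. by rewrite /W /laguerre_W eqxx. Qed.

Let W_sub n : W n.+1 n = Num.sqrt (c + n.+1%:R).
Proof. by rewrite /W /laguerre_W eqxx gtn_eqF. Qed.

Let W0 i j : (i != j) -> (i != j.+1) -> W i j = 0.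
Proof. by rewrite /W /laguerre_W => /negbTE -> /negbTE ->. Qed.

Let Wup i j : (i < j)%N -> W i j = 0.
Proof. by move=> ij; rewrite W0// ltn_eqF// leqW. Qed.

Let WWE i j : imul W (itr W) i j =
  W i i * W j i + (if i is i'.+1 then W i i' * W j i' else 0).
Proof.
rewrite /imul /itr (@fsum_nat_bounded _ i.+1); last first.
  by move=> k ik; rewrite Wup// mul0r.
rewrite big_ord_recr/= addrC; congr (_ + _); case: i => [|i].
  by rewrite big_ord0.
rewrite big_ord_recr/= big1 ?add0r// => k _.
have ki := ltn_ord k; rewrite W0 ?mul0r//; first by rewrite gtn_eqF// ltnS ltnW.
by rewrite gtn_eqF.
Qed.

Let sqrt_sqr (x : R) : 0 <= x -> Num.sqrt x * Num.sqrt x = x.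
Proof. by move=> x0; rewrite -expr2 sqr_sqrtr. Qed.

Let al_ge0 n : 0 <= c / gamma + n%:R.
Proof. by rewrite addr_ge0// divr_ge0// ltW. Qed.

Let ka_ge0 n : 0 <= c + n%:R.
Proof. by rewrite addr_ge0// ltW. Qed.

Let J00 : J 0%N 0%N = al 0.
Proof. by rewrite /J /iscale WWE addr0 W_diag sqrt_sqr// alE. Qed.

Let J_diag n : J n.+1 n.+1 = al n.+1 + ka n.+1.
Proof.
by rewrite /J /iscale WWE W_diag W_sub !sqrt_sqr// alE kaE -mulrDr.
Qed.

Let sqrt_e n : Num.sqrt (al n * ka n.+1) =
  e * (Num.sqrt (c / gamma + n%:R) * Num.sqrt (c + n.+1%:R)).
Proof.
rewrite alE kaE mulrACA sqrtrM; last by rewrite mulr_ge0 ?(ltW e0).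
by rewrite -expr2 sqrtr_sqr gtr0_norm// sqrtrM ?al_ge0.
Qed.

Let J_up n : J n n.+1 = Num.sqrt (al n * ka n.+1).
Proof.
rewrite sqrt_e /J /iscale WWE W_diag W_sub; congr (_ * _).
case: n => [|n]; first by rewrite addr0.
by rewrite [W n.+2 n]W0 ?mulr0 ?addr0// gtn_eqF.
Qed.

Let J_down n : J n.+1 n = Num.sqrt (al n * ka n.+1).
Proof.
rewrite sqrt_e /J /iscale WWE W_diag W_sub; congr (_ * _).
by rewrite [W n n.+1]Wup// mulr0 add0r mulrC W_diag.
Qed.

Let J_far i j : (i.+1 < j)%N || (j.+1 < i)%N -> J i j = 0.
Proof.
move=> ij; rewrite /J /iscale WWE; apply/eqP; rewrite mulf_eq0; apply/orP; right.
case/orP: ij => ij.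
  rewrite [W j i]W0 ?mulr0 ?add0r; [|by rewrite gtn_eqF// ltnW|by rewrite gtn_eqF].
  case: i ij => // i ij; rewrite [W j i]W0 ?mulr0//; first by rewrite gtn_eqF// 2?ltnW.
  by rewrite gtn_eqF// ltnW.
rewrite [W j i]Wup ?mulr0 ?add0r; last by rewrite ltnW.
case: i ij => // i ij; rewrite [W j i]Wup ?mulr0//.
Qed.

(** The matrix J is tridiagonal, with the entries of [jacobi_moment] for a =
    1, c = gamma and e = gamma / c. *)
Lemma spectral_matrix_moments k :
  iexp J k 0%N 0%N = rec_moment (fun k => 1 - gamma + k%:R * e) gamma k.
Proof.
apply: (@jacobi_moment R 1 gamma e _ _ _ (fun k n => iexp J k n 0%N)); rewrite ?ler01 ?ltW//.
- move=> {}k; rewrite /= {1}/imul (@fsum_nat_bounded _ 2) => [|j j2].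
    by rewrite !big_ord_recr/= big_ord0 add0r J00 J_up.
  by rewrite J_far ?mul0r// j2.
- move=> {}k n; rewrite /= {1}/imul (@fsum_nat_bounded _ n.+3) => [|j jn].
    rewrite !big_ord_recr/= big1 ?add0r => [|j _].
      by rewrite J_down J_diag J_up.
    by rewrite J_far ?mul0r// !ltnS ltn_ord orbT.
  by rewrite J_far ?mul0r// jn.
Qed.

End spectral_moments.

(** * Moments of the Marchenko-Pastur law *)

Section sine_integrals.
Context {R : realType}.
Implicit Types (t : R) (n : nat).
Local Notation mu := (@lebesgue_measure R).

Lemma sin_natpi n : sin (n%:R * pi) = 0 :> R.
Proof.
elim: n => [|n IH]; first by rewrite mul0r sin0.
by rewrite -natr1 mulrDl mul1r sinDpi IH oppr0.
Qed.

Lemma continuous_sin_natmul n : continuous (fun t => sin (n%:R * t)).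
Proof.
move=> t; apply: (@continuous_comp _ _ _ (fun t => n%:R * t) sin).
  by apply: cvgM; [exact: cvg_cst|exact: cvg_id].
exact: continuous_sin.
Qed.

Lemma continuous_cos_natmul n : continuous (fun t => cos (n%:R * t)).
Proof.
move=> t; apply: (@continuous_comp _ _ _ (fun t => n%:R * t) cos).
  by apply: cvgM; [exact: cvg_cst|exact: cvg_id].
exact: continuous_cos.
Qed.

Lemma integrable_0pi (f : R -> R) : continuous f ->
  mu.-integrable `[0, pi] (EFin \o f).
Proof.
move=> cf; apply: continuous_compact_integrable; first exact: segment_compact.
exact: continuous_subspaceT.
Qed.

(** The functions sin (n t), n >= 1, are orthonormal for this mean. *)
Definition sine_mean (f : R -> R) : R := 2 / pi * \int[mu]_(t in `[0, pi]) f t.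

Lemma sine_meanD (f g : R -> R) : continuous f -> continuous g ->
  sine_mean (fun t => f t + g t) = sine_mean f + sine_mean g.
Proof.
move=> cf cg; rewrite /sine_mean RintegralD ?mulrDr//; exact: integrable_0pi.
Qed.

Lemma sine_meanZ c (f : R -> R) : continuous f ->
  sine_mean (fun t => c * f t) = c * sine_mean f.
Proof.
by move=> cf; rewrite /sine_mean RintegralZl// 1?mulrCA//; exact: integrable_0pi.
Qed.

Lemma integral_cos_natmul n :
  \int[mu]_(t in `[0, pi]) cos (n%:R * t) = pi * (n == 0%N)%:R.
Proof.
case: n => [|n].
  under eq_Rintegral do rewrite mul0r cos0.
  have mupi : mu `[0, pi]%classic = pi%:E.
    by rewrite lebesgue_measure_itv/= lte_fin pi_gt0 -EFinB subr0.
  by rewrite Rintegral_cst// mul1r mulr1 [X in fine X]mupi.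
have D (t : R) : is_derive t 1 (fun t => n.+1%:R^-1 * sin (n.+1%:R * t)) (cos (n.+1%:R * t)).
  have h := is_deriveZ (n.+1%:R^-1) (is_derive1_comp (is_derive_sin (n.+1%:R * t))
    (is_deriveZ n.+1%:R (is_derive_id t (1 : R)))).
  by apply: (is_derive_eq h); rewrite /GRing.scale/= mulr1 mulrC mulfK// pnatr_eq0.
have cD : continuous (fun t : R => n.+1%:R^-1 * sin (n.+1%:R * t)).
  by move=> t; apply: cvgM; [exact: cvg_cst|exact: continuous_sin_natmul].
rewrite mulr0 /Rintegral (@continuous_FTC2 _ (fun t => cos (n.+1%:R * t))
  (fun t => n.+1%:R^-1 * sin (n.+1%:R * t))) ?pi_gt0//.
- by rewrite sin_natpi !mulr0 sin0 mulr0 subee.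
- by apply: continuous_subspaceT; exact: continuous_cos_natmul.
- split => [t _||].
  + by have [] := D t.
  + exact/cvg_at_right_filter/cD.
  + exact/cvg_at_left_filter/cD.
- by move=> t _; rewrite derive1E; have [_ ->] := D t.
Qed.

Lemma sine_mean_sin n : sine_mean (fun t => sin t * sin (n.+1%:R * t)) = (n == 0%N)%:R.
Proof.
have E (t : R) : sin t * sin (n.+1%:R * t) = 2^-1 * cos (n%:R * t) + (- 2^-1) * cos (n.+2%:R * t).
  have -> : cos (n%:R * t) = cos (n.+1%:R * t - t) by congr cos; rewrite -natr1; ring.
  have -> : cos (n.+2%:R * t) = cos (n.+1%:R * t + t).
    by congr cos; rewrite -[n.+2%:R]natr1; ring.
  by rewrite cosB cosD; field.
have cc := continuous_cos_natmul.
rewrite (_ : (fun t => _) = fun t => 2^-1 * cos (n%:R * t) + (- 2^-1) * cos (n.+2%:R * t)); last first.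
  by apply/funext => t; exact: E.
rewrite sine_meanD ?sine_meanZ//; last 2 first.
- by move=> t; apply: cvgM; [exact: cvg_cst|exact: cc].
- by move=> t; apply: cvgM; [exact: cvg_cst|exact: cc].
rewrite /sine_mean !integral_cos_natmul [n.+2 == _]/= !mulr0 addr0.
have p0 : pi != 0 :> R by rewrite gt_eqF// pi_gt0.
by rewrite [2 / pi * _]mulrA divfK// mulKf// pnatr_eq0.
Qed.
End sine_integrals.

Section marchenko_pastur_moments.
Context {R : realType}.
Variable gamma : R.
Hypothesis gamma01 : 0 < gamma < 1.
Local Notation mu := (@lebesgue_measure R).
Let s := Num.sqrt gamma.

Let s0 : 0 < s. Proof. by rewrite sqrtr_gt0; case/andP: gamma01. Qed.
Let s1 : s < 1.
Proof. by rewrite -[ltRHS]sqrtr1 ltr_sqrt; case/andP: gamma01. Qed.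
Let s2 : s ^+ 2 = gamma. Proof. by rewrite sqr_sqrtr// ltW; case/andP: gamma01. Qed.

(** The arc-cosine parametrization of the support. *)
Definition mp_param (t : R) : R := 1 + gamma - 2 * s * cos t.

Let lo := mp_lo gamma.
Let hi := mp_hi gamma.

Let lo_gt0 : 0 < lo. Proof. by rewrite exprn_gt0// subr_gt0. Qed.
Let lo_hi : lo < hi.
Proof.
rewrite -subr_gt0 /lo /hi /mp_lo /mp_hi -/s (_ : _ - _ = 4 * s); last by ring.
by rewrite mulr_gt0.
Qed.

Let paramE t : mp_param t = lo + 2 * s * (1 - cos t).
Proof. by rewrite /mp_param -s2 /lo /mp_lo -/s; ring. Qed.

Let param_ge t : lo <= mp_param t.
Proof. by rewrite paramE lerDl !mulr_ge0 ?subr_ge0 ?cos_le1// ltW. Qed.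

Let param_gt0 t : 0 < mp_param t.
Proof. exact: lt_le_trans (param_ge t). Qed.

Let param0 : mp_param 0 = lo.
Proof. by rewrite paramE cos0 subrr mulr0 addr0. Qed.

Let parampi : mp_param pi = hi.
Proof. by rewrite paramE cospi /lo /hi /mp_lo /mp_hi -/s; ring. Qed.

Let cparam : continuous mp_param.
Proof.
move=> t; apply: cvgB; first exact: cvg_cst.
by apply: cvgM; [exact: cvg_cst|exact: continuous_cos].
Qed.

Let dparam (t : R) : is_derive t 1 mp_param (2 * s * sin t).
Proof.
have h := is_deriveB (is_derive_cst (1 + gamma) t 1) (is_deriveZ (2 * s) (is_derive_cos t)).
by apply: (is_derive_eq h); rewrite /GRing.scale/= sub0r mulrN opprK.
Qed.

Let dparamE : derive1 mp_param = fun t => 2 * s * sin t.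
Proof. by apply/funext => t; rewrite derive1E; have [_ ->] := dparam t. Qed.

Let cparamV : continuous (fun t => (mp_param t)^-1).
Proof. by move=> t; apply: cvgV; [rewrite gt_eqF|exact: cparam]. Qed.

Definition mp_closed (x : R) : R :=
  (2 * pi * gamma * x)^-1 * Num.sqrt ((hi - x) * (x - lo)).

Let mp_pdfE x : mp_pdf gamma x = if (lo <= x <= hi) then mp_closed x else 0.
Proof.
rewrite /mp_pdf -/lo -/hi; have [xlo|xlo|<-] := ltgtP lo x => //=.
  by have [xhi|xhi|->] := ltgtP x hi => //; rewrite /mp_closed subrr mul0r sqrtr0 mulr0.
by rewrite (ltW lo_hi) /mp_closed subrr mulr0 sqrtr0 mulr0.
Qed.

(** Under the parametrization the square root in the density becomes 2 s sin
    t, which is also the derivative of the parametrization. *)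
Lemma mp_integral (f : R -> R) : continuous f ->
  (\int[marchenko_pastur gamma]_x (f x)%:E =
   (sine_mean (fun t => f (mp_param t) * ((mp_param t)^-1 * (sin t * sin t))))%:E)%E.
Proof.
move=> cf.
rewrite (@integral_density _ _ _ mu _ (mp_pdf gamma))//; last 3 first.
- exact: measurable_mp_pdf.
- exact: mp_pdf_ge0.
- exact: continuous_measurable_fun.
transitivity (\int[mu]_(x in `[lo, hi]) (f x * mp_closed x)%:E)%E.
  rewrite [RHS]integral_mkcond; apply: eq_integral => x _.
  rewrite mp_pdfE patchE mem_setE in_itv/=; case: ifP => //; by rewrite mulr0.
have cG : {within `[mp_param 0, mp_param pi], continuous (fun x => f x * mp_closed x)}.
  rewrite param0 parampi; apply: continuous_in_subspaceT => x; rewrite inE/= in_itv/= => /andP[xlo _].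
  have x0 : 0 < x by exact: lt_le_trans xlo.
  apply: cvgM; first exact: cf.
  apply: cvgM.
    apply: cvgV; first by rewrite !mulf_neq0// gt_eqF// ?pi_gt0//; case/andP: gamma01.
    by apply: cvgM; [exact: cvg_cst|exact: cvg_id].
  apply: (@continuous_comp _ _ _ (fun x => (hi - x) * (x - lo)) Num.sqrt); last exact: sqrt_continuous.
  by apply: cvgM; apply: cvgB; [exact: cvg_cst|exact: cvg_id|exact: cvg_id|exact: cvg_cst].
have cd : continuous (derive1 mp_param).
  by rewrite dparamE => t; apply: cvgM; [exact: cvg_cst|exact: continuous_sin].
rewrite -param0 -parampi (@integration_by_substitution_increasing _ mp_param)//; first last.
- split => [t _||]; first by have [] := dparam t.
    exact/cvg_at_right_filter/cparam.
  exact/cvg_at_left_filter/cparam.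
- by apply/cvg_ex; exists (derive1 mp_param pi); exact/cvg_at_left_filter/cd.
- by apply/cvg_ex; exists (derive1 mp_param 0); exact/cvg_at_right_filter/cd.
- move=> x y xI yI xy; rewrite !paramE ltrD2l ltr_pM2l ?mulr_gt0//.
  by rewrite ltrD2l ltrN2 ltr_cos.
- exact: pi_ge0.
pose g t := f (mp_param t) * ((mp_param t)^-1 * (sin t * sin t)).
have cg : continuous g.
  move=> t; apply: cvgM.
    by apply: (@continuous_comp _ _ _ mp_param f); [exact: cparam|exact: cf].
  apply: cvgM; first exact: cparamV.
  by apply: cvgM; exact: continuous_sin.
rewrite -/g /sine_mean -RintegralZl//; last exact: integrable_0pi.
rewrite /Rintegral fineK; last first.
  apply: integrable_fin_num => //; apply: integrable_0pi => t.
  by apply: cvgM; [exact: cvg_cst|exact: cg].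
apply: eq_integral => t; rewrite inE/= in_itv/= => tI; congr (_%:E).
have st : 0 <= sin t by rewrite sin_ge0_pi.
have sqE : Num.sqrt ((hi - mp_param t) * (mp_param t - lo)) = 2 * s * sin t.
  rewrite [X in Num.sqrt X](_ : _ = (2 * s * sin t) ^+ 2).
    by rewrite sqrtr_sqr ger0_norm// !mulr_ge0// ltW.
  by rewrite paramE /hi /mp_hi /lo /mp_lo -/s exprMn sin2cos2; ring.
have p0 : pi != 0 :> R by rewrite gt_eqF// pi_gt0.
have g0 : s != 0 by rewrite gt_eqF.
have x0 : mp_param t != 0 by rewrite gt_eqF.
rewrite /= !fctE dparamE /g /mp_closed sqE -s2.
by move: (pi : R) p0 => q q0; field; rewrite x0 q0 g0.
Qed.

Let r := - s.
(** Up to a sign and a factor sin t, the orthogonal polynomials of the law: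
    combinations of Chebyshev polynomials of the second kind. *)
Let fn n t := sin (n.+1%:R * t) + r * sin (n%:R * t).

Let cfn n : continuous (fn n).
Proof.
move=> t; apply: cvgD; first exact: continuous_sin_natmul.
by apply: cvgM; [exact: cvg_cst|exact: continuous_sin_natmul].
Qed.

Let sin_step n (t : R) : 2 * cos t * sin (n.+1%:R * t) = sin (n.+2%:R * t) + sin (n%:R * t).
Proof.
have -> : sin (n%:R * t) = sin (n.+1%:R * t - t) by congr sin; rewrite -natr1; ring.
have -> : sin (n.+2%:R * t) = sin (n.+1%:R * t + t).
  by congr sin; rewrite -[n.+2%:R]natr1; ring.
by rewrite sinB sinD; ring.
Qed.

Let paramE' (t : R) : mp_param t = 1 + gamma + r * (2 * cos t).
Proof. by rewrite /mp_param /r; ring. Qed.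

Let fn_step n (t : R) : mp_param t * fn n.+1 t =
  (1 + gamma) * fn n.+1 t + r * (fn n.+2 t + fn n t).
Proof.
have h1 := sin_step n.+1 t; have h2 := sin_step n t.
rewrite paramE' mulrDl; congr (_ + _); rewrite -mulrA; congr (_ * _).
by rewrite /fn mulrDr h1 mulrCA h2; ring.
Qed.

Let fn_step0 (t : R) : mp_param t * fn 0 t = fn 0 t + r * fn 1 t.
Proof.
have := sin_step 0 t; rewrite mul0r sin0 addr0 mul1r => h.
rewrite paramE' /fn mul0r sin0 mulr0 addr0 mul1r -h -s2 /r; ring.
Qed.

Let fn_up n (t : R) : fn n t + r * fn n.+1 t = mp_param t * sin (n.+1%:R * t).
Proof.
rewrite paramE' mulrDl -mulrA sin_step /fn -s2 /r; ring.
Qed.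

Let c k n := sine_mean (fun t => mp_param t ^+ k * ((mp_param t)^-1 * (sin t * fn n t))).

Let cc k n : continuous (fun t => mp_param t ^+ k * ((mp_param t)^-1 * (sin t * fn n t))).
Proof.
move=> t; apply: cvgM.
  by apply: (@continuous_comp _ _ _ mp_param (fun x => x ^+ k)); [exact: cparam|exact: exprn_continuous].
apply: cvgM; first exact: cparamV.
by apply: cvgM; [exact: continuous_sin|exact: cfn].
Qed.

Let cZ (a : R) (f : R -> R) : continuous f -> continuous (fun t => a * f t).
Proof. by move=> cf t; apply: cvgM; [exact: cvg_cst|exact: cf]. Qed.

Let cD (f g : R -> R) : continuous f -> continuous g -> continuous (fun t => f t + g t).
Proof. by move=> cf cg t; apply: cvgD; [exact: cf|exact: cg]. Qed.

Let c_up n : c 0 n + r * c 0 n.+1 = (n == 0%N)%:R.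
Proof.
rewrite -sine_mean_sin /c -sine_meanZ// -sine_meanD//; last exact: cZ.
congr sine_mean; apply/funext => t; rewrite !expr0 !mul1r.
rewrite -[RHS](mulKf (_ : mp_param t != 0)); last by rewrite gt_eqF.
by rewrite [mp_param t * _]mulrCA -fn_up; ring.
Qed.

(** By [c_up] the values at n >= 1 form a geometric sequence of ratio 1 / s >
    1; being bounded, they vanish. *)
Let c0E n : c 0 n = (n == 0%N)%:R.
Proof.
have [B hB] : exists B, forall n, `|c 0 n| <= B.
  exists (2 / pi * \int[mu]_(t in `[0, pi]) (lo^-1 * 2)) => j.
  have p2 : 0 <= 2 / pi :> R by rewrite divr_ge0// pi_ge0.
  have cabs : continuous (fun t => `|mp_param t ^+ 0 * ((mp_param t)^-1 * (sin t * fn j t))|).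
    by move=> t; apply: cvg_norm; exact: cc.
  rewrite /c /sine_mean normrM ger0_norm// ler_wpM2l//.
  have i0 := integrable_0pi (@cc 0%N j).
  apply: (le_trans (le_normr_Rintegral _ i0)) => //.
  apply: le_Rintegral => //; first exact: integrable_0pi.
    by apply: integrable_0pi => t; exact: cvg_cst.
  move=> t _; rewrite expr0 mul1r normrM ler_pM//.
    by rewrite gtr0_norm ?invr_gt0// lef_pV2 ?posrE.
  rewrite normrM -[leRHS]mul1r ler_pM ?sin_max//.
  apply: (le_trans (ler_normD _ _)); apply: lerD; first exact: sin_max.
  rewrite normrM -[leRHS]mul1r ler_pM ?sin_max// /r normrN gtr0_norm//; exact: ltW.
have h m : c 0 m.+1 = 0.
  have E j : c 0 m.+1 = s ^+ j * c 0 (m + j).+1.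
    elim: j => [|j IH]; first by rewrite expr0 mul1r addn0.
    have := c_up (m + j).+1; rewrite /= => /eqP; rewrite addr_eq0 /r mulNr opprK => /eqP Ej.
    by rewrite IH Ej exprSr addnS mulrA.
  have B0 : 0 <= B by apply: le_trans (hB 0%N).
  have : s ^+ j * B @[j --> \oo] --> 0 * B.
    by apply: cvgM; [apply: cvg_expr; rewrite gtr0_norm|exact: cvg_cst].
  rewrite mul0r => /cvgr0Pnorm_lt lim.
  apply/eqP; rewrite -normr_eq0 eq_le normr_ge0 andbT leNgt; apply/negP => /lim [j _ /(_ _ (leqnn j))].
  apply/negP; rewrite -leNgt (E j) (normrM (s ^+ j)) (normrM (s ^+ j) B) ler_wpM2l//.
  by rewrite (le_trans (hB _))// ler_norm.
case: n => [|n]; last exact: h.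
by have := c_up 0; rewrite h mulr0 addr0.
Qed.

(** The functions [fn] obey the three-term recursion of a Jacobi matrix with
    constant coefficients; this is [jacobi_moment] with e = 0. The sign (-1)^n
    makes the off-diagonal entries positive. *)
Lemma marchenko_pastur_moment k : (\int[marchenko_pastur gamma]_x (x ^+ k)%:E =
  (rec_moment (fun k => 1 - gamma + k%:R * 0) gamma k)%:E)%E.
Proof.
rewrite mp_integral; last exact: exprn_continuous.
have -> : sine_mean (fun t => mp_param t ^+ k * ((mp_param t)^-1 * (sin t * sin t))) = c k 0.
  congr sine_mean; apply/funext => t.
  by rewrite /fn mul0r sin0 mulr0 addr0 mul1r.
have g0 : 0 <= gamma by case/andP: gamma01 => /ltW.
have sq : Num.sqrt (1 * gamma) = s by rewrite mul1r.
have al0 (m : nat) : 1 + m%:R * 0 = 1 :> R by rewrite mulr0 addr0.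
have ka0 (m : nat) : gamma + m%:R * 0 = gamma by rewrite mulr0 addr0.
congr (_%:E); rewrite -[LHS]mul1r.
apply: (@jacobi_moment R 1 gamma 0 ler01 g0 (lexx _) (fun k n => (-1) ^+ n * c k n)).
- by move=> n; rewrite c0E; case: n => [|n]; rewrite ?mulr0 ?mulr1.
- move=> {}k; rewrite /= !al0 !ka0 sq expr0 expr1 !mul1r mulN1r mulrN -mulNr.
  rewrite /c -[- s]/r -sine_meanZ// -sine_meanD//; last exact: cZ.
  congr sine_mean; apply/funext => t; rewrite exprS.
  have := fn_step0 t; move: (fn 0 t) (fn 1 t) => f0 f1 E.
  rewrite (_ : mp_param t * _ * _ = mp_param t ^+ k * ((mp_param t)^-1 * (sin t * (mp_param t * f0)))).
    by rewrite E; ring.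
  by ring.
- move=> {}k n; rewrite /= !al0 !ka0 sq.
  have -> : s * ((-1) ^+ n * c k n) + (1 + gamma) * ((-1) ^+ n.+1 * c k n.+1) +
      s * ((-1) ^+ n.+2 * c k n.+2) =
    (-1) ^+ n.+1 * ((1 + gamma) * c k n.+1 + (r * c k n.+2 + r * c k n)).
    by rewrite /r !exprS; ring.
  congr (_ * _); rewrite /c -!sine_meanZ// -!sine_meanD//; do ?[apply: cD|apply: cZ] => //.
  congr sine_mean; apply/funext => t; rewrite exprS.
  have := fn_step n t; move: (fn n t) (fn n.+1 t) (fn n.+2 t) => f0 f1 f2 E.
  rewrite (_ : mp_param t * _ * _ = mp_param t ^+ k * ((mp_param t)^-1 * (sin t * (mp_param t * f1)))).
    by rewrite E; ring.
  by ring.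
Qed.

Lemma marchenko_pastur_integrable k :
  (marchenko_pastur gamma).-integrable setT (fun x => (x ^+ k)%:E).
Proof.
apply/integrableP; split.
  by apply/measurable_EFinP; exact: exprn_measurable.
under eq_integral => x _ do rewrite abse_EFin.
rewrite (mp_integral (f := fun x => `|x ^+ k|)) ?ltry// => x.
by apply: cvg_norm; exact: exprn_continuous.
Qed.

Lemma marchenko_pastur_setT : marchenko_pastur gamma [set: R] = 1%E.
Proof.
have := marchenko_pastur_moment 0; rewrite rec_moment0.
under eq_integral do rewrite expr0.
by rewrite integral_cst// mul1e.
Qed.

End marchenko_pastur_moments.

(** * Equality of trigonometric integrals *)

Section trig_series.
Context {R : realType}.
Implicit Types (x : R).

Lemma series_exp_coeff_le x n : 0 <= x -> series (exp_coeff x) n <= expR x.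
Proof.
move=> x0; apply: nondecreasing_cvgn_le; last exact: is_cvg_series_exp_coeff.
by apply: nondecreasing_series => k _ _; rewrite divr_ge0// exprn_ge0.
Qed.

Lemma series_cos_coeff_le x n : `|series (cos_coeff x) n| <= expR `|x|.
Proof.
apply: le_trans (series_exp_coeff_le n (normr_ge0 x)).
apply: (le_trans (ler_norm_sum _ _ _)); apply: ler_sum => i _.
rewrite /exp_coeff /cos_coeff /= !normrM normfV !normr_nat !normrX normrN normr1 expr1n mulr1.
by case: odd; rewrite ?mul0r ?mul1r// divr_ge0// exprn_ge0.
Qed.

Lemma series_sin_coeff_le x n : `|series (sin_coeff x) n| <= expR `|x|.
Proof.
apply: le_trans (series_exp_coeff_le n (normr_ge0 x)).
apply: (le_trans (ler_norm_sum _ _ _)); apply: ler_sum => i _.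
rewrite /exp_coeff /sin_coeff /= !normrM normfV !normr_nat !normrX normrN normr1 expr1n mulr1.
by case: odd; rewrite ?mul0r ?mul1r// divr_ge0// exprn_ge0.
Qed.
End trig_series.

Section agreement.
Context {R : realType}.
Variables mu nu : probability (measurableTypeR R) R.
Implicit Types (f g : R -> R) (c t x y : R) (k n : nat).

(** Integrability is part of the notion, so that it is stable under linear
    combinations and dominated limits. *)
Definition agree f := [/\ mu.-integrable setT (EFin \o f), nu.-integrable setT (EFin \o f) &
  (\int[mu]_x (f x)%:E = \int[nu]_x (f x)%:E)%E].

Lemma agree_ext f g : f =1 g -> agree f -> agree g.
Proof. by move=> /funext ->. Qed.

Lemma agree_measurable f : agree f -> measurable_fun setT f.
Proof. by case=> /integrableP[/measurable_EFinP]. Qed.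

Lemma agreeD f g : agree f -> agree g -> agree (fun x => f x + g x).
Proof.
move=> [fm fn E] [gm gn F].
have I (m : probability (measurableTypeR R) R) : m.-integrable setT (EFin \o f) ->
    m.-integrable setT (EFin \o g) -> m.-integrable setT (EFin \o (fun x => f x + g x)).
  move=> mf mg; apply: (@eq_integrable _ (measurableTypeR R) R m setT measurableT
    ((EFin \o f) \+ (EFin \o g))%E) => //; exact: integrableD.
split; [exact: I|exact: I|].
have S (m : probability (measurableTypeR R) R) : m.-integrable setT (EFin \o f) ->
    m.-integrable setT (EFin \o g) ->
    (\int[m]_x (f x + g x)%:E = \int[m]_x (f x)%:E + \int[m]_x (g x)%:E)%E.
  by move=> mf mg; rewrite -integralD.
by rewrite !S// E F.
Qed.

Lemma agreeZ c f : agree f -> agree (fun x => c * f x).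
Proof.
move=> [fm fn E].
have I (m : probability (measurableTypeR R) R) : m.-integrable setT (EFin \o f) ->
    m.-integrable setT (EFin \o (fun x => c * f x)).
  move=> mf; apply: (@eq_integrable _ (measurableTypeR R) R m setT measurableT (fun x => c%:E * (f x)%:E)%E) => //.
  exact: integrableZl.
split; [exact: I|exact: I|].
have S (m : probability (measurableTypeR R) R) : m.-integrable setT (EFin \o f) ->
    (\int[m]_x (c * f x)%:E = c%:E * \int[m]_x (f x)%:E)%E.
  by move=> mf; rewrite -integralZl.
by rewrite !S// E.
Qed.

Lemma agree0 : agree (fun=> 0).
Proof.
have I (m : probability (measurableTypeR R) R) : m.-integrable setT (EFin \o (fun=> 0 : R)).
  exact: integrable0.
by split; [exact: I|exact: I|rewrite !integral0].
Qed.

Lemma agree_sum I (r : seq I) (F : I -> R -> R) : (forall i, agree (F i)) ->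
  agree (fun x => \sum_(i <- r) F i x).
Proof.
move=> aF; elim: r => [|i r IH].
  by apply: agree_ext agree0 => x; rewrite big_nil.
by apply: agree_ext (agreeD (aF i) IH) => x; rewrite big_cons.
Qed.

Lemma agree_lim (f_ : nat -> R -> R) f (g : R -> R) :
  (forall n, agree (f_ n)) -> (forall x, f_ n x @[n --> \oo] --> f x) ->
  mu.-integrable setT (EFin \o g) -> nu.-integrable setT (EFin \o g) ->
  (forall n x, `|f_ n x| <= g x) -> agree f.
Proof.
move=> af ff gm gn fg.
have mf : measurable_fun setT f.
  apply: (@measurable_fun_cvg _ (measurableTypeR R) R setT f_ f) => [n|x _]; last exact: ff.
  exact: agree_measurable.
have D (m : probability (measurableTypeR R) R) : m.-integrable setT (EFin \o g) ->
    m.-integrable setT (EFin \o f) /\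
    (\int[m]_x (f_ n x)%:E @[n --> \oo] --> \int[m]_x (f x)%:E)%E.
  move=> gi; have [] := @dominated_convergence _ _ _ m setT measurableT
    (fun n x => (f_ n x)%:E) (fun x => (f x)%:E) (fun x => (g x)%:E).
  - by move=> n; apply/measurable_EFinP; exact: agree_measurable.
  - exact/measurable_EFinP.
  - by apply: aeW => x _; apply: cvg_EFin; [exact: nearW|exact: ff].
  - exact: gi.
  - by apply: aeW => x n _; rewrite lee_fin.
  - by [].
have [fm cm] := D _ gm; have [fn cn] := D _ gn; split=> //.
apply: (cvg_unique _ cm) => //.
apply: cvg_trans cn; apply: near_eq_cvg; apply: nearW => n /=.
by have [_ _ ->] := af n.
Qed.

Lemma integrable_cst_prob (m : probability (measurableTypeR R) R) c :
  m.-integrable setT (EFin \o (fun=> c)).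
Proof. exact: finite_measure_integrable_cst. Qed.

Lemma agree_lim_bounded (f_ : nat -> R -> R) f B :
  (forall n, agree (f_ n)) -> (forall x, f_ n x @[n --> \oo] --> f x) ->
  (forall n x, `|f_ n x| <= B) -> agree f.
Proof. by move=> af ff fB; apply: (agree_lim af ff _ _ fB); exact: integrable_cst_prob. Qed.

Section exponential_moments.
Variable delta : R.
Hypothesis delta_gt0 : 0 < delta.
Hypotheses (emu : mu.-integrable setT (EFin \o (fun x => expR (delta * `|x|))))
  (enu : nu.-integrable setT (EFin \o (fun x => expR (delta * `|x|)))).
Hypothesis moments : forall k, agree (fun x => x ^+ k).

Let trig_agree t := forall k,
  agree (fun x => x ^+ k * cos (t * x)) /\ agree (fun x => x ^+ k * sin (t * x)).

Let trig_agree0 : trig_agree 0.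
Proof.
move=> k; split.
  by apply: agree_ext (moments k) => x; rewrite mul0r cos0 mulr1.
by apply: agree_ext agree0 => x; rewrite mul0r sin0 mulr0.
Qed.

(** Expansion of the trigonometric function of frequency h in powers of x; the
    exponential moment dominates the partial sums because |h| <= delta / 2. *)
Let trig_term t h k (q : R -> R) : trig_agree t -> `|h| <= delta / 2 ->
  (forall j, agree (fun x => x ^+ j * q x)) -> (forall x, `|q x| <= 1) ->
  agree (fun x => x ^+ k * q x * cos (h * x)) /\
  agree (fun x => x ^+ k * q x * sin (h * x)).
Proof.
move=> tt hd aq q1.
pose K := k`!%:R / (delta / 2) ^+ k.
have d2 : 0 < delta / 2 by rewrite divr_gt0.
have K0 : 0 <= K by rewrite divr_ge0// exprn_ge0// ltW.
have iK (m : probability (measurableTypeR R) R) :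
    m.-integrable setT (EFin \o (fun x => expR (delta * `|x|))) ->
    m.-integrable setT (EFin \o (fun x => K * expR (delta * `|x|))).
  move=> mi; apply: (@eq_integrable _ (measurableTypeR R) R m setT measurableT (fun x => K%:E * (expR (delta * `|x|))%:E)%E) => //.
  exact: integrableZl.
have bnd x (S : R) : `|S| <= expR `|h * x| -> `|x ^+ k * q x * S| <= K * expR (delta * `|x|).
  move=> Sx; rewrite -mulrA normrM normrX.
  have -> : delta * `|x| = delta / 2 * `|x| + delta / 2 * `|x| by field.
  rewrite expRD mulrA ler_pM// ?expr_le_expR//.
  rewrite normrM -[leRHS]mul1r ler_pM//; apply: (le_trans Sx).
  by rewrite ler_expR normrM ler_wpM2r.
split.
- apply: (agree_lim (f_ := fun n x => x ^+ k * q x * series (cos_coeff (h * x)) n) _ _ (iK _ emu) (iK _ enu)).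
  + move=> n; apply: (agree_ext (f := fun x => \sum_(0 <= j < n)
      ((~~ odd j)%:R * (-1) ^+ j./2 / j`!%:R * h ^+ j) * (x ^+ (k + j) * q x))).
      move=> x; rewrite /series/= mulr_sumr; apply: eq_bigr => j _.
      by rewrite cos_coeffE /= exprD exprMn; ring.
    by apply: agree_sum => j; apply: agreeZ.
  + move=> x; apply: cvgM; first exact: cvg_cst.
    by rewrite unlock; exact: is_cvg_series_cos_coeff.
  + by move=> n x; apply: bnd; exact: series_cos_coeff_le.
- apply: (agree_lim (f_ := fun n x => x ^+ k * q x * series (sin_coeff (h * x)) n) _ _ (iK _ emu) (iK _ enu)).
  + move=> n; apply: (agree_ext (f := fun x => \sum_(0 <= j < n)
      ((odd j)%:R * (-1) ^+ j.-1./2 / j`!%:R * h ^+ j) * (x ^+ (k + j) * q x))).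
      move=> x; rewrite /series/= mulr_sumr; apply: eq_bigr => j _.
      by rewrite sin_coeffE /= exprD exprMn; ring.
    by apply: agree_sum => j; apply: agreeZ.
  + move=> x; apply: cvgM; first exact: cvg_cst.
    by rewrite unlock; exact: is_cvg_series_sin_coeff.
  + by move=> n x; apply: bnd; exact: series_sin_coeff_le.
Qed.

Let trig_agree_step t h : trig_agree t -> `|h| <= delta / 2 -> trig_agree (t + h).
Proof.
move=> tt hd k.
have [cc cs] := @trig_term t h k (fun x => cos (t * x)) tt hd (fun j => (tt j).1) (fun x => cos_max _).
have [sc ss] := @trig_term t h k (fun x => sin (t * x)) tt hd (fun j => (tt j).2) (fun x => sin_max _).
split.
  by apply: agree_ext (agreeD cc (agreeZ (- 1) ss)) => x; rewrite mulrDl cosD; ring.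
by apply: agree_ext (agreeD sc cs) => x; rewrite mulrDl sinD; ring.
Qed.

(** The frequency t is reached by finitely many steps of length at most delta
    / 2. The monomial weights in [trig_agree] are what the expansion in the
    next step consumes. *)
Lemma agree_trig t : agree (fun x => cos (t * x)) /\ agree (fun x => sin (t * x)).
Proof.
have d2 : 0 < delta / 2 by rewrite divr_gt0.
pose n := (Num.truncn (`|t| / (delta / 2))).+1.
have n0 : 0 < n%:R :> R by rewrite ltr0n.
have hd : `|t / n%:R| <= delta / 2.
  rewrite normrM normfV (gtr0_norm n0) ler_pdivrMr// -ler_pdivrMl// mulrC.
  have t0 : 0 <= `|t| / (delta / 2) by rewrite divr_ge0// ltW.
  by have /andP[_ /ltW] := truncn_itv t0.
have H j : trig_agree (j%:R * (t / n%:R)).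
  elim: j => [|j IH]; first by rewrite mul0r.
  by rewrite -natr1 mulrDl mul1r; exact: trig_agree_step.
have := H n 0%N; rewrite mulrCA mulfV ?gt_eqF// mulr1 => -[c s].
by split; [apply: agree_ext c|apply: agree_ext s] => x; rewrite expr0 mul1r.
Qed.

End exponential_moments.
End agreement.

(** * Indicators of intervals as limits of trigonometric polynomials *)

Section threshold_polynomial.
Context {R : realType}.
Implicit Types (v w y : R) (n k : nat).

Lemma bernoulli_ge y n : 0 <= y -> 1 + n%:R * y <= (1 + y) ^+ n.
Proof.
move=> y0; elim: n => [|n IH]; first by rewrite mul0r addr0 expr0.
rewrite exprS; have := ler_wpM2l (_ : 0 <= 1 + y) IH; rewrite addr_ge0// => /(_ isT).
apply: le_trans; rewrite -natr1 mulrDl mul1r.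
have : 0 <= n%:R * y ^+ 2 by rewrite mulr_ge0 ?sqr_ge0.
by rewrite expr2; lra.
Qed.

Lemma bernoulli_le y n : 0 <= y <= 1 -> 1 - n%:R * y <= (1 - y) ^+ n.
Proof.
move=> /andP[y0 y1]; elim: n => [|n IH]; first by rewrite mul0r subr0 expr0.
rewrite exprS; have := ler_wpM2l (_ : 0 <= 1 - y) IH; rewrite subr_ge0 => /(_ y1).
apply: le_trans; rewrite -natr1 mulrDl mul1r.
have : 0 <= n%:R * y ^+ 2 by rewrite mulr_ge0 ?sqr_ge0.
by rewrite expr2; lra.
Qed.

Lemma natmul_expr_bound w : 0 <= w < 1 -> exists2 B, 0 <= B & forall n, n%:R * w ^+ n <= B.
Proof.
move=> /andP[]; rewrite le_eqVlt => /predU1P[<- _|w0 w1].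
  by exists 0 => // -[|n]; rewrite ?mul0r// expr0n mulr0.
have a0 : 0 < w^-1 - 1 by rewrite subr_gt0 invf_gt1.
exists (w^-1 - 1)^-1 => [|n]; first by rewrite invr_ge0 ltW.
rewrite -[leRHS]mul1r ler_pdivlMr// mulrAC -ler_pdivlMr ?exprn_gt0// mul1r -exprVn.
have := bernoulli_ge n (ltW a0); rewrite [1 + (_ - 1)]addrC subrK => h.
by apply: le_trans h; rewrite lerDr.
Qed.

(** Polynomials in v which converge to the indicator of v < 1 / k. *)
Definition threshold k n v : R := (1 - v ^+ (n + n)) ^+ (n * k ^ (n + n)).

Lemma threshold_bounds k n v : 0 <= v <= 1 -> 0 <= threshold k n v <= 1.
Proof.
move=> /andP[v0 v1].
have v2 : 0 <= 1 - v ^+ (n + n) by rewrite subr_ge0 exprn_ile1.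
by rewrite exprn_ge0// exprn_ile1// gerBl exprn_ge0.
Qed.

(** The product of the exponent and v^(2n) is n (k v)^(2n), which tends to 0
    if k v < 1 and is at least n otherwise; the inequalities of Bernoulli and
    1 - x <= exp (- x) conclude. *)
Lemma threshold_cvg k v : 0 <= v <= 1 -> (0 < k)%N ->
  threshold k n v @[n --> \oo] --> ((v < k%:R^-1)%R%:R : R).
Proof.
move=> v01 k0; have /andP[v0 v1] := v01.
have kR : 0 < k%:R :> R by rewrite ltr0n.
pose w := k%:R * v; have w0 : 0 <= w by rewrite mulr_ge0.
have wE n : (n * k ^ (n + n))%:R * v ^+ (n + n) = n%:R * w ^+ (n + n).
  by rewrite natrM natrX -mulrA -exprMn.
have y01 n : 0 <= v ^+ (n + n) <= 1 by rewrite exprn_ge0// exprn_ile1.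
have [vk|vk] := ltP v k%:R^-1.
  have w1 : w < 1 by rewrite /w mulrC -ltr_pdivlMr// mul1r.
  have [B B0 hB] := natmul_expr_bound (introT andP (conj w0 w1)).
  have lim : 1 - B * w ^+ n @[n --> \oo] --> (1 - B * 0 : R).
    apply: cvgB; first exact: cvg_cst.
    by apply: cvgM; [exact: cvg_cst|apply: cvg_expr; rewrite ger0_norm].
  rewrite mulr0 subr0 in lim.
  change (threshold k n v @[n --> \oo] --> (1 : R)).
  apply: (@squeeze_cvgr _ _ _ _ (fun n => 1 - B * w ^+ n) (fun=> 1) _ _ _ lim); last exact: cvg_cst.
  apply: nearW => n.
  have /andP[_ ->] := threshold_bounds k n v01; rewrite andbT.
  apply: le_trans (bernoulli_le _ (y01 n)); rewrite lerD2l lerN2 wE exprD mulrA.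
  by rewrite ler_wpM2r ?exprn_ge0.
have w1 : 1 <= w by rewrite /w mulrC -ler_pdivrMr// mul1r.
change (threshold k n v @[n --> \oo] --> (0 : R)).
apply: (@squeeze_cvgr _ _ _ _ (fun=> 0) (fun n => expR (- n%:R))); last 2 first.
- exact: cvg_cst.
- exact: cvgn_expR.
apply: nearW => n.
have /andP[-> _] := threshold_bounds k n v01; rewrite /=.
have /andP[y0 y1] := y01 n.
apply: (@le_trans _ _ (expR (- v ^+ (n + n)) ^+ (n * k ^ (n + n)))).
  by rewrite lerXn2r ?nnegrE ?subr_ge0 ?expR_ge0// expR_ge1Dx.
rewrite -expRM_natl ler_expR mulrN lerN2 wE ler_peMr// exprn_ege1//.
Qed.

Lemma sin_mvt (z : R) : 0 < z -> exists2 c : R, 0 < c < z & sin z = z * cos c.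
Proof.
move=> z0; have [] := @MVT R sin cos 0 z z0.
- exact/continuous_subspaceT/continuous_sin.
- move=> c; rewrite in_itv/= => cz; rewrite sin0 !subr0 => ->.
  by exists c => //; rewrite mulrC.
Qed.

Lemma sin_lt_id (z : R) : 0 < z <= 1 -> sin z < z.
Proof.
move=> /andP[z0 z1]; have [c /andP[c0 cz] ->] := sin_mvt z0.
rewrite gtr_pMr// -(@cos0 R) ltr_cos// in_itv/= ?lexx ?pi_ge0//.
rewrite (ltW c0) (le_trans (ltW cz))// (le_trans z1)// (le_trans _ (@pi_ge2 R))//.
by rewrite ler1n.
Qed.

Lemma sin_norm_le1 (z : R) : `|z| <= 1 -> `|sin z| = sin `|z|.
Proof.
move=> z1; have s0 : 0 <= sin `|z|.
  by rewrite sin_ge0_pi// normr_ge0 (le_trans z1)// (le_trans _ (@pi_ge2 R))// ler1n.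
rewrite -(ger0_norm s0); have [z0|z0] := leP 0 z; first by rewrite (ger0_norm z0).
by rewrite (ltr0_norm z0) sinN normrN.
Qed.

(** With m = n + 1, the condition reads m |sin (w / m)| < 1. Since sin z < z
    for small z > 0, and sin z / z tends to 1, it holds in the limit exactly
    on the closed interval |w| <= 1. *)
Lemma dilated_sine_cvg w :
  ((1 - cos (w / n.+1%:R) ^+ 2 < (n.+1 ^ 2)%:R^-1)%R%:R : R) @[n --> \oo] --> ((`|w| <= 1)%R%:R : R).
Proof.
have mR n : 0 < n.+1%:R :> R by rewrite ltr0n.
have E n : (1 - cos (w / n.+1%:R) ^+ 2 < (n.+1 ^ 2)%:R^-1) = (`|sin (w / n.+1%:R)| < n.+1%:R^-1).
  rewrite -sin2cos2 natrX -exprVn -[in LHS]real_normK ?num_real//.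
  by rewrite ltr_pXn2r ?nnegrE// invr_ge0 ltW.
have nE n : `|w / n.+1%:R| = `|w| / n.+1%:R by rewrite normrM normfV (gtr0_norm (mR n)).
apply: cvg_near_cst; have [w1|w1] := leP `|w| 1.
  apply: nearW => n; rewrite E.
  have z1 : `|w / n.+1%:R| <= n.+1%:R^-1 by rewrite nE ler_piMl// invr_ge0 ltW.
  have z1' : `|w / n.+1%:R| <= 1 by rewrite (le_trans z1)// invf_le1// ler1n.
  rewrite sin_norm_le1//; have [z0|z0] := eqVneq (w / n.+1%:R) 0.
    by rewrite z0 normr0 sin0 invr_gt0 mR.
  by rewrite (lt_le_trans (sin_lt_id _) z1)// normr_gt0 z0.
have w0 : 0 < `|w| by exact: lt_trans w1.
have : \forall x \near (0:R), `|w|^-1 < cos x.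
  have w0' : `|w|^-1 < cos (0 : R) by rewrite cos0 invf_lt1.
  exact: (cvgr_gt _ (@continuous_cos R 0) _ w0').
move=> /nbhs_ballP[d /= d0 hd].
near=> n; rewrite E.
have m0 : 0 < Num.min d 1 by rewrite lt_min d0 ltr01.
have zd : `|w| / n.+1%:R < Num.min d 1.
  rewrite ltr_pdivrMr// -ltr_pdivrMl//.
  near: n; exists (Num.truncn ((Num.min d 1)^-1 * `|w|)).+1 => // j /= tj.
  by apply: lt_le_trans (truncnS_gt _) _; rewrite ler_nat leqW.
have z0 : 0 < `|w| / n.+1%:R by rewrite divr_gt0.
move: zd; rewrite lt_min => /andP[zd z1].
rewrite sin_norm_le1 nE ?ltW//; have [c /andP[c0 cz] ->] := sin_mvt z0.
have : `|w|^-1 < cos c by apply: hd; rewrite /ball/= sub0r normrN gtr0_norm// (lt_trans cz).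
move=> h; have -> : (`|w| / n.+1%:R * cos c < n.+1%:R^-1) = false => //.
apply/negbTE; rewrite -leNgt mulrAC ler_pdivlMr// mulVf ?gt_eqF//.
by rewrite -ler_pdivrMl// mulr1 ltW.
Unshelve. all: by end_near. Qed.

End threshold_polynomial.

Section trigonometric_determinacy.
Context {R : realType}.
Variables mu nu : probability (measurableTypeR R) R.
Implicit Types (t s y : R).
Hypothesis trig : forall t, agree mu nu (fun x => cos (t * x)) /\ agree mu nu (fun x => sin (t * x)).

Lemma agree_cos_shift t y : agree mu nu (fun x => cos (t * (x - y))).
Proof.
have [c s] := trig t.
apply: agree_ext (agreeD (agreeZ (cos (t * y)) c) (agreeZ (sin (t * y)) s)) => x.
by rewrite mulrBr cosB; ring.
Qed.

(** Products of cosines are turned into sums of cosines. *)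
Lemma agree_cos_pow t y n : forall s,
  agree mu nu (fun x => cos (t * (x - y)) ^+ n * cos (s * (x - y))).
Proof.
elim: n => [|n IH] s.
  by apply: agree_ext (agree_cos_shift s y) => x; rewrite expr0 mul1r.
apply: agree_ext (agreeZ 2^-1 (agreeD (IH (s + t)) (IH (s - t)))) => x.
rewrite mulrDl mulrBl cosD cosB exprS.
by move: (cos (t * (x - y)) : R) (cos (s * (x - y)) : R) (sin (t * (x - y)) : R)
  (sin (s * (x - y)) : R) => c c' z z'; field.
Qed.

Lemma agree_cos_poly (p : {poly R}) t y : agree mu nu (fun x => p.[cos (t * (x - y))]).
Proof.
have pw i : agree mu nu (fun x => cos (t * (x - y)) ^+ i).
  by apply: agree_ext (agree_cos_pow t y i 0) => x; rewrite mul0r cos0 mulr1.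
apply: agree_ext (agree_sum (index_enum _) (fun i : 'I_(size p) => agreeZ p`_i (pw i))) => x.
by rewrite horner_coef.
Qed.

Lemma agree_threshold t y (k : nat) : (0 < k)%N ->
  agree mu nu (fun x => (1 - cos (t * (x - y)) ^+ 2 < k%:R^-1)%R%:R).
Proof.
move=> k0; pose v x := 1 - cos (t * (x - y)) ^+ 2.
have v01 x : 0 <= v x <= 1.
  by rewrite /v subr_ge0 -real_normK ?num_real// expr_le1 ?cos_max//= gerBl exprn_ge0.
apply: (@agree_lim_bounded _ mu nu (fun n x => threshold k n (v x)) _ 1).
- move=> n; apply: agree_ext (agree_cos_poly
    ((1 - (1 - 'X ^+ 2) ^+ (n + n)) ^+ (n * k ^ (n + n))) t y) => x.
  by rewrite /threshold /v !(hornerE, horner_exp).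
- by move=> x; exact: threshold_cvg.
- by move=> n x; have /andP[h0 h1] := threshold_bounds k n (v01 x); rewrite ger0_norm.
Qed.

(** Indicators of periodic sets, whose period tends to infinity. *)
Lemma agree_ball y (rho : R) : 0 < rho -> agree mu nu (fun x => (`|x - y| <= rho)%R%:R).
Proof.
move=> rho0.
apply: (@agree_lim_bounded _ mu nu (fun n x =>
  (1 - cos ((rho * n.+1%:R)^-1 * (x - y)) ^+ 2 < (n.+1 ^ 2)%:R^-1)%R%:R) _ 1).
- by move=> n; apply: agree_threshold; rewrite expn_gt0.
- move=> x; have := @dilated_sine_cvg R ((x - y) / rho).
  rewrite normrM normfV (gtr0_norm rho0) ler_pdivrMr// mul1r => h.
  have E n : (rho * n.+1%:R)^-1 * (x - y) = (x - y) / rho / n.+1%:R.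
    by rewrite invfM mulrC mulrA.
  by under eq_cvg do rewrite E.
- by move=> n x; case: (_ < _); rewrite ?normr0 ?normr1.
Qed.

Lemma agree_itvcc (a b : R) : a < b -> agree mu nu (fun x => (a <= x <= b)%R%:R).
Proof.
move=> ab; have r0 : 0 < (b - a) / 2 by rewrite divr_gt0// subr_gt0.
apply: agree_ext (agree_ball ((a + b) / 2) r0) => x.
rewrite ler_distl; have -> : (a + b) / 2 - (b - a) / 2 = a by field.
by have -> : (a + b) / 2 + (b - a) / 2 = b by field.
Qed.

Lemma agree_itvoc (a b : R) : a < b -> agree mu nu (fun x => (a < x <= b)%R%:R).
Proof.
move=> ab; have ba : 0 < b - a by rewrite subr_gt0.
apply: (@agree_lim_bounded _ mu nu (fun n x =>
  (a + (b - a) / n.+2%:R <= x <= b)%R%:R) _ 1).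
- move=> n; apply: agree_itvcc; rewrite -ltrBrDl ltr_pdivrMr ?ltr0n//.
  by rewrite ltr_pMr// ltr1n.
- move=> x; apply: cvg_near_cst; have [ax|xa] := ltP a x; last first.
    apply: nearW => n; congr ((_ : bool)%:R); apply/negbTE; rewrite negb_and.
    by rewrite -ltNge (le_lt_trans xa)// ltrDl divr_gt0.
  exists (Num.truncn ((b - a) / (x - a))) => // n /= hn.
  suff -> : a + (b - a) / n.+2%:R <= x by [].
  rewrite -lerBrDl ler_pdivrMr ?ltr0n// mulrC -ler_pdivrMr ?subr_gt0//.
  apply: le_trans (ltW (truncnS_gt _)) _; rewrite ler_nat.
  exact: leq_trans (leqnSn _).
- by move=> n x; case: (_ && _); rewrite ?normr0 ?normr1.
Qed.

Lemma trig_determinacy A : measurable A -> mu A = nu A.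
Proof.
move=> mA.
have oc (a b : R) : mu `]a, b]%classic = nu `]a, b]%classic.
  have [ab|ba] := ltP a b; last first.
    by rewrite set_itv_ge ?measure0// -leNgt bnd_simp.
  have [_ _] := agree_itvoc ab.
  have E (m : probability (measurableTypeR R) R) :
      (\int[m]_x ((a < x <= b)%R%:R : R)%:E = m `]a, b]%classic)%E.
    have mab : measurable (`]a, b]%classic : set (measurableTypeR R)) by exact: measurable_itv.
    have := @integral_indic _ (measurableTypeR R) R m setT measurableT _ mab.
    rewrite setIT => <-; apply: eq_integral => x _.
    by rewrite indicE mem_setE.
  by rewrite !E.
apply: (@measure_unique _ R (measurableTypeR R) (@ocitv R)
  (fun n => `]- n%:R, n%:R]%classic)) => //.
- exact: ocitvI.
- by move=> n; exact: is_ocitv.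
- exact: bigcup_itvT.
- by move=> ? [[a b] _ <-]; exact: oc.
- by move=> n; rewrite (le_lt_trans (probability_le1 _ _))// ltry.
Qed.

End trigonometric_determinacy.

(** * Determinacy of moment sequences of factorial growth *)

Section moment_growth.
Context {R : realType}.

Lemma fact_mul_le (i k : nat) : (i <= k)%N -> ((k - i)`! * i`! <= k`!)%N.
Proof. by move=> ik; rewrite -(bin_fact ik) mulnC leq_pmull// bin_gt0. Qed.

(** Each of the k + 1 terms of the convolution is bounded through (k - i)! i!
    <= k!, so that their sum is at most C^k (k + 1)!. *)
Lemma rec_moment_growth (a e g : R) k :
  `|rec_moment (fun j => a + j%:R * e) g k| <= (1 + `|a| + `|e| + `|g|) ^+ k * k`!%:R.
Proof.
set C := 1 + _ + _ + _.
have C0 : 0 <= C by rewrite !addr_ge0.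
have [m] := ubnP k; elim: m k => // m IH [_|k]; first by rewrite rec_moment0 normr1 expr0 mul1r.
rewrite ltnS => km; rewrite rec_momentS.
have F : 0 <= C ^+ k * (k.+1)`!%:R by rewrite mulr_ge0 ?exprn_ge0.
have h1 : `|(a + k%:R * e) * rec_moment (fun j => a + j%:R * e) g k| <=
    (`|a| + `|e|) * (C ^+ k * (k.+1)`!%:R).
  rewrite normrM factS natrM -natr1.
  have -> : (`|a| + `|e|) * (C ^+ k * ((k%:R + 1) * k`!%:R)) =
    ((k%:R + 1) * (`|a| + `|e|)) * (C ^+ k * k`!%:R) by ring.
  rewrite ler_pM ?IH//; apply: (le_trans (ler_normD _ _)).
  rewrite normrM normr_nat mulrDl mul1r mulrDr.
  have : 0 <= k%:R * `|a| by rewrite mulr_ge0.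
  by have := normr_ge0 e; lra.
have h2 : `|g * \sum_(i < k.+1) rec_moment (fun j => a + j%:R * e) g (k - i) *
      rec_moment (fun j => a + j%:R * e) g i| <= `|g| * (C ^+ k * (k.+1)`!%:R).
  rewrite normrM ler_wpM2l// (le_trans (ler_norm_sum _ _ _))//.
  apply: (@le_trans _ _ (\sum_(i < k.+1) C ^+ k * k`!%:R)).
    apply: ler_sum => -[i /= ik] _; rewrite ltnS in ik; rewrite normrM.
    apply: (@le_trans _ _ (C ^+ (k - i) * (k - i)`!%:R * (C ^+ i * i`!%:R))).
      by rewrite ler_pM ?IH// (leq_ltn_trans _ km)// leq_subr.
    rewrite mulrACA -exprD subnK// ler_wpM2l ?exprn_ge0//.
    by rewrite -natrM ler_nat fact_mul_le.
  by rewrite sumr_const card_ord -mulr_natl factS natrM; lra.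
apply: (le_trans (ler_normD _ _)); apply: (le_trans (lerD h1 h2)).
rewrite exprS -mulrA -mulrDl ler_wpM2r// /C; lra.
Qed.

End moment_growth.

Section moment_determinacy.
Context {R : realType}.
Implicit Types (m mu nu : probability (measurableTypeR R) R) (u : nat -> R).

Definition has_moments m u := forall k : nat,
  m.-integrable setT (fun x : R => (x ^+ k)%:E) /\ (\int[m]_x (x ^+ k)%:E = (u k)%:E)%E.

Lemma has_moments_sum m u (a : nat -> R) n : has_moments m u ->
  m.-integrable setT (EFin \o (fun x : R => \sum_(0 <= j < n) a j * x ^+ j)) /\
  (\int[m]_x (\sum_(0 <= j < n) a j * x ^+ j)%:E = (\sum_(0 <= j < n) a j * u j)%:E)%E.
Proof.
move=> mu; elim: n => [|n [I E]].
  under eq_integral do rewrite big_nil.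
  rewrite big_nil integral0; split => //.
  apply: (@eq_integrable _ (measurableTypeR R) R m setT measurableT (fun=> 0%E)).
    by move=> x _ /=; rewrite big_nil.
  exact: integrable0.
have [Ik Ek] := mu n.
have IZ : m.-integrable setT (fun x : R => (a n)%:E * (x ^+ n)%:E)%E by exact: integrableZl.
pose p (x : R) := \sum_(0 <= j < n) a j * x ^+ j.
pose q (x : R) := ((a n)%:E * (x ^+ n)%:E)%E.
have pq x : (\sum_(0 <= j < n.+1) a j * x ^+ j)%:E = ((EFin \o p) \+ q)%E x.
  by rewrite big_nat_recr.
split.
  apply: (@eq_integrable _ (measurableTypeR R) R m setT measurableT ((EFin \o p) \+ q)%E).
    by move=> x _ /=; rewrite -pq.
  exact: integrableD.
under eq_integral do rewrite pq.
rewrite (@integralD _ (measurableTypeR R) R m setT measurableT (EFin \o p) q)//.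
by rewrite E (integralZl measurableT Ik) Ek big_nat_recr//= EFinD EFinM.
Qed.

(** Only even powers survive in exp (d x) + exp (- d x), whose partial sums
    therefore increase; their integrals are bounded by a geometric series of
    ratio 1/2. *)
Lemma exp_moment_integrable m u (C : R) : 0 < C -> has_moments m u ->
  (forall k, `|u k| <= C ^+ k * k`!%:R) ->
  m.-integrable setT (EFin \o (fun x => expR ((2 * C)^-1 * `|x|))).
Proof.
move=> C0 mu uC; pose d := (2 * C)^-1.
have d0 : 0 < d by rewrite invr_gt0 mulr_gt0.
have dC : d * C = 2^-1 by rewrite /d; field; rewrite gt_eqF.
pose a (j : nat) : R := (1 + (-1) ^+ j) * d ^+ j / j`!%:R.
have a2 (j : nat) : 0 <= (1 + (-1) ^+ j : R) <= 2.
  by rewrite -signr_odd; case: odd => /=; rewrite ?expr0 ?expr1; apply/andP; split; lra.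
pose g (n : nat) (x : R) := (\sum_(0 <= j < n) a j * x ^+ j)%:E.
have gE n x : g n x = (series (exp_coeff (d * x)) n + series (exp_coeff (- (d * x))) n)%:E.
  congr EFin; rewrite /series/= -big_split/=; apply: eq_bigr => j _.
  by rewrite /a /exp_coeff/= (exprNn (d * x)) !exprMn; ring.
have t0 j x : 0 <= a j * x ^+ j.
  rewrite mulrAC mulr_ge0 ?invr_ge0// -mulrA -exprMn -signr_odd.
  have [oj|ej] := boolP (odd j); first by rewrite expr1 subrr mul0r.
  by rewrite expr0 mulr_ge0// exprn_even_ge0.
have mg n : measurable_fun setT (g n).
  by have [/integrableP[]] := has_moments_sum a n mu.
pose f x := (expR (d * x) + expR (- (d * x)))%:E : \bar R.
have gf x : g n x @[n --> \oo] --> f x.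
  under eq_fun do rewrite gE.
  apply: cvg_EFin; first exact: nearW.
  by apply: cvgD; exact: is_cvg_series_exp_coeff.
have mexp : measurable_fun setT (fun x : R => expR (d * `|x|)).
  apply: measurableT_comp => //; apply: measurable_funM => //.
apply/integrableP; split; first exact/measurable_EFinP.
have f0 x : (0 <= f x)%E by rewrite lee_fin addr_ge0 ?expR_ge0.
have mf : measurable_fun setT f.
  exact: (@emeasurable_fun_cvg _ (measurableTypeR R) R setT g f mg (fun x _ => gf x)).
apply: (@le_lt_trans _ _ (\int[m]_x f x)%E).
  apply: (@ge0_le_integral _ (measurableTypeR R) R m setT measurableT) => //.
  - by apply/measurable_EFinP; apply: measurableT_comp.
  - move=> x _; rewrite lee_fin ger0_norm ?expR_ge0//.
    have [x0|x0] := leP 0 x; first by rewrite ger0_norm// lerDl expR_ge0.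
    by rewrite ltr0_norm// mulrN lerDr expR_ge0.
have mono x : {homo g^~ x : n k / (n <= k)%N >-> (n <= k)%E}.
  move=> n k nk; rewrite lee_fin (@big_cat_nat _ _ _ n 0 k)//= lerDl.
  by apply: sumr_ge0 => j _; exact: t0.
have g0 n x : setT x -> (0 <= g n x)%E by move=> _; rewrite lee_fin sumr_ge0.
have cvg := @cvg_monotone_convergence _ (measurableTypeR R) R m setT measurableT g mg g0
  (fun x _ => mono x).
have -> : (\int[m]_x f x = \int[m]_x limn (g^~ x))%E.
  by apply: eq_integral => x _; apply/esym/cvg_lim => //; exact: gf.
apply: (@le_lt_trans _ _ 4%:E); last exact: ltry.
rewrite -(cvg_lim _ cvg)//; apply: lime_le; first by apply/cvg_ex; eexists; exact: cvg.
apply: nearW => n; have [_ ->] := has_moments_sum a n mu; rewrite lee_fin.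
apply: (@le_trans _ _ (\sum_(0 <= j < n) 2 * 2^-1 ^+ j)).
  apply: ler_sum => j _; apply: (le_trans (ler_norm _)).
  have /andP[e0 e2] := a2 j; have f1 : 0 < j`!%:R :> R by rewrite ltr0n fact_gt0.
  rewrite /a !normrM normfV (ger0_norm e0) (gtr0_norm f1) (ger0_norm (exprn_ge0 _ (ltW d0))).
  rewrite -!mulrA ler_pM//; first by rewrite mulr_ge0 ?exprn_ge0 ?(ltW d0)// mulr_ge0// invr_ge0 ltW.
  rewrite -dC exprMn ler_wpM2l ?exprn_ge0 ?(ltW d0)//.
  by rewrite mulrC ler_pdivrMr.
rewrite -mulr_sumr; have -> : (4 : R) = 2 * 2 by ring.
rewrite ler_wpM2l//; have z1 : (2^-1 : R) != 1 by rewrite lt_eqF// invf_lt1 ?ltr1n.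
have /(congr1 (fun s : R^nat => s n)) := geometric_seriesE 1 z1.
rewrite /series /geometric/=; under eq_bigr do rewrite mul1r.
move=> ->.
have h0 : 0 <= (2^-1 : R) ^+ n by rewrite exprn_ge0.
have -> : (1 - 2^-1 : R) = 2^-1 by field.
rewrite mul1r invrK; lra.
Qed.

(** Factorial growth yields a common exponential moment, hence equality of all
    trigonometric integrals, hence equality of the laws. *)
Lemma moment_determinacy mu nu u (C : R) : 0 < C ->
  (forall k, `|u k| <= C ^+ k * k`!%:R) -> has_moments mu u -> has_moments nu u ->
  forall A, measurable A -> mu A = nu A.
Proof.
move=> C0 uC mmu mnu; apply: trig_determinacy.
apply: (agree_trig (delta := (2 * C)^-1)); first by rewrite invr_gt0 mulr_gt0.
- exact: exp_moment_integrable mmu uC.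
- exact: exp_moment_integrable mnu uC.
- by move=> k; have [I E] := mmu k; have [J F] := mnu k; split => //; rewrite E F.
Qed.

End moment_determinacy.

(** * Quantile functions *)

Section quantile.
Context {R : realType}.
Implicit Types (m : probability (measurableTypeR R) R) (s t x y : R).

Lemma is_interval_preimage_ge (q : R -> R) x :
  {in `]0, 1[ &, nondecreasing_fun q} ->
  is_interval (`]0, 1[%classic `&` q @^-1` `[x, +oo[%classic : set R).
Proof.
move=> nd s t /= [s01 +] [t01 +] r /andP[sr rt].
rewrite !in_itv/= !andbT => xs xt.
have r01 : r \in `]0, 1[.
  move: s01 t01; rewrite !in_itv/= => /andP[s0 _] /andP[_ t1].
  by rewrite (lt_le_trans s0 sr) (le_lt_trans rt t1).
by split => //; rewrite ?in_itv/= ?andbT; apply: (le_trans xs); exact: nd.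
Qed.

(** Quantiles are meaningful on the open unit interval only; the value 0
    outside has no effect on integrals against [unif01]. *)
Definition unit_ext (q : R -> R) t : R := if 0 < t < 1 then q t else 0.

Lemma measurable_unit_ext (q : R -> R) : {in `]0, 1[ &, nondecreasing_fun q} ->
  measurable_fun setT (unit_ext q : measurableTypeR R -> measurableTypeR R).
Proof.
move=> nd; apply: (@measurable_fun_if _ _ (measurableTypeR R) (measurableTypeR R)) => //.
  by apply: measurable_and; exact: measurable_fun_ltr.
apply: (measurability (@RGenCInfty.G R)) => [|/= _ [_] [r] -> <-].
  exact: RGenCInfty.measurableE.
rewrite setTI (_ : _ @^-1` [set true] = `]0, 1[%classic).
  apply: is_interval_measurable; apply: is_interval_preimage_ge. exact: nd.
by apply/seteqP; split => t /=; rewrite in_itv.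
Qed.

Definition unif01 : probability (measurableTypeR R) R := uniform_prob (@ltr01 R).

Lemma unif01_itv (bl br : bool) (a b : R) : 0 <= a -> a <= b -> b <= 1 ->
  unif01 [set` Interval (BSide bl a) (BSide br b)] = (b - a)%:E.
Proof.
move=> a0 ab b1; rewrite /unif01/= /uniform_prob integral_uniform_pdf.
have sub : [set` Interval (BSide bl a) (BSide br b)] `<=` `[0, 1].
  by apply: subset_itv; rewrite bnd_simp; [case: bl|case: br].
rewrite setIidl// (eq_integral (fun=> 1%E)); last first.
  move=> x; rewrite inE => /sub/=; rewrite in_itv/= /uniform_pdf => ->.
  by rewrite subr0 invr1.
rewrite integral_cst//= lebesgue_measure_itv/= mul1e lte_fin.
by case: ltP ab => // ba ab; rewrite (@le_anti _ _ a b) ?subrr// ab.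
Qed.

Lemma unif01_null (A : set R) : measurable A -> A `&` `]0, 1[%classic = set0 ->
  unif01 A = 0%E.
Proof.
move=> mA A0; have m01 : measurable (`]0, 1[%classic : set (measurableTypeR R)).
  exact: measurable_itv.
apply/eqP; rewrite eq_le measure_ge0 andbT.
apply: (@le_trans _ _ (unif01 (~` `]0, 1[%classic))).
  apply: le_measure; rewrite ?inE//; first exact: measurableC.
  by move=> x Ax x01; have : (A `&` `]0, 1[%classic) x by []; rewrite A0.
by rewrite probability_setC// unif01_itv// subr0 -EFinB subrr.
Qed.

Lemma unif01_eq (A B : set R) : measurable A -> measurable B ->
  A `&` `]0, 1[%classic = B `&` `]0, 1[%classic -> unif01 A = unif01 B.
Proof.
have m01 : measurable (`]0, 1[%classic : set (measurableTypeR R)).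
  exact: measurable_itv.
have E (C : set R) : measurable C -> unif01 C = unif01 (C `&` `]0, 1[%classic).
  move=> mC; rewrite (measureDI unif01 mC m01) [X in (X + _)%E]unif01_null ?add0e//.
    exact: measurableD.
  by rewrite setDE -setIA setICl setI0.
by move=> mA mB AB; rewrite E// AB -E.
Qed.

Section quantile_of.
Variable m : probability (measurableTypeR R) R.
Let idTR : measurableTypeR R -> R := idfun.

#[local] HB.instance Definition _ :=
  @isMeasurableFun.Build _ _ _ _ idTR (@measurable_id _ _ setT).

Definition distr_fun x : R := fine (m `]-oo, x]%classic).

Let distr_funE x : (distr_fun x)%:E = cdf (idTR : {RV m >-> R}) x.
Proof. by rewrite fineK ?fin_num_measure// /cdf/= /distribution /pushforward preimage_id. Qed.

Lemma distr_fun_ge0 x : 0 <= distr_fun x.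
Proof. by rewrite -lee_fin distr_funE cdf_ge0. Qed.

Lemma distr_fun_le1 x : distr_fun x <= 1.
Proof. by rewrite -lee_fin distr_funE cdf_le1. Qed.

Lemma distr_fun_nd : nondecreasing_fun distr_fun.
Proof. by move=> x y xy; rewrite -lee_fin !distr_funE cdf_nondecreasing. Qed.

Let distr_fun_y : distr_fun @ +oo --> (1 : R).
Proof.
apply/fine_cvg; under eq_fun do rewrite -[m _]fineK ?fin_num_measure// distr_funE.
exact: cvg_cdfy1.
Qed.

Let distr_fun_Ny : distr_fun @ -oo --> (0 : R).
Proof.
apply/fine_cvg; under eq_fun do rewrite -[m _]fineK ?fin_num_measure// distr_funE.
exact: cvg_cdfNy0.
Qed.

Let distr_fun_right x : distr_fun @ x^'+ --> distr_fun x.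
Proof.
apply/fine_cvg; rewrite distr_funE; under eq_fun do rewrite -[m _]fineK ?fin_num_measure// distr_funE.
exact: cdf_right_continuous.
Qed.

Definition quantile t : R := inf [set x | t <= distr_fun x].

(** The infimum that defines the quantile is attained, by right continuity of
    the distribution function. *)
Lemma quantile_le t x : t \in `]0, 1[ -> (quantile t <= x) = (t <= distr_fun x).
Proof.
rewrite in_itv/= => /andP[t0 t1]; set S := [set x | t <= distr_fun x].
have S0 : S !=set0.
  have [y /ltW ty] := filter_ex (cvgr_gt _ distr_fun_y _ t1).
  by exists y.
have Sb : has_lbound S.
  have [y yt] := filter_ex (cvgr_lt _ distr_fun_Ny _ t0).
  exists y => z /= tz; rewrite leNgt; apply/negP => /ltW zy.
  by have := le_lt_trans (le_trans tz (distr_fun_nd zy)) yt; rewrite ltxx.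
apply/idP/idP => [qx|tx]; last exact: ge_inf.
apply: le_trans (distr_fun_nd qx).
apply: (cvgr_to_ge (distr_fun_right (x := quantile t))).
near=> y; have qy : quantile t < y by near: y; exact: nbhs_right_gt.
have [s Ss sy] := inf_lt S0 qy.
exact: le_trans (distr_fun_nd (ltW sy)).
Unshelve. all: by end_near. Qed.

End quantile_of.
End quantile.

Lemma measurable_norm_ge (R : realType) (a : R) :
  measurable ([set x | a <= `|x|] : set (measurableTypeR R)).
Proof.
have -> : [set x | a <= `|x|] = setT `&` (fun x : R => `|x|) @^-1` `[a, +oo[%classic.
  by apply/seteqP; split => x /=; rewrite in_itv/= andbT => //; case.
exact: (@normr_measurable R setT measurableT _ (@measurable_itv R _)).
Qed.

Lemma bounded_integrable (R : realType) (m : probability (measurableTypeR R) R)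
    (f : R -> R) (B : R) : measurable_fun setT f -> (forall x, `|f x| <= B) ->
  m.-integrable setT (EFin \o f).
Proof.
move=> mf fB; apply: (@le_integrable _ (measurableTypeR R) R m setT measurableT
  (EFin \o f) (EFin \o cst B)) => //.
- exact/measurable_EFinP.
- by move=> x _; rewrite lee_fin (le_trans (fB x))// ler_norm.
- exact: finite_measure_integrable_cst.
Qed.

Section monotone_rv.
Context {R : realType}.
Variable q : R -> R.
Hypothesis nd : {in `]0, 1[ &, nondecreasing_fun q}.

Definition mono_rv : {RV (@unif01 R) >-> measurableTypeR R} :=
  @mfun_Sub _ _ (measurableTypeR R) (measurableTypeR R) (unit_ext q) (mem_set (measurable_unit_ext nd)).

End monotone_rv.

Section quantile_representation.
Context {R : realType}.
Variable m : probability (measurableTypeR R) R.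

Lemma quantile_nd : {in `]0, 1[ &, nondecreasing_fun (quantile m)}.
Proof.
move=> s t s01 t01 st; rewrite quantile_le//; apply: (le_trans st).
by rewrite -quantile_le.
Qed.

(** By [quantile_le], the quantile function pulls back the interval from a to
    b to the interval between the values of the distribution function. *)
Lemma quantile_distribution A : measurable A ->
  distribution unif01 (mono_rv quantile_nd) A = m A.
Proof.
apply: (@measure_unique _ R (measurableTypeR R) (@ocitv R)
  (fun n => `]- n%:R, n%:R]%classic) _ _ _ _ (distribution unif01 (mono_rv quantile_nd)) m) => //.
- exact: ocitvI.
- by move=> n; exact: is_ocitv.
- exact: bigcup_itvT.
- move=> _ [[a b] _ <-] /=; have [ab|ba] := leP a b; last first.
    by rewrite set_itv_ge ?measure0// -leNgt bnd_simp ltW.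
  have mab : measurable (`]a, b]%classic : set (measurableTypeR R)) by exact: measurable_itv.
  rewrite /distribution /pushforward.
  rewrite (unif01_eq (B := `](distr_fun m a), (distr_fun m b)]%classic)).
  + rewrite unif01_itv ?distr_fun_ge0 ?distr_fun_le1 ?distr_fun_nd//.
    rewrite EFinB !fineK ?fin_num_measure//.
    have -> : `]a, b]%classic = `]-oo, b] `\` `]-oo, a] :> set R.
      by rewrite -[RHS]setCK setCD setCitvl setUC -[LHS]setCK setCitv.
    rewrite measureD ?setIidr//; first exact: subset_itvl.
    by rewrite -ge0_fin_numE// fin_num_measure.
  + rewrite -[_ @^-1` _]setTI; exact: (measurable_unit_ext quantile_nd).
  + exact: measurable_itv.
  + apply/seteqP; split => t /= [h t01]; split => //; move: h;
      rewrite !in_itv/= /unit_ext; move: (t01); rewrite in_itv/= => ->.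
      by rewrite !ltNge !quantile_le.
    by rewrite !ltNge !quantile_le.
- by move=> n; rewrite (le_lt_trans (probability_le1 _ _))// ltry.
Qed.

Lemma integral_quantile (f : R -> R) (B : R) : measurable_fun setT f ->
  (forall x, `|f x| <= B) ->
  (\int[m]_x (f x)%:E = \int[unif01]_t (f (mono_rv quantile_nd t))%:E)%E.
Proof.
move=> mf fB; have mF : measurable_fun setT (EFin \o f) by exact/measurable_EFinP.
have := @integral_distribution _ _ (measurableTypeR R) (measurableTypeR R) R unif01
  (mono_rv quantile_nd) (EFin \o f) mF; rewrite /comp => <-.
  by apply: eq_measure_integral => A mA _; exact/esym/quantile_distribution.
apply: (@bounded_integrable R unif01 (f \o mono_rv quantile_nd) B).
  by apply: measurableT_comp => //; exact: (measurable_unit_ext quantile_nd).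
by move=> t; exact: fB.
Qed.

(** A Chebyshev bound on the tails confines the quantiles. *)
Lemma quantile_bound (C t : R) : 0 <= C ->
  (forall a, 0 < a -> (m [set x | (a <= `|x|)%R] <= (C / a ^+ 2)%:E)%E) -> t \in `]0, 1[ ->
  `|quantile m t| <= C / t + C / (1 - t) + 1.
Proof.
move=> C0 tail t01; move: (t01); rewrite in_itv/= => /andP[t0 t1].
have t1' : 0 < 1 - t by rewrite subr_gt0.
(* As a >= 1, C / a ^+ 2 is at most C / a, which is below both t and 1 - t. *)
pose a := C / t + C / (1 - t) + 1.
have Ct : 0 <= C / t by rewrite divr_ge0// ltW.
have Ct' : 0 <= C / (1 - t) by rewrite divr_ge0// ltW.
have a1 : 1 <= a by rewrite /a; lra.
have a0 : 0 < a by rewrite (lt_le_trans ltr01).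
have aa : a <= a ^+ 2 by rewrite expr2 ler_peMr// ltW.
have ta : C / a ^+ 2 < t.
  rewrite ltr_pdivrMr ?exprn_gt0// mulrC -ltr_pdivrMr// (lt_le_trans _ aa)// /a; lra.
have ta' : C / a ^+ 2 < 1 - t.
  rewrite ltr_pdivrMr ?exprn_gt0// mulrC -ltr_pdivrMr// (lt_le_trans _ aa)// /a; lra.
have {}tail := tail _ a0.
have mtail := measurable_norm_ge a.
have low : distr_fun m (- a) < t.
  apply: le_lt_trans ta; rewrite -lee_fin fineK ?fin_num_measure//.
  apply: le_trans tail; apply: le_measure; rewrite ?inE//.
  by move=> x /=; rewrite in_itv/= => xa; rewrite ler_normr lerNr xa orbT.
have high : t <= distr_fun m a.
  rewrite leNgt; apply/negP => Fa; move: ta'; apply/negP; rewrite -leNgt -lee_fin.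
  apply: le_trans tail.
  apply: (@le_trans _ _ (m (~` `]-oo, a]%classic))).
    rewrite probability_setC// -[X in (1 - X)%E]fineK ?fin_num_measure// -EFinB lee_fin.
    by rewrite lerD2l lerN2 ltW.
  apply: le_measure; rewrite ?inE//; first exact: measurableC.
  by move=> x /=; rewrite in_itv/= => /negP; rewrite -ltNge => ax; rewrite ler_normr ltW.
rewrite ler_norml quantile_le// high andbT leNgt; apply/negP => /ltW.
by rewrite quantile_le// leNgt low.
Qed.

End quantile_representation.

(** * Helly selection *)

Section monotone_limits.
Context {R : realType}.
Implicit Types (q : R -> R) (s t : R).

Definition unit_mono q := {in `]0, 1[ &, nondecreasing_fun q}.

Lemma unit_mono_left q t : unit_mono q -> t \in `]0, 1[ -> cvg (q x @[x --> t^'-]).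
Proof.
move=> nd t01; move: (t01); rewrite in_itv/= => /andP[t0 t1].
apply: nondecreasing_at_left_is_cvgr.
  near=> x; have x0 : 0 <= x by near: x; exact: nbhs_left_ge.
  move=> u v; rewrite !in_itv/= => /andP[xu ut] /andP[xv vt]; apply: nd; rewrite in_itv/=.
    by rewrite (le_lt_trans x0 xu) (lt_trans ut t1).
  by rewrite (le_lt_trans x0 xv) (lt_trans vt t1).
near=> x; have x0 : 0 <= x by near: x; exact: nbhs_left_ge.
exists (q t) => _ [y xyt <-]; move: xyt; rewrite /= in_itv/= => /andP[xy yt]; apply: nd => //; last exact: ltW.
by rewrite in_itv/= (le_lt_trans x0 xy) (lt_trans yt t1).
Unshelve. all: by end_near. Qed.

Lemma unit_mono_right q t : unit_mono q -> t \in `]0, 1[ -> cvg (q x @[x --> t^'+]).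
Proof.
move=> nd t01; move: (t01); rewrite in_itv/= => /andP[t0 t1].
apply: nondecreasing_at_right_is_cvgr.
  near=> x; have x1 : x <= 1 by near: x; exact: nbhs_right_le.
  move=> u v; rewrite !in_itv/= => /andP[tu ux] /andP[tv vx]; apply: nd; rewrite in_itv/=.
    by rewrite (lt_trans t0 tu) (lt_le_trans ux x1).
  by rewrite (lt_trans t0 tv) (lt_le_trans vx x1).
near=> x; have x1 : x <= 1 by near: x; exact: nbhs_right_le.
exists (q t) => _ [y xyt <-]; move: xyt; rewrite /= in_itv/= => /andP[ty yx]; apply: nd => //; last exact: ltW.
by rewrite in_itv/= (lt_trans t0 ty) (lt_le_trans yx x1).
Unshelve. all: by end_near. Qed.

(** Monotonicity squeezes the values at a continuity point between values at
    rational points. *)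
Lemma unit_mono_cvg (q_ : nat -> R -> R) q t : (forall k, unit_mono (q_ k)) -> unit_mono q ->
  (forall r : rat, (ratr r : R) \in `]0, 1[ -> q_ k (ratr r) @[k --> \oo] --> q (ratr r)) ->
  t \in `]0, 1[ -> ~ discontinuity q t -> q_ k t @[k --> \oo] --> q t.
Proof.
move=> nd_ nd qr t01 dt; move: (t01); rewrite in_itv/= => /andP[t0 t1].
have cl := unit_mono_left nd t01; have cr := unit_mono_right nd t01.
have lr : lim (q x @[x --> t^'-]) = lim (q x @[x --> t^'+]).
  by apply/eqP; apply/negPn/negP => h; apply: dt.
have ql : lim (q x @[x --> t^'-]) <= q t.
  apply: limr_le => //; near=> x.
  have x0 : 0 < x by near: x; exact: nbhs_left_gt.
  have xt : x <= t by near: x; exact: nbhs_left_le.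
  by apply: nd => //; rewrite in_itv/= x0 (le_lt_trans xt t1).
have qR : q t <= lim (q x @[x --> t^'+]).
  apply: limr_ge => //; near=> x.
  have x1 : x < 1 by near: x; exact: nbhs_right_lt.
  have xt : t <= x by near: x; exact: nbhs_right_ge.
  by apply: nd => //; rewrite in_itv/= x1 (lt_le_trans t0 xt).
have qE : q t = lim (q x @[x --> t^'-]) by apply/le_anti; rewrite ql lr qR.
have cl' : q x @[x --> t^'-] --> q t by rewrite qE.
have cr' : q x @[x --> t^'+] --> q t by rewrite qE lr.
apply/cvgrPdist_lt => e e0.
have [s [s01 st qs]] : exists s : rat, [/\ (ratr s : R) \in `]0, 1[, (ratr s : R) <= t & q t - e < q (ratr s)].
  have te : q t - e < q t by rewrite ltrBlDr ltrDl.
  have [x [x0 xt qx]] : exists x, [/\ 0 < x, x < t & q t - e < q x].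
    have t0' : 0 < t by [].
    near (t^'-) => x; exists x; split.
    - by near: x; exact: nbhs_left_gt.
    - by near: x; exact: nbhs_left_lt.
    - by near: x; exact: (cvgr_gt _ cl' _ te).
  have [s] := rat_in_itvoo xt; rewrite in_itv/= => /andP[xs st].
  have s01 : (ratr s : R) \in `]0, 1[ by rewrite in_itv/= (lt_trans x0 xs) (lt_trans st t1).
  exists s; split => //; first exact: ltW.
  by apply: (lt_le_trans qx); apply: nd; rewrite ?ltW// in_itv/= x0 (lt_trans xt t1).
have [u [u01 tu qu]] : exists u : rat, [/\ (ratr u : R) \in `]0, 1[, t <= (ratr u : R) & q (ratr u) < q t + e].
  have te : q t < q t + e by rewrite ltrDl.
  have [x [x1 tx qx]] : exists x, [/\ x < 1, t < x & q x < q t + e].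
    near (t^'+) => x; exists x; split.
    - by near: x; exact: nbhs_right_lt.
    - by near: x; exact: nbhs_right_gt.
    - by near: x; exact: (cvgr_lt _ cr' _ te).
  have [u] := rat_in_itvoo tx; rewrite in_itv/= => /andP[tu ux].
  have u01 : (ratr u : R) \in `]0, 1[ by rewrite in_itv/= (lt_trans t0 tu) (lt_trans ux x1).
  exists u; split => //; first exact: ltW.
  by apply: (le_lt_trans _ qx); apply: nd; rewrite ?ltW// in_itv/= x1 (lt_trans t0 tx).
near=> k.
have h1 : q t - e < q_ k (ratr s) by near: k; exact: (cvgr_gt _ (qr s s01) _ qs).
have h2 : q_ k (ratr u) < q t + e by near: k; exact: (cvgr_lt _ (qr u u01) _ qu).
rewrite distrC ltr_distl (lt_le_trans h1) ?(le_lt_trans _ h2)//; exact: nd_.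
Unshelve. all: by end_near. Qed.

Lemma unit_mono_discontinuity_null q : unit_mono q ->
  (@unif01 R).-negligible [set t | (t \in `]0, 1[) /\ discontinuity q t].
Proof.
move=> nd; set D := [set t | _].
have cD : countable D.
  apply: (@sub_countable _ _ _ (\bigcup_n
    [set t | (t \in `]n.+2%:R^-1, 1 - n.+2%:R^-1[) /\ discontinuity q t])).
    apply: subset_card_le => t [+ dt]; rewrite in_itv/= => /andP[t0 t1].
    have m0 : 0 < Num.min t (1 - t) by rewrite lt_min t0 subr_gt0.
    exists (Num.truncn (Num.min t (1 - t))^-1) => //; split => //.
    set n := Num.truncn _.
    have : n.+2%:R^-1 < Num.min t (1 - t).
      rewrite invf_plt ?posrE ?ltr0n//; apply: lt_le_trans (truncnS_gt _) _.
      by rewrite ler_nat.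
    by rewrite lt_min in_itv/= => /andP[-> h]; rewrite /= ltrBrDr addrC -ltrBrDr.
  apply: bigcup_countable => // n _; apply: discontinuity_countable.
  have h : 0 < n.+2%:R^-1 :> R by rewrite invr_gt0 ltr0n.
  have sub (u : R) : u \in `[n.+2%:R^-1, 1 - n.+2%:R^-1] -> u \in `]0, 1[.
    rewrite !in_itv/= => /andP[u0 u1].
    by rewrite (lt_le_trans h u0) (le_lt_trans u1)// gtrBl.
  by move=> u v /sub u01 /sub v01; exact: nd.
have mD : measurable (D : set (measurableTypeR R)).
  by apply: countable_measurable => // t; exact: measurable_set1.
exists D; split => //.
apply: (null_content_dominatesP _ _).1 (@dominates_uniform_prob R 0 1 ltr01) _ mD _.
exact: countable_lebesgue_measure0.
Qed.

End monotone_limits.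

Section selection.
Context {R : realType}.

(** Limits along an ultrafilter exist without extraction of subsequences,
    hence at all points simultaneously. *)
Lemma ultra_bounded_cvg (U : set_system nat) (x_ : nat -> R) B : UltraFilter U ->
  (forall n, `|x_ n| <= B) -> exists x, forall e, 0 < e -> U [set n | `|x_ n - x| < e].
Proof.
move=> UU xB; have FP : ProperFilter (x_ @ U) by exact: fmap_proper_filter.
have FB : U [set n | x_ n \in `[- B, B]].
  by apply: (filterS _ (@filterT _ U _)) => n _; rewrite /= in_itv/= -ler_norml.
have [x [_ cx]] := @segment_compact R (- B) B (x_ @ U) FP FB.
exists x => e e0; have [//|Uc] := in_ultra_setVsetC [set n | `|x_ n - x| < e] UU.
have nx : nbhs x (ball x e) by exact: nbhsx_ballx.
have [y [/= yc yx]] := cx [set y | ~ `|y - x| < e] (ball x e) Uc nx.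
by case: yc; rewrite distrC.
Qed.

(** The limit q is taken along an ultrafilter that contains S. The first k
    rational points and the accuracy 1 / (k + 1) define a set of the
    ultrafilter, from which the index phi k is picked. *)
Lemma unit_mono_selection (q_ : nat -> R -> R) (B : R -> R) (S : set nat) :
  (forall n, unit_mono (q_ n)) ->
  (forall n t, t \in `]0, 1[ -> `|q_ n t| <= B t) ->
  (forall n, exists2 k, (n <= k)%N & S k) ->
  exists q (phi : nat -> nat), [/\ unit_mono q, forall k, (k <= phi k)%N /\ S (phi k) &
    forall r : rat, (ratr r : R) \in `]0, 1[ ->
      q_ (phi k) (ratr r) @[k --> \oo] --> q (ratr r)].
Proof.
move=> nd qB Soo.
have FP : ProperFilter (within S \oo).
  split; last exact: within_filter.
  move=> [N _ /= NS]; have [k Nk Sk] := Soo N.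
  exact: NS k Nk Sk.
have [U [UU FU]] := ultraFilterLemma FP.
have : forall t, exists x, t \in `]0, 1[ -> forall e, 0 < e -> U [set n | `|q_ n t - x| < e].
  move=> t; have [t01|_] := boolP (t \in `]0, 1[); last by exists 0.
  have [x xP] := @ultra_bounded_cvg U (fun n => q_ n t) (B t) UU (fun n => qB n t t01).
  by exists x.
move=> /choice[q qP].
(* An enumeration of the rational numbers. *)
pose r_ i : R := if @unpickle rat i is Some r then ratr r else 0.
have Uk k : U [set n | [/\ (k <= n)%N, S n & forall i, (i < k)%N -> r_ i \in `]0, 1[ ->
    `|q_ n (r_ i) - q (r_ i)| < k.+1%:R^-1]].
  have e0 : 0 < k.+1%:R^-1 :> R by rewrite invr_gt0 ltr0n.
  have UN : U [set n | (k <= n)%N /\ S n].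
    by apply: FU; exists k => // n /= kn Sn.
  suff : forall j, U [set n | forall i, (i < j)%N -> r_ i \in `]0, 1[ ->
      `|q_ n (r_ i) - q (r_ i)| < k.+1%:R^-1].
    by move=> /(_ k) /(filterI UN); apply: filterS => n [[kn Sn] h]; split.
  elim=> [|j IH]; first by apply: filterS filterT => n _ i.
  have [rj|rj] := boolP (r_ j \in `]0, 1[).
    apply: filterS (filterI IH (qP _ rj _ e0)) => n [h hj] i.
    by rewrite ltnS leq_eqVlt => /predU1P[-> _//|]; exact: h.
  apply: filterS IH => n h i; rewrite ltnS leq_eqVlt => /predU1P[->|]; last exact: h.
  by move=> hj; rewrite hj in rj.
have : forall k, exists n, [/\ (k <= n)%N, S n & forall i, (i < k)%N -> r_ i \in `]0, 1[ ->
    `|q_ n (r_ i) - q (r_ i)| < k.+1%:R^-1] by move=> k; exact: filter_ex (Uk k).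
move=> /choice[phi phiP]; exists q, phi; split.
- move=> s t s01 t01 st; rewrite leNgt; apply/negP => qts.
  have e0 : 0 < (q s - q t) / 2 by rewrite divr_gt0// subr_gt0.
  have [n [/= hs ht]] := filter_ex (filterI (qP _ s01 _ e0) (qP _ t01 _ e0)).
  have := nd n _ _ s01 t01 st; move: hs ht; rewrite !ltr_distl => /andP[a b] /andP[c d'].
  lra.
- by move=> k; have [] := phiP k.
- move=> r r01; apply/cvgrPdist_lt => e e0; near=> k.
  have [_ _ /(_ (pickle r))] := phiP k; rewrite /r_ pickleK distrC => h.
  apply: lt_trans (h _ r01) _; first by near: k; exact: nbhs_infty_gt.
  near: k; exists (Num.truncn e^-1) => // k /= ek.
  rewrite invf_plt ?posrE ?ltr0n//; apply: lt_le_trans (truncnS_gt _) _.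
  by rewrite ler_nat.
Unshelve. all: by end_near. Qed.

(** All laws are realized by quantile functions on the unit interval, where
    pointwise convergence fails at most at the countably many discontinuities
    of the limit; dominated convergence then applies. *)
Lemma helly_selection (mu_ : nat -> probability (measurableTypeR R) R) (C : R) (S : set nat) :
  0 <= C ->
  (forall n a, 0 < a -> (mu_ n [set x | (a <= `|x|)%R] <= (C / a ^+ 2)%:E)%E) ->
  (forall n, exists2 k, (n <= k)%N & S k) ->
  exists (mu : probability (measurableTypeR R) R) (phi : nat -> nat),
    (forall k, (k <= phi k)%N /\ S (phi k)) /\
    forall (f : R -> R) (B : R), continuous f -> (forall x, `|f x| <= B) ->
      (\int[mu_ (phi k)]_x (f x)%:E @[k --> \oo] --> \int[mu]_x (f x)%:E)%E.
Proof.
move=> C0 tail Soo.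
have [q [phi [nd phiS qr]]] := unit_mono_selection (fun n => @quantile_nd R (mu_ n))
  (fun n t => @quantile_bound R (mu_ n) C t C0 (tail n)) Soo.
exists (distribution unif01 (mono_rv nd)), phi; split => // f B cf fB.
have mf : measurable_fun setT f by exact: continuous_measurable_fun.
have mF : measurable_fun setT (EFin \o f) by exact/measurable_EFinP.
have mq (p : R -> R) (pd : unit_mono p) : measurable_fun setT (f \o mono_rv pd).
  by apply: measurableT_comp => //; exact: (measurable_unit_ext pd).
have := @integral_distribution _ _ (measurableTypeR R) (measurableTypeR R) R unif01
  (mono_rv nd) (EFin \o f) mF; rewrite /comp => ->; last first.
  exact: (@bounded_integrable R unif01 (f \o mono_rv nd) B (mq _ nd) (fun t => fB _)).
under eq_fun do rewrite (@integral_quantile R _ f B mf fB).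
have [] := @dominated_convergence _ (measurableTypeR R) R unif01 setT measurableT
  (fun k t => (f (mono_rv (@quantile_nd R (mu_ (phi k))) t))%:E)
  (fun t => (f (mono_rv nd t))%:E) (fun=> B%:E).
- by move=> k; apply/measurable_EFinP; exact: mq.
- by apply/measurable_EFinP; exact: mq.
- apply: negligibleS (unit_mono_discontinuity_null nd) => t /= /existsNP[_ h].
  have [t01|t01] := boolP (t \in `]0, 1[).
    split => //; apply: contrapT => dt; apply: h.
    apply: cvg_EFin; first exact: nearW.
    apply: continuous_cvg; first exact: cf.
    rewrite /= /unit_ext; move: (t01); rewrite in_itv/= => ->.
    exact: (unit_mono_cvg (fun k => @quantile_nd R (mu_ (phi k))) nd qr t01 dt).
  exfalso; apply: h; rewrite /= /unit_ext; move: t01; rewrite in_itv/= => /negbTE ->.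
  exact: cvg_cst.
- exact: finite_measure_integrable_cst.
- by apply: aeW => t k _ /=; rewrite lee_fin.
- by [].
Qed.

End selection.

(** * The method of moments *)

Section truncation.
Context {R : realType}.
Implicit Types (e x y : R).

(** A bounded continuous approximation of the identity, with an error
    quadratic in the argument. *)
Definition soft_trunc e y : R := y / (1 + (e * y) ^+ 2).

Let den_gt0 e y : 0 < 1 + (e * y) ^+ 2.
Proof. by rewrite ltr_pwDl// sqr_ge0. Qed.

Lemma soft_trunc_le e y : 0 < e -> `|soft_trunc e y| <= e^-1.
Proof.
move=> e0; rewrite /soft_trunc normrM normfV (gtr0_norm (den_gt0 e y)).
rewrite ler_pdivrMr// -ler_pdivrMl ?invr_gt0// invrK.
have := sqr_ge0 (`|e * y| - 1); rewrite sqrrB expr1n mulr1 real_normK ?num_real//.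
have -> : e * `|y| = `|e * y| by rewrite normrM (gtr0_norm e0).
have := normr_ge0 (e * y); rewrite mulr2n; lra.
Qed.

Lemma soft_trunc_dist e y : 0 < e -> `|y - soft_trunc e y| <= e * y ^+ 2.
Proof.
move=> e0; have -> : y - soft_trunc e y = y * (e * y) ^+ 2 / (1 + (e * y) ^+ 2).
  by rewrite /soft_trunc; field; rewrite gt_eqF// den_gt0.
rewrite normrM normfV (gtr0_norm (den_gt0 e y)) ler_pdivrMr//.
rewrite normrM (ger0_norm (sqr_ge0 (e * y))).
have -> : `|y| * (e * y) ^+ 2 = e * y ^+ 2 * `|e * y| by rewrite normrM (gtr0_norm e0); ring.
apply: ler_wpM2l; first by rewrite mulr_ge0 ?sqr_ge0// ltW.
have := sqr_ge0 (`|e * y| - 1); rewrite sqrrB expr1n mulr1 real_normK ?num_real//.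
have := normr_ge0 (e * y); rewrite mulr2n; lra.
Qed.

Lemma soft_trunc_ge0 e y : 0 <= y -> 0 <= soft_trunc e y <= y.
Proof.
move=> y0; rewrite divr_ge0 ?(ltW (den_gt0 _ _))//= ler_pdivrMr// ler_peMr//.
by rewrite lerDl sqr_ge0.
Qed.

Lemma soft_trunc_mono e e' y : 0 <= y -> 0 < e' <= e -> soft_trunc e y <= soft_trunc e' y.
Proof.
move=> y0 /andP[e0 ee]; rewrite ler_wpM2l// lef_pV2 ?posrE ?den_gt0// lerD2l.
by rewrite lerXn2r ?nnegrE ?mulr_ge0 ?(ltW e0) ?(le_trans (ltW e0) ee)// ler_wpM2r.
Qed.

Lemma continuous_soft_trunc e k : continuous (fun x => soft_trunc e (x ^+ k)).
Proof.
move=> x; apply: cvgM; first exact: exprn_continuous.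
apply: cvgV; first by rewrite gt_eqF.
apply: cvgD; first exact: cvg_cst.
have h : (fun y : R => e * y ^+ k) @ x --> e * x ^+ k.
  by apply: cvgM; [exact: cvg_cst|exact: exprn_continuous].
exact: (cvgM h h).
Qed.

Lemma soft_trunc_cvg y : 0 <= y -> soft_trunc n.+1%:R^-1 y @[n --> \oo] --> y.
Proof.
move=> y0.
have c0 : y - n.+1%:R^-1 * y ^+ 2 @[n --> \oo] --> y.
  rewrite -[X in _ --> X]subr0 -[X in _ - X](mul0r (y ^+ 2)).
  apply: cvgB; first exact: cvg_cst.
  by apply: cvgM; [exact: cvg_harmonic|exact: cvg_cst].
apply: (@squeeze_cvgr _ _ _ _ (fun n => y - n.+1%:R^-1 * y ^+ 2) (fun=> y) _ _ _ c0); last exact: cvg_cst.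
apply: nearW => n; have /andP[_ ->] := soft_trunc_ge0 n.+1%:R^-1 y0; rewrite andbT.
have := soft_trunc_dist y (_ : 0 < n.+1%:R^-1); rewrite invr_gt0 ltr0n => /(_ isT).
by move=> /(le_trans (ler_norm _)); rewrite lerBlDr addrC -lerBlDr.
Qed.

End truncation.

Section moment_limit.
Context {R : realType}.
Implicit Types (m mu : probability (measurableTypeR R) R) (v u : nat -> R) (e : R) (k : nat).

Lemma has_moments_tail m v (a : R) : has_moments m v -> 0 < a ->
  (m [set x | (a <= `|x|)%R] <= (v 2%N / a ^+ 2)%:E)%E.
Proof.
move=> mv a0; have [I E] := mv 2%N.
have mtail := measurable_norm_ge a.
have mx : measurable_fun setT (fun x : R => (x ^+ 2)%:E) by case/integrableP: I.
have a2 : 0 < a ^+ 2 by rewrite exprn_gt0.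
rewrite EFinM lee_pdivlMr// muleC -E.
rewrite -[X in (_ * m X)%E](@setIT _ _).
rewrite -(@integral_indic _ (measurableTypeR R) R m setT measurableT _ mtail).
rewrite -ge0_integralZl//; last 2 first.
- by apply/measurable_EFinP; exact: measurable_indic.
- by rewrite lee_fin ltW.
apply: (@ge0_le_integral _ (measurableTypeR R) R m setT measurableT) => //.
- by move=> x _; rewrite mule_ge0// lee_fin// ltW.
- by apply: measurable_funeM; apply/measurable_EFinP; exact: measurable_indic.
- move=> x _; rewrite indicE -EFinM lee_fin; have [|_] := boolP (_ \in _).
    rewrite inE/= mulr1 => ax; rewrite -[leRHS]real_normK ?num_real//.
    by rewrite lerXn2r ?nnegrE// ltW.
  by rewrite mulr0 sqr_ge0.
Qed.

Lemma soft_trunc_integrable m e k : 0 < e ->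
  m.-integrable setT (EFin \o (fun x => soft_trunc e (x ^+ k))).
Proof.
move=> e0; apply: (@bounded_integrable R _ _ e^-1).
  exact: (continuous_measurable_fun (@continuous_soft_trunc R e k)).
by move=> x; exact: soft_trunc_le.
Qed.

Lemma soft_trunc_moment_dist m v e k : has_moments m v -> 0 < e ->
  `|v k - \int[m]_x soft_trunc e (x ^+ k)| <= e * v (k + k)%N.
Proof.
move=> mv e0; have [I E] := mv k; have [J F] := mv (k + k)%N.
have vE : v k = \int[m]_x (x ^+ k) by rewrite /Rintegral E.
have vF : v (k + k)%N = \int[m]_x (x ^+ (k + k)) by rewrite /Rintegral F.
have Is := soft_trunc_integrable m k e0.
rewrite vE vF -RintegralB// -RintegralZl//.
have Id : m.-integrable setT (EFin \o (fun x => x ^+ k - soft_trunc e (x ^+ k))).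
  apply: (@eq_integrable _ (measurableTypeR R) R m setT measurableT
    ((fun x : R => (x ^+ k)%:E) \- (EFin \o (fun x => soft_trunc e (x ^+ k))))%E) => //.
  exact: integrableB.
apply: (le_trans (le_normr_Rintegral measurableT Id)); apply: le_Rintegral => //.
- exact: integrable_norm Id.
- apply: (@eq_integrable _ (measurableTypeR R) R m setT measurableT
    (fun x : R => e%:E * (x ^+ (k + k))%:E)%E) => //.
  exact: integrableZl.
- by move=> x _; rewrite exprD -expr2; exact: soft_trunc_dist.
Qed.

Section limit.
Variables (nu_ : nat -> probability (measurableTypeR R) R) (v_ : nat -> nat -> R) (u : nat -> R).
Variable mu : probability (measurableTypeR R) R.
Hypothesis nuv : forall n, has_moments (nu_ n) (v_ n).
Hypothesis vu : forall k, v_ n k @[n --> \oo] --> u k.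
Hypothesis weak : forall (f : R -> R) (B : R), continuous f -> (forall x, `|f x| <= B) ->
  (\int[nu_ n]_x (f x)%:E @[n --> \oo] --> \int[mu]_x (f x)%:E)%E.

Let weakR e k : 0 < e ->
  \int[nu_ n]_x soft_trunc e (x ^+ k) @[n --> \oo] --> \int[mu]_x soft_trunc e (x ^+ k).
Proof.
move=> e0; apply: fine_cvg; rewrite fineK; last first.
  by apply: integrable_fin_num => //; exact: soft_trunc_integrable.
by apply: (weak (B := e^-1)); [exact: continuous_soft_trunc|move=> x; exact: soft_trunc_le].
Qed.

Let even_moment k : (\int[mu]_x (x ^+ (k + k))%:E <= (u (k + k))%:E)%E.
Proof.
have p0 (x : R) : 0 <= x ^+ (k + k) by rewrite exprD -expr2 sqr_ge0.
pose g n x := (soft_trunc n.+1%:R^-1 (x ^+ (k + k)) : R)%:E.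
have n0 n : 0 < n.+1%:R^-1 :> R by rewrite invr_gt0 ltr0n.
have Is n := soft_trunc_integrable mu (k + k) (n0 n).
have mg n : measurable_fun setT (g n) by case/integrableP: (Is n).
have g0 n x : setT x -> (0 <= g n x)%E.
  by move=> _; rewrite lee_fin; have /andP[] := soft_trunc_ge0 n.+1%:R^-1 (p0 x).
have mono x : setT x -> {homo g^~ x : n k / (n <= k)%N >-> (n <= k)%E}.
  move=> _ i j ij; rewrite lee_fin soft_trunc_mono// n0/= lef_pV2 ?posrE ?ltr0n//.
  by rewrite ler_nat.
have cvg := @cvg_monotone_convergence _ (measurableTypeR R) R mu setT measurableT g mg g0 mono.
have -> : (\int[mu]_x (x ^+ (k + k))%:E = \int[mu]_x limn (g^~ x))%E.
  apply: eq_integral => x _; apply/esym/cvg_lim => //.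
  by apply: cvg_EFin; [exact: nearW|exact: soft_trunc_cvg].
rewrite -(cvg_lim _ cvg)//; apply: lime_le; first by apply/cvg_ex; eexists; exact: cvg.
apply: nearW => n; rewrite -[leLHS]fineK; last exact: integrable_fin_num (Is n).
rewrite lee_fin; apply: (ler_cvg_to (@weakR _ (k + k)%N (n0 n)) (@vu (k + k)%N)).
apply: nearW => i; have [I E] := nuv i (k + k)%N.
rewrite -[leRHS]/(fine (v_ i (k + k)%N)%:E) -E; apply: le_Rintegral => //.
  exact: soft_trunc_integrable.
by move=> x _; have /andP[] := soft_trunc_ge0 n.+1%:R^-1 (p0 x).
Qed.

Let mu_integrable k : mu.-integrable setT (fun x : R => (x ^+ k)%:E).
Proof.
have mX j : measurable_fun setT (fun x : R => (x ^+ j)%:E).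
  by apply/measurable_EFinP; exact: exprn_measurable.
have I2 : mu.-integrable setT (fun x : R => (x ^+ (k + k))%:E).
  apply/integrableP; split; first exact: mX.
  apply: (@le_lt_trans _ _ (u (k + k)%N)%:E); last exact: ltry.
  apply: le_trans (even_moment k); rewrite le_eqVlt; apply/orP; left; apply/eqP.
  by apply: eq_integral => x _; rewrite gee0_abs// lee_fin exprD -expr2 sqr_ge0.
apply: (@le_integrable _ (measurableTypeR R) R mu setT measurableT _
  (cst 1%E \+ (fun x : R => (x ^+ (k + k))%:E))%E).
- exact: mX.
- move=> x _ /=; rewrite lee_fin exprD -expr2 [leRHS]ger0_norm ?addr_ge0 ?sqr_ge0//.
  have := sqr_ge0 (`|x ^+ k| - 1); rewrite sqrrB expr1n mulr1 real_normK ?num_real//.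
  have := normr_ge0 (x ^+ k); rewrite mulr2n; lra.
- by apply: integrableD => //; exact: finite_measure_integrable_cst.
Qed.

(** The error made by truncating x^k is at most e times the moment of order
    2k, uniformly along the sequence and, by monotone convergence, also for
    the limit law. *)
Lemma has_moments_limit : has_moments mu u.
Proof.
have mf : has_moments mu (fun k => fine (\int[mu]_x (x ^+ k)%:E)%E).
  move=> k; split; first exact: mu_integrable.
  by rewrite fineK//; apply: integrable_fin_num.
move=> k; have [I ->] := mf k; split => //; congr EFin; set a := fine _.
have bound e : 0 < e -> `|a - u k| <= e * (u (k + k)%N + u (k + k)%N).
  move=> e0.
  have h1 : `|a - \int[mu]_x soft_trunc e (x ^+ k)| <= e * u (k + k)%N.
    apply: (le_trans (soft_trunc_moment_dist k mf e0)); rewrite ler_wpM2l ?(ltW e0)//.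
    rewrite -lee_fin fineK ?even_moment//; exact: integrable_fin_num (mu_integrable _).
  have h2 : `|u k - \int[mu]_x soft_trunc e (x ^+ k)| <= e * u (k + k)%N.
    apply: (@ler_cvg_to _ _ _ _ (fun n => `|v_ n k - \int[nu_ n]_x soft_trunc e (x ^+ k)|)
      (fun n => e * v_ n (k + k)%N) _ _ (cvg_norm (cvgB (@vu k) (@weakR e k e0))) (cvgM (cvg_cst e) (@vu (k + k)%N))).
    by apply: nearW => n; exact: (soft_trunc_moment_dist k (nuv n) e0).
  rewrite mulrDr; apply: le_trans (lerD h1 h2); rewrite (distrC (u k)).
  by apply: ler_distD.
have u0 : 0 <= u (k + k)%N.
  rewrite -lee_fin; apply: le_trans (even_moment k); apply: integral_ge0 => x _.
  by rewrite lee_fin exprD -expr2 sqr_ge0.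
apply/eqP; rewrite -subr_eq0 -normr_eq0 eq_le normr_ge0 andbT.
apply/ler_addgt0Pl => e e0; rewrite addr0.
pose K := u (k + k)%N + u (k + k)%N + 1.
have K0 : 0 < K by rewrite /K; lra.
apply: (le_trans (bound (e / K) (divr_gt0 e0 K0))).
rewrite mulrAC ler_pdivrMr// ler_wpM2l ?(ltW e0)// /K; lra.
Qed.

End limit.

(** With S the set of all indices this constructs a law from its moments; a
    general S serves to argue by contradiction about a whole sequence. *)
Lemma moment_selection (nu_ : nat -> probability (measurableTypeR R) R) (v_ : nat -> nat -> R) u
    (S : set nat) :
  (forall n, has_moments (nu_ n) (v_ n)) -> (forall k, v_ n k @[n --> \oo] --> u k) ->
  (forall n, exists2 k, (n <= k)%N & S k) ->
  exists (mu : probability (measurableTypeR R) R) (phi : nat -> nat),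
    [/\ has_moments mu u, (forall k, (k <= phi k)%N /\ S (phi k)) &
    forall (f : R -> R) (B : R), continuous f -> (forall x, `|f x| <= B) ->
      (\int[nu_ (phi k)]_x (f x)%:E @[k --> \oo] --> \int[mu]_x (f x)%:E)%E].
Proof.
move=> nuv vu Soo.
have [C hC] := cvg_bound (cvgP _ (vu 2%N)).
have C0 : 0 <= C by exact: le_trans (normr_ge0 _) (hC 0%N).
have tail n (a : R) : 0 < a -> (nu_ n [set x | (a <= `|x|)%R] <= (C / a ^+ 2)%:E)%E.
  move=> a0; apply: (le_trans (has_moments_tail (nuv n) a0)); rewrite lee_fin.
  by rewrite ler_wpM2r ?invr_ge0 ?sqr_ge0// (le_trans (ler_norm _)).
have [mu [phi [phiS weak]]] := helly_selection C0 tail Soo.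
exists mu, phi; split => //.
have phioo : phi k @[k --> \oo] --> \oo.
  move=> A [N _ NA]; exists N => // k /= Nk; apply: NA => /=.
  by apply: (leq_trans Nk); have [] := phiS k.
apply: (has_moments_limit (fun k => nuv (phi k)) _ weak) => k.
exact: (cvg_comp _ _ phioo (vu k)).
Qed.

(** If convergence failed, a limit law selected along an infinite set of bad
    indices would have the moments of mu, hence would be equal to mu. *)
Theorem method_of_moments (nu_ : nat -> probability (measurableTypeR R) R) (v_ : nat -> nat -> R) u
    (C : R) (mu : probability (measurableTypeR R) R) :
  (forall n, has_moments (nu_ n) (v_ n)) -> (forall k, v_ n k @[n --> \oo] --> u k) ->
  0 < C -> (forall k, `|u k| <= C ^+ k * k`!%:R) -> has_moments mu u ->
  forall (f : R -> R) (B : R), continuous f -> (forall x, `|f x| <= B) ->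
    (\int[nu_ n]_x (f x)%:E @[n --> \oo] --> \int[mu]_x (f x)%:E)%E.
Proof.
move=> nuv vu C0 uC muu f B cf fB.
have If (m : probability (measurableTypeR R) R) : m.-integrable setT (EFin \o f).
  by apply: (@bounded_integrable R _ _ B) => //; exact: continuous_measurable_fun.
have fin (m : probability (measurableTypeR R) R) : (\int[m]_x (f x)%:E)%E \is a fin_num.
  exact: integrable_fin_num (If m).
rewrite -(fineK (fin mu)); under eq_fun do rewrite -(fineK (fin _)).
apply: cvg_EFin; first exact: nearW.
apply/cvgrPdist_lt => e e0; apply: contrapT => notnear.
pose S := [set n | ~ `|\int[mu]_x f x - \int[nu_ n]_x f x| < e].
have Soo n : exists2 k, (n <= k)%N & S k.
  apply: contrapT => h; apply: notnear; exists n => // k /= nk.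
  by apply: contrapT => Sk; apply: h; exists k.
have [mu' [phi [mu'u phiS weak]]] := moment_selection nuv vu Soo.
have E : (\int[mu']_x (f x)%:E = \int[mu]_x (f x)%:E)%E.
  by apply: eq_measure_integral => A mA _; exact: (moment_determinacy C0 uC).
have := weak f B cf fB; rewrite E -(fineK (fin mu)) => /fine_cvgP[_ /cvgrPdist_lt/(_ e e0)].
move=> [N _ /(_ N (leqnn N))] /=; by have [_] := phiS N.
Qed.

End moment_limit.

(** * The Laguerre ensembles *)

Section empirical_law.
Context {R : realType}.
Variable n : nat.
Variable x : n.+1.-tuple R.

Lemma ge0_integral_empirical (f : R -> R) : measurable_fun setT f -> (forall y, 0 <= f y) ->
  (\int[empirical_measure x]_y (f y)%:E =
   (n.+1%:R^-1 * \sum_(i < n.+1) f (tnth x i))%:E)%E.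
Proof.
move=> mf f0; have mF : measurable_fun [set: measurableTypeR R] (EFin \o f).
  exact/measurable_EFinP.
have F0 (y : measurableTypeR R) : setT y -> (0 <= (EFin \o f) y)%E by rewrite lee_fin.
rewrite /empirical_measure ge0_integral_mscale// ge0_integral_measure_sum//.
rewrite EFinM -sumEFin; congr (_ * _)%E; apply: eq_bigr => i _.
by rewrite (@integral_dirac _ (measurableTypeR R))// diracT mul1e (tnth_nth 0).
Qed.

Let empirical_setT : empirical_measure x setT = 1%E.
Proof.
have := @ge0_integral_empirical (cst 1) (measurable_cst _) (fun=> ler01).
under eq_integral do rewrite /cst/=.
rewrite integral_cst// mul1e => ->; rewrite sumr_const card_ord -mulr_natl mulr1 mulVf//.
Qed.

HB.instance Definition _ := Measure_isProbability.Build _ _ _ (empirical_measure x) empirical_setT.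

Definition empirical_prob : probability (measurableTypeR R) R := empirical_measure x.

Lemma integral_empirical (f : R -> R) : measurable_fun setT f ->
  (\int[empirical_measure x]_y (f y)%:E =
   (n.+1%:R^-1 * \sum_(i < n.+1) f (tnth x i))%:E)%E.
Proof.
move=> mf; rewrite integralE (funerpos f) (funerneg f).
rewrite !ge0_integral_empirical//; last 2 first.
- exact: measurable_funrneg.
- exact: measurable_funrpos.
rewrite -EFinB -mulrBr -sumrB; congr (_ * _)%:E; apply: eq_bigr => i _.
by rewrite -[in RHS](funrposBneg f).
Qed.

Lemma empirical_has_moments : has_moments empirical_prob (fun k => power_mean k x).
Proof.
move=> k; have mX : measurable_fun setT (fun y : R => y ^+ k) by exact: exprn_measurable.
split; last exact: (integral_empirical mX).
apply/integrableP; split; first exact/measurable_EFinP.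
have -> : (\int[empirical_prob]_y `|(y ^+ k)%:E| =
  \int[empirical_measure x]_y (`|y ^+ k| : R)%:E)%E by [].
by rewrite (integral_empirical (f := fun y => `|y ^+ k|)) ?ltry//; exact: measurableT_comp.
Qed.
End empirical_law.

Section weak_limits.
Context {R : realType}.

Lemma cvg_weakly_empirical (x_ : forall N, N.-tuple R) (u : nat -> R) (C : R)
    (mu : probability (measurableTypeR R) R) :
  (forall k, power_mean k (x_ N) @[N --> \oo] --> u k) ->
  0 < C -> (forall k, `|u k| <= C ^+ k * k`!%:R) -> has_moments mu u ->
  cvg_weakly (fun N => empirical_measure (x_ N)) mu.
Proof.
move=> xu C0 uC muu f cf [B [_ fB]].
have xu' k : power_mean k (x_ n.+1) @[n --> \oo] --> u k.
  by rewrite (cvg_shiftS (fun N => power_mean k (x_ N))).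
rewrite -(cvg_shiftS (fun N => \int[empirical_measure (x_ N)]_y (f y)%:E)%E).
apply: (method_of_moments (fun n => empirical_has_moments (x_ n.+1)) xu' C0 uC muu (B := B + 1)) => //.
by move=> y; apply: fB => //; rewrite ltrDl.
Qed.

(** The moment problem has a solution, namely a weak limit of the empirical
    measures, and the growth of the moments makes it unique; the defining
    choice of the spectral measure is therefore not the default one. *)
Lemma spectral_measure_has_moments (J : imatrix) (x_ : forall N, N.-tuple R) (u : nat -> R) (C : R) :
  (forall k, power_mean k (x_ N) @[N --> \oo] --> u k) ->
  0 < C -> (forall k, `|u k| <= C ^+ k * k`!%:R) ->
  (forall k, iexp J k 0 0 = u k) -> has_moments (spectral_measure J) u.
Proof.
move=> xu C0 uC Ju.
have xu' k : power_mean k (x_ n.+1) @[n --> \oo] --> u k.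
  by rewrite (cvg_shiftS (fun N => power_mean k (x_ N))).
have [mu [_ [muu _ _]]] := moment_selection (fun n => empirical_has_moments (x_ n.+1)) xu'
  (S := setT) (fun n => ex_intro2 _ _ n (leqnn n) Logic.I).
have JE nu : has_moments_of J nu <-> has_moments nu u.
  by split=> h k; have [I E] := h k; split => //; rewrite E Ju.
have [/JE h _] : is_spectral_measure J (spectral_measure J).
  apply: xgetPex; exists mu; split; first exact/JE.
  by move=> nu /JE nuu A mA; exact: (moment_determinacy C0 uC).
exact: h.
Qed.

End weak_limits.

Section marchenko_pastur_law.
Context {R : realType}.
Variable gamma : R.
Hypothesis hgamma : 0 < gamma < 1.

HB.instance Definition _ := Measure_isProbability.Build _ _ _ (marchenko_pastur gamma)
  (marchenko_pastur_setT hgamma).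

Definition marchenko_pastur_prob : probability (measurableTypeR R) R := marchenko_pastur gamma.

Lemma marchenko_pastur_has_moments :
  has_moments marchenko_pastur_prob (rec_moment (fun k => 1 - gamma + k%:R * 0) gamma).
Proof.
by move=> k; split; [exact: marchenko_pastur_integrable|exact: marchenko_pastur_moment].
Qed.

End marchenko_pastur_law.

Theorem theorem1p1 (R : realType) (d : measure_display) (T : measurableType d)
    (P : probability T R) (gamma : R) (beta M : nat -> R)
    (lambda : forall N : nat, {RV P >-> N.-tuple R})
    (hgamma : 0 < gamma < 1)
    (hbeta : forall N : nat, (1 <= N)%N -> 0 < beta N)
    (hM : forall N : nat, (1 <= N)%N -> N%:R - 1 < M N)
    (hNM : N%:R / M N @[N --> \oo] --> gamma)
    (hlambda : forall N : nat, (1 <= N)%N ->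
       laguerre_ensemble (beta N) (M N) (lambda N)) :
  (beta N * N%:R @[N --> \oo] --> +oo ->
     {ae P, forall w,
       cvg_weakly (fun N => empirical_measure (lambda N w))
         (marchenko_pastur gamma)}) /\
  (forall c : R, 0 < c -> beta N * N%:R @[N --> \oo] --> 2 * c ->
     {ae P, forall w,
       cvg_weakly (fun N => empirical_measure (lambda N w))
         (nu_spectral gamma c)}).
Proof.
have g0 : 0 < gamma by case/andP: hgamma.
have growth e k := rec_moment_growth (1 - gamma) e gamma k.
have C0 (e : R) : 0 < 1 + `|1 - gamma| + `|e| + `|gamma| by rewrite -!addrA ltr_pwDl// !addr_ge0.
(* The rate 2 / (beta M) fixes the limiting recursion. *)
have rateE N : (0 < N)%N -> 2 / (beta N * M N) = 2 * (N%:R / M N) * (beta N * N%:R)^-1.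
  move=> N0; have bN := hbeta N N0; have MN : 0 < M N.
    by apply: le_lt_trans (hM N N0); rewrite subr_ge0 ler1n.
  by field; rewrite !gt_eqF ?ltr0n.
have rate_cvg l : (beta N * N%:R)^-1 @[N --> \oo] --> l ->
    2 / (beta N * M N) @[N --> \oo] --> 2 * gamma * l.
  move=> bl; have h : 2 * (N%:R / M N) * (beta N * N%:R)^-1 @[N --> \oo] --> 2 * gamma * l.
    by apply: cvgM bl; apply: cvgM hNM; exact: cvg_cst.
  have E : \forall N \near \oo, 2 * (N%:R / M N) * (beta N * N%:R)^-1 = 2 / (beta N * M N).
    by exists 1%N => // N /= N1; rewrite rateE.
  exact: cvg_trans (near_eq_cvg E) h.
split=> [bN|c c0 bN].
- have hkappa : 2 / (beta N * M N) @[N --> \oo] --> (0 : R).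
    rewrite -[X in _ --> X](mulr0 (2 * gamma)); apply: rate_cvg.
    apply/gtr0_cvgV0 => //; exists 1%N => // N /= N1.
    by rewrite mulr_gt0 ?ltr0n// hbeta.
  apply: filterS (laguerre_power_mean_ae hbeta hM hNM hlambda hkappa) => w xu.
  have mp := cvg_weakly_empirical xu (C0 0) (growth 0) (marchenko_pastur_has_moments hgamma).
  exact: mp.
- have hkappa : 2 / (beta N * M N) @[N --> \oo] --> gamma / c.
    have -> : gamma / c = 2 * gamma * (2 * c)^-1 by field; rewrite gt_eqF.
    by apply: rate_cvg; apply: cvgV => //; rewrite gt_eqF// mulr_gt0.
  apply: filterS (laguerre_power_mean_ae hbeta hM hNM hlambda hkappa) => w xu.
  apply: (cvg_weakly_empirical xu (C0 (gamma / c)) (growth (gamma / c))).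
  apply: (spectral_measure_has_moments xu (C0 (gamma / c)) (growth (gamma / c))).
  exact: spectral_matrix_moments.
Qed.
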